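(* Consider types BD1, C1, C2, D3 in infinite dimension (see context). Let $\mathcal{F}_\sigma$ be an $\omega$-isotropic maximal generalized flag compatible with $E$, where $\sigma:\mathbb{N}^*\to(A,\prec)$ is a bijection onto a totally ordered set, and let $\mathbf{X}_\omega=\mathbf{X}_\omega(\mathcal{F}_\sigma,E)$. Consider the following condition on bases $\underline v=(v_1,v_2,\ldots)$ of $\mathbf{V}$: $$(\ast)\quad\omega(v_k,v_\ell)\ne0\ \text{ if and only if }\ \ell=\iota(k).$$ (a) For every $(w,\varepsilon)\in\mathfrak{I}^{\eta,\epsilon}_\infty(N_+,N_-)$ we have $$\boldsymbol{\mathcal{O}}^{\eta,\epsilon}_{(w,\varepsilon)}:=\boldsymbol{\mathcal{O}}_{(w,\varepsilon)}\cap\mathbf{X}_\omega=\{\mathcal{F}_\sigma(\underline v):\underline v\text{ is }(w,\varepsilon)\text{-conjugate and satisfies }(\ast)\}\ne\emptyset,$$ $$\boldsymbol{\mathfrak{O}}^{\eta,\epsilon}_{(w,\varepsilon)}:=\boldsymbol{\mathfrak{O}}_{(w,\varepsilon)}\cap\mathbf{X}_\omega=\{\mathcal{F}_\sigma(\underline v):\underline v\text{ is }(w,\varepsilon)\text{-dual and satisfies }(\ast)\}\ne\emptyset,$$ $$\boldsymbol{\mathcal{O}}^{\eta,\epsilon}_{(w,\varepsilon)}\cap\boldsymbol{\mathfrak{O}}^{\eta,\epsilon}_{(w,\varepsilon)}=\{\mathcal{F}_\sigma(\underline v):\underline v\text{ is }(w,\varepsilon)\text{-conjugate, }(w,\varepsilon)\text{-dual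 and satisfies }(\ast)\}\ne\emptyset.$$ (b) The subsets $\boldsymbol{\mathcal{O}}^{\eta,\epsilon}_{(w,\varepsilon)}$ ($(w,\varepsilon)\in\mathfrak{I}^{\eta,\epsilon}_\infty(N_+,N_-)$) are exactly the $\mathbf{K}$-orbits of $\mathbf{X}_\omega$. The subsets $\boldsymbol{\mathfrak{O}}^{\eta,\epsilon}_{(w,\varepsilon)}$ ($(w,\varepsilon)\in\mathfrak{I}^{\eta,\epsilon}_\infty(N_+,N_-)$) are exactly the $\mathbf{G}^0$-orbits of $\mathbf{X}_\omega$. Moreover $\boldsymbol{\mathcal{O}}^{\eta,\epsilon}_{(w,\varepsilon)}\cap\boldsymbol{\mathfrak{O}}^{\eta,\epsilon}_{(w,\varepsilon)}$ is a single $\mathbf{K}\cap\mathbf{G}^0$-orbit.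
   Context: $\mathbb{N}^*$ is the set of positive integers; $\mathbf{V}$ is a complex vector space with basis $E=(e_1,e_2,\ldots)$; vectors are identified with coordinate columns, $\overline{x}$ is the coordinatewise conjugate. $\mathbf{G}(E)=\{g\in\mathrm{Aut}(\mathbf{V}):g(e_\ell)=e_\ell\text{ for all but finitely many }\ell\}$. $\Omega$ is a block-diagonal $\mathbb{N}^*\times\mathbb{N}^*$-matrix whose diagonal blocks are each $\begin{pmatrix}0&1\\1&0\end{pmatrix}$ or $(1)$ (symmetric case, $\epsilon=1$), or all $\begin{pmatrix}0&1\\-1&0\end{pmatrix}$ (symplectic case, $\epsilon=-1$); $\omega(x,y)={}^tx\,\Omega\,y$; $\mathbf{G}(E,\omega)$ is the subgroup of $\mathbf{G}(E)$ preserving $\omega$. $\iota(\ell)=\ell^*$ is the unique index with $\omega(e_\ell,e_{\ell^*})\ne0$. Fix a partition $\mathbb{N}^*=N_+\sqcup N_-$ into nonempty subsets such that either $\iota(N_+)=N_+$ and $\iota(N_-)=N_-$ (put $\eta=1$), or $\iota(N_+)=N_-$ (put $\eta=-1$). The types are: BD1: $(\eta,\epsilon)=(1,1)$; C2: $(1,-1)$; D3: $(-1,1)$; C1: $(-1,-1)$. $\Phi$ is the diagonal matrix with $\ell$-th entry $\pm1$ for $\ell\in N_\pm$, $\phi(x,y)={}^t\overline{x}\,\Phi\,y$, $\delta(x)=\Phi x$. $\mathbf{K}=\{g\in\mathbf{G}(E,\omega):\delta g=g\delta\}$, $\mathbf{G}^0=\{g\in\mathbf{G}(E,\omega):\phi(gx,gy)=\phi(x,y)\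 \forall x,y\}$. For a basis $\underline v$ of $\mathbf{V}$, $\mathcal{F}_\sigma(\underline v)=\{F'_a,F''_a:a\in A\}$ with $F'_a=\langle v_\ell:\sigma(\ell)\prec a\rangle_{\mathbb C}$, $F''_a=\langle v_\ell:\sigma(\ell)\preceq a\rangle_{\mathbb C}$; $\mathcal{F}_\sigma=\mathcal{F}_\sigma(E)$. A generalized flag $\mathcal{F}$ is $\omega$-isotropic if $F\mapsto F^\perp$ (orthogonal for $\omega$) is a well-defined involution of the set $\mathcal{F}$; for $\mathcal{F}_\sigma$ this means that $A$ has an involutive order-reversing bijection $\iota_A$ with $\sigma\iota=\iota_A\sigma$. $\mathbf{X}(\mathcal{F}_\sigma,E)$ is the $\mathbf{G}(E)$-orbit of $\mathcal{F}_\sigma$, i.e. the set of $\mathcal{F}_\sigma(\underline v)$ with $v_\ell=e_\ell$ for all but finitely many $\ell$; $\mathbf{X}_\omega(\mathcal{F}_\sigma,E)$ is the set of its $\omega$-isotropic elements. $\mathfrak{I}_\infty(N_+,N_-)$ is the set of pairs $(w,\varepsilon)$ with $w:\mathbb{N}^*\to\mathbb{N}^*$, $w^2=\mathrm{id}$ (write $w_\ell=w(\ell)$), and $\varepsilon:\{\ell:w_\ell=\ell\}\to\{1,-1\}$, $\ell\mapsto\varepsilon_\ell$, such that $N'_\pm=\{\ell\in N_\pm:(w_\ell,\varepsilon_\ell)=(\ell,\pm1)\}$ satisfy, for each sign, $$|N_\pm\setminus N'_\pm|=|\{\ell\in N_\mp:(w_\ell,\varepsilon_\ell)=(\ell,\pm1)\}|+\tfrac12|\{\ell:w_\ell\ne\ell\}|<\infty.$$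 $\mathfrak{I}^{\eta,\epsilon}_\infty(N_+,N_-)$ is the subset of pairs with (i) $\iota w=w\iota$; (ii) $\varepsilon_{\iota(k)}=\eta\varepsilon_k$ whenever $w_k=k$; (iii) if $\eta\epsilon=-1$: $w_k\ne\iota(k)$ for all $k$. A basis $\underline v$ of $\mathbf{V}$ with $v_\ell=e_\ell$ for all but finitely many $\ell$ is $(w,\varepsilon)$-conjugate if for all $k$: $\delta(v_k)=v_{w_k}$ when $w_k\ne k$, $\delta(v_k)=\varepsilon_kv_k$ when $w_k=k$. It is $(w,\varepsilon)$-dual if for all $k,\ell$: $\phi(v_k,v_\ell)=0$ if $\ell\ne w_k$, $=1$ if $\ell=w_k\ne k$, $=\varepsilon_k$ if $\ell=w_k=k$. $\boldsymbol{\mathcal{O}}_{(w,\varepsilon)}$ (resp. $\boldsymbol{\mathfrak{O}}_{(w,\varepsilon)}$) is the set of $\mathcal{F}_\sigma(\underline v)\in\mathbf{X}(\mathcal{F}_\sigma,E)$ with $\underline v$ $(w,\varepsilon)$-conjugate (resp. $(w,\varepsilon)$-dual). *)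

(* Defs.v *)
(* The complex numbers are R[i], for an arbitrary realType R. *)
From HB Require Import structures.
From mathcomp Require Export all_boot all_order all_algebra.
From mathcomp Require Export finmap.
From mathcomp Require Export boolp classical_sets functions cardinality fsbigop reals.
From mathcomp Require Export complex.

Set Implicit Arguments.
Unset Strict Implicit.
Unset Printing Implicit Defensive.

Export Order.TTheory GRing.Theory Num.Theory.

#[export] Set Implicit Arguments.
#[export] Unset Strict Implicit.
#[export] Unset Printing Implicit Defensive.

Local Open Scope classical_set_scope.
Local Open Scope ring_scope.

(* The index set of positive integers is encoded by nat: the index l >= 1 is
   represented by l - 1. *)

Inductive flag_type := BD1 | C2 | D3 | C1.

Definition eta_of (t : flag_type) : int :=
  match t with BD1 | C2 => 1 | D3 | C1 => - 1 end.

Definition epsilon_of (t : flag_type) : int :=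
  match t with BD1 | D3 => 1 | C2 | C1 => - 1 end.

Definition lspan (K : fieldType) (V : lmodType K) (v : nat -> V) (P : set nat) :
    set V :=
  [set x | exists c : nat -> K,
     finite_set [set k | c k != 0] /\ x = \sum_(k \in P) c k *: v k].

Definition is_basis (K : fieldType) (V : lmodType K) (v : nat -> V) : Prop :=
  lspan v setT = setT /\
  (forall c : nat -> K, finite_set [set k | c k != 0] ->
     \sum_(k \in [set: nat]) c k *: v k = 0 -> forall k, c k = 0).

(* Defaults to 0 only when x is not in the span of E. *)
Definition basis_coord (K : fieldType) (V : lmodType K) (E : nat -> V) (x : V) :
    nat -> K :=
  xget (fun=> 0) [set c : nat -> K |
    finite_set [set k | c k != 0] /\ x = \sum_(k \in [set: nat]) c k *: E k].

(* ^t a M b, for finitely supported coordinate columns a and b. *)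
Definition mxform (K : fieldType) (M : nat -> nat -> K) (a b : nat -> K) : K :=
  \sum_(k \in [set: nat]) \sum_(l \in [set: nat]) a k * M k l * b l.

(* The two admissible diagonal blocks of Omega: (1) in size 1, and
   [0 1; epsilon 0] in size 2. *)
Definition Omega_block (K : fieldType) (epsilon : int) (n p q : nat) : K :=
  match n, p, q with
  | 1%N, 0%N, 0%N => 1
  | 2%N, 0%N, 1%N => 1
  | 2%N, 1%N, 0%N => epsilon%:~R
  | _, _, _ => 0
  end.

(* sz j is the size of the j-th diagonal block, which starts at row
   sz 0 + ... + sz (j - 1). *)
Definition is_Omega (K : fieldType) (epsilon : int) (Omega : nat -> nat -> K) :
    Prop :=
  exists sz : nat -> nat,
    (forall j, sz j = 2%N \/ (epsilon = 1 /\ sz j = 1%N)) /\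
    (forall i j p q : nat, (p < sz i)%N -> (q < sz j)%N ->
       Omega (\sum_(a < i) sz a + p)%N (\sum_(a < j) sz a + q)%N =
       if i == j then Omega_block K epsilon (sz i) p q else 0).

Definition eta_compatible (eta : int) (iota : nat -> nat) (Np Nm : set nat) :
    Prop :=
  if eta == 1 then iota @` Np = Np /\ iota @` Nm = Nm
  else iota @` Np = Nm.

Definition Phi (K : fieldType) (Np : set nat) (k l : nat) : K :=
  if k == l then (if k \in Np then 1 else - 1) else 0.

Section Geometry.

Variables (R : realType) (V : lmodType R[i]) (E : nat -> V).
Variables (Omega : nat -> nat -> R[i]) (Np : set nat).

Definition omega (x y : V) : R[i] := mxform Omega (basis_coord E x) (basis_coord E y).

Definition phi (x y : V) : R[i] :=
  mxform (Phi R[i] Np) (fun k => (basis_coord E x k)^*) (basis_coord E y).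

Definition delta (x : V) : V :=
  \sum_(k \in [set: nat])
    (\sum_(l \in [set: nat]) Phi R[i] Np k l * basis_coord E x l) *: E k.

Definition GE : set {linear V -> V} :=
  [set g : {linear V -> V} |
     bijective g /\ finite_set [set l | g (E l) != E l]].

Definition GEomega : set {linear V -> V} :=
  GE `&` [set g : {linear V -> V} |
            forall x y, omega (g x) (g y) = omega x y].

Definition KK : set {linear V -> V} :=
  GEomega `&` [set g : {linear V -> V} | forall x, delta (g x) = g (delta x)].

Definition G0 : set {linear V -> V} :=
  GEomega `&` [set g : {linear V -> V} | forall x y, phi (g x) (g y) = phi x y].

Definition flag_orbit (H : set {linear V -> V}) (F : set (set V)) :
    set (set (set V)) :=
  [set [set g @` S | S in F] | g in H].

Definition perp (F : set V) : set V := [set x | forall y, F y -> omega x y = 0].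

Definition isotropic (F : set (set V)) : Prop :=
  forall S, F S -> F (perp S) /\ perp (perp S) = S.

Definition Ebasis (v : nat -> V) : Prop :=
  is_basis v /\ finite_set [set l | v l != E l].

Definition starred (iota : nat -> nat) (v : nat -> V) : Prop :=
  forall k l, omega (v k) (v l) != 0 <-> l = iota k.

Section Flags.

Variables (d : Order.disp_t) (A : orderType d) (sigma : nat -> A).

(* The generalized flag of the F'_a and F''_a. *)
Definition Fl (v : nat -> V) : set (set V) :=
  [set S | exists a : A,
     S = lspan v [set l | (sigma l < a)%O] \/
     S = lspan v [set l | (sigma l <= a)%O]].

Definition XF : set (set (set V)) := flag_orbit GE (Fl E).

Definition XFomega : set (set (set V)) := XF `&` isotropic.

End Flags.

(* In a pair (w, eps), only the values of eps at the fixed points of w are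
   meaningful; no definition below depends on the other ones. *)

Definition wconjugate (p : (nat -> nat) * (nat -> int)) (v : nat -> V) : Prop :=
  Ebasis v /\
  forall k, (p.1 k <> k -> delta (v k) = v (p.1 k)) /\
            (p.1 k = k -> delta (v k) = (p.2 k)%:~R *: v k).

Definition wdual (p : (nat -> nat) * (nat -> int)) (v : nat -> V) : Prop :=
  Ebasis v /\
  forall k l, (l <> p.1 k -> phi (v k) (v l) = 0) /\
              (l = p.1 k -> l <> k -> phi (v k) (v l) = 1) /\
              (l = p.1 k -> l = k -> phi (v k) (v l) = (p.2 k)%:~R).

Section FlagOrbits.

Variables (d : Order.disp_t) (A : orderType d) (sigma : nat -> A).

Definition OO (p : (nat -> nat) * (nat -> int)) : set (set (set V)) :=
  XF sigma `&` [set Fl sigma v | v in wconjugate p].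

Definition OOfrak (p : (nat -> nat) * (nat -> int)) : set (set (set V)) :=
  XF sigma `&` [set Fl sigma v | v in wdual p].

Definition OOomega (p : (nat -> nat) * (nat -> int)) : set (set (set V)) :=
  OO p `&` XFomega sigma.

Definition OOfrakomega (p : (nat -> nat) * (nat -> int)) : set (set (set V)) :=
  OOfrak p `&` XFomega sigma.

End FlagOrbits.

End Geometry.

Definition signed_fix (p : (nat -> nat) * (nat -> int)) (N : set nat) (s : int) :
    set nat :=
  [set l | N l /\ p.1 l = l /\ p.2 l = s].

(* The condition |N \ N'| = |N''| + |{w_l <> l}| / 2 < oo, multiplied by 2. *)
Definition balanced (p : (nat -> nat) * (nat -> int)) (N N' : set nat) (s : int) :
    Prop :=
  let U := N `\` signed_fix p N s in
  let T := signed_fix p N' s in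
  let M := [set l | p.1 l != l] in
  [/\ finite_set U, finite_set T, finite_set M &
      (2 * #|` fset_set U| = 2 * #|` fset_set T| + #|` fset_set M|)%N].

Definition Iinf (Np Nm : set nat) : set ((nat -> nat) * (nat -> int)) :=
  [set p | (forall k, p.1 (p.1 k) = k) /\
           (forall k, p.1 k = k -> p.2 k = 1 \/ p.2 k = - 1) /\
           balanced p Np Nm 1 /\ balanced p Nm Np (- 1)].

Definition Iinf_type (t : flag_type) (iota : nat -> nat) (Np Nm : set nat) :
    set ((nat -> nat) * (nat -> int)) :=
  Iinf Np Nm `&`
  [set p | (forall k, iota (p.1 k) = p.1 (iota k)) /\
           (forall k, p.1 k = k -> p.2 (iota k) = eta_of t * p.2 k) /\
           (eta_of t * epsilon_of t = - 1 -> forall k, p.1 k <> iota k)].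

(* Main.v *)
Require Import Defs.
From HB Require Import structures.
From mathcomp Require Import all_boot all_order all_algebra.
From mathcomp Require Import boolp classical_sets functions cardinality fsbigop reals complex.
From mathcomp Require Import finmap ring zify.
Import Order.TTheory GRing.Theory Num.Theory.

Local Open Scope classical_set_scope.
Local Open Scope ring_scope.

(** For a basis [v], let [F_k] be the span of the [v_l] with [sigma l <= sigma k]. Two bases
    that differ from [E] at finitely many places have the same flag exactly when all their
    [F_k] agree ([Fl_same_flag]), that is, when the change of basis is triangular. The flag
    is isotropic exactly when the matrix of [om] in the basis [v] is triangular with respect
    to the antidiagonal [l = iota k]: by a dimension count in a finite window, the orthogonal
    of a member of the flag is spanned by the right set of basis vectors ([orth_lower],
    [isotropic_antitri]).

    Conjugate and dual bases exist. The map [delta] is linear, with [delta^2 = 1] and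
    [om (delta x) (delta y) = eta * om x y]. Since [om] is non-degenerate, it turns the
    hermitian form [phi] into an antilinear operator, [phi x y = om (tau x) y], with
    [tau^2 = eta * e] and [om (tau x) (tau y)] equal to [eta] times the conjugate of
    [om x y]. For every semilinear [T] of this kind, every isotropic flag has a basis that
    [om] pairs along [iota] and whose lines [T] permutes ([normal_basis]): in a finite window
    outside of which the basis is [E], one splits off a non-degenerate [T]-stable piece of
    dimension 1, 2 or 4 containing the lowest vector, projects the other vectors onto its
    orthogonal, and goes on with a smaller window. After a rescaling, [T = delta] gives
    conjugate bases ([conjugate_exists]) and [T = tau] gives dual ones ([dual_exists]). The
    operator attached in the same way to the positive definite form [phi (delta x) y] gives
    orthonormal ones ([orthonormal_exists]).

    The pair is determined by the flag, because a triangular change of basis does not move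
    leading terms ([conj_pair_uniq], [dual_pair_uniq]). Evaluating [om] on [delta v_k] and
    [delta v_(iota k)], or on their images by [tau], shows that it satisfies the three
    conditions relating [w], [eps] and [iota] ([conj_admissible], [dual_admissible]). The
    counting condition expresses that [delta] has the same eigenvalues, or [phi] the same
    signature, in the basis [v] as in the basis [E] ([plus_index_count], [balanced_count]).

    If a flag has both a conjugate and a dual basis for the same pair, then it has a basis
    that is both ([common_basis]): walking along the flag, one sees that [delta] must permute
    the lines of an orthonormal basis, and an orthonormal conjugate basis is dual.

    Orbits. The groups carry conjugate, respectively dual, bases that [om] pairs along [iota]
    to bases of the same kind. Conversely, given two such bases [v] and [u] for the same pair,
    multiply [v_k] by a square root of the ratio of [om (u_k) (u_(iota k))] to
    [om (v_k) (v_(iota k))]: this keeps [v] conjugate, or dual, and afterwards the linear map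
    carrying [v] to [u] is in the group ([match_values], [orbitE]).

    Every pair occurs ([both_exists]). The basis [E] is orthonormal, paired by [om] along
    [iota], and made of eigenvectors of [delta]. Permute and rescale it so that [u_k] and
    [u_(w k)] have opposite eigenvalues whenever [w k <> k], and rotate each such pair by 45
    degrees. If [e = eta = 1], a permutation commuting with [iota] need not be able to do
    this; there one first changes the pairing [iota] into the identity on a finite window, by
    a unitary and symmetric square root of a permutation, and changes it back at the end. *)

(** * Bases, spans and coordinates *)

Section Bases.
Variables (K : fieldType) (V : lmodType K).
Implicit Types (v : nat -> V) (x y : V) (P Q : set nat) (c : nat -> K).

Lemma finite_supp_bound (T : eqType) (z : T) (f : nat -> T) :
  finite_set [set k | f k != z] <-> exists n, forall k, (n <= k)%N -> f k = z.
Proof.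
split=> [/finite_seqP[s hs]|[n hn]].
  exists (\max_(k <- s) k.+1)%N => k hk; apply/eqP; apply: contraTT hk => fk.
  rewrite -ltnNge; have ks : k \in s.
    by have : [set k | f k != z] k by []; rewrite hs.
  by rewrite (big_rem k) //= leq_max ltnSn.
apply: (sub_finite_set _ (finite_II n)) => k /= fk.
by rewrite ltnNge; apply: contraNN fk => /hn ->.
Qed.

Lemma fsumE (W : nmodType) (F : nat -> W) P n :
  (forall k, (n <= k)%N -> F k = 0) ->
  \sum_(k \in P) F k = \sum_(k < n | (k : nat) \in P) F k.
Proof.
move=> hF; rewrite (fsbigE [seq k <- iota 0 n | k \in P]).
- rewrite big_filter_cond -(big_mkord (mem P)) /index_iota subn0.
  by apply: eq_bigl => k; rewrite andbb.
- by rewrite filter_uniq ?iota_uniq.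
- by move=> k /=; rewrite mem_filter => /andP[/set_mem].
- move=> k Pk; rewrite mem_filter mem_iota /= add0n mem_set //= -leqNgt.
  exact: hF.
Qed.

Lemma fsumTE (W : nmodType) (F : nat -> W) n :
  (forall k, (n <= k)%N -> F k = 0) ->
  \sum_(k \in [set: nat]) F k = \sum_(k < n) F k.
Proof.
by move=> hF; rewrite (fsumE _ hF); apply: eq_bigl => k; rewrite in_setT.
Qed.

Lemma lspanE v P x : lspan v P x <->
  exists n c, [/\ forall k, (n <= k)%N -> c k = 0,
    forall k, ~ P k -> c k = 0 & x = \sum_(k < n) c k *: v k].
Proof.
split=> [[c [/finite_supp_bound [n hn] ->]]|[n [c [hn hP ->]]]].
  exists n, (fun k => if k \in P then c k else 0); split.
  - by move=> k /hn ->; rewrite if_same.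
  - by move=> k Pk; rewrite memNset.
  - rewrite (@fsumE _ _ _ n) => [|k /hn ->]; last by rewrite scale0r.
    rewrite big_mkcond; apply: eq_bigr => k _.
    by case: ifP => // _; rewrite scale0r.
exists c; split; first by apply/finite_supp_bound; exists n.
rewrite (@fsumE _ _ _ n) => [|k /hn ->]; last by rewrite scale0r.
rewrite [in RHS]big_mkcond; apply: eq_bigr => k _.
by case: ifP => // /negP kP; rewrite hP ?scale0r // => /mem_set.
Qed.

Lemma lspan_ind v P (Q : V -> Prop) :
  Q 0 -> (forall a x y, Q x -> Q y -> Q (a *: x + y)) ->
  (forall k, P k -> Q (v k)) -> forall x, lspan v P x -> Q x.
Proof.
move=> Q0 QD Qv x /lspanE[n [c [_ hP ->]]].
elim/big_ind: _ => [//|y z Qy Qz|k _]; first by rewrite -[y]scale1r; exact: QD.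
case: (pselect (P k)) => [/Qv Qk|/hP ->]; last by rewrite scale0r.
by rewrite -[_ *: _]addr0; apply: QD.
Qed.

Lemma widen_sum v c n m : (n <= m)%N -> (forall k, (n <= k)%N -> c k = 0) ->
  \sum_(k < m) c k *: v k = \sum_(k < n) c k *: v k.
Proof.
move=> nm hn; rewrite -!(big_mkord predT (fun k => c k *: v k)).
rewrite (big_cat_nat (n := n)) //= [X in _ + X]big_nat [X in _ + X]big1 ?addr0 // => k.
by case/andP => /hn -> _; rewrite scale0r.
Qed.

Lemma lspanZD v P a x y : lspan v P x -> lspan v P y -> lspan v P (a *: x + y).
Proof.
move=> /lspanE[n [c [hn hP ->]]] /lspanE[m [d [hm hQ ->]]]; apply/lspanE.
exists (maxn n m), (fun k => a * c k + d k); split=> [k|k Pk|].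
- by rewrite geq_max => /andP[/hn -> /hm ->]; rewrite mulr0 addr0.
- by rewrite hP // hQ // mulr0 addr0.
- rewrite -(@widen_sum _ _ _ _ (leq_maxl n m)) //.
  rewrite -(@widen_sum _ _ _ _ (leq_maxr n m)) //.
  rewrite scaler_sumr -big_split; apply: eq_bigr => k _.
  by rewrite scalerDl scalerA.
Qed.

Lemma lspan0 v P : lspan v P 0.
Proof. by apply/lspanE; exists 0%N, (fun=> 0); split=> //; rewrite big_ord0. Qed.

Lemma lspanD v P x y : lspan v P x -> lspan v P y -> lspan v P (x + y).
Proof. by rewrite -{2}[x]scale1r; apply: lspanZD. Qed.

Lemma lspanZ v P a x : lspan v P x -> lspan v P (a *: x).
Proof. by move=> h; rewrite -[_ *: _]addr0; apply: lspanZD (lspan0 _ _). Qed.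

Lemma lspanB v P x y : lspan v P x -> lspan v P y -> lspan v P (x - y).
Proof. by move=> hx hy; apply: lspanD => //; rewrite -scaleN1r; apply: lspanZ. Qed.

Lemma lspan_sum (I : eqType) (s : seq I) (F : I -> V) v P :
  (forall i, i \in s -> lspan v P (F i)) -> lspan v P (\sum_(i <- s) F i).
Proof.
rewrite big_seq => h.
by apply: (big_ind (lspan v P)) => //; [exact: lspan0|exact: lspanD].
Qed.

Lemma lspan_mem v P k : P k -> lspan v P (v k).
Proof.
move=> Pk; apply/lspanE; exists k.+1, (fun l => (l == k)%:R); split.
- by move=> l; case: eqP => // ->; rewrite ltnn.
- by move=> l Pl; case: eqP => // lk; rewrite lk in Pl.
- rewrite big_ord_recr /= eqxx scale1r big1 ?add0r // => i _.
  by rewrite (ltn_eqF (ltn_ord i)) scale0r.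
Qed.

Lemma lspan_sub v v' P P' : (forall k, P k -> lspan v' P' (v k)) ->
  lspan v P `<=` lspan v' P'.
Proof.
move=> h x; apply: lspan_ind => //; first exact: lspan0.
by move=> *; apply: lspanZD.
Qed.

Lemma lspan_subset v P P' : P `<=` P' -> lspan v P `<=` lspan v P'.
Proof. by move=> h; apply: lspan_sub => k /h; apply: lspan_mem. Qed.

Definition indep v := forall n c, (forall k, (n <= k)%N -> c k = 0) ->
  \sum_(k < n) c k *: v k = 0 -> forall k, c k = 0.

Lemma is_basisE v : is_basis v <-> indep v /\ forall x, lspan v setT x.
Proof.
split=> [[h1 h2]|[h1 h2]].
  split=> [n c hn h|x]; last by rewrite h1.
  apply: h2; first by apply/finite_supp_bound; exists n.
  by rewrite -[RHS]h (@fsumTE _ _ n) // => k /hn ->; rewrite scale0r.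
split; first by apply/seteqP; split=> x _ //; apply: h2.
move=> c /finite_supp_bound[n hn] h; apply: h1 (hn) _.
by rewrite -[RHS]h (@fsumTE _ _ n) // => k /hn ->; rewrite scale0r.
Qed.

Section OneBasis.
Variable v : nat -> V.
Hypothesis bv : is_basis v.
Notation co := (basis_coord v).

Lemma bcoordP x : exists n, (forall k, (n <= k)%N -> co x k = 0) /\
  x = \sum_(k < n) co x k *: v k.
Proof.
rewrite /basis_coord.
case: xgetP => [c _ [/finite_supp_bound[n hn] hx]|].
  exists n; split=> //; rewrite hx; apply: fsumTE => k /hn ->.
  by rewrite scale0r.
move=> h; exfalso.
have [c [hc hx]] : lspan v setT x by rewrite bv.1.
by apply: (h c); split.
Qed.

Lemma bcoord_uniq x c n : (forall k, (n <= k)%N -> c k = 0) ->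
  x = \sum_(k < n) c k *: v k -> forall k, co x k = c k.
Proof.
move=> hc hx; have [m [hm hx']] := bcoordP x.
have /is_basisE[ind _] := bv.
suff h k : co x k - c k = 0 by move=> k; apply/eqP; rewrite -subr_eq0 h.
apply: (ind (maxn n m) (fun k => co x k - c k)) => [l|].
  by rewrite geq_max => /andP[/hc -> /hm ->]; rewrite subrr.
under eq_bigr do rewrite scalerBl.
rewrite sumrB (@widen_sum _ c _ _ (leq_maxl n m)) // -hx.
by rewrite (@widen_sum _ (co x) _ _ (leq_maxr n m)) // -hx' subrr.
Qed.

Lemma bcoordZD a x y k : co (a *: x + y) k = a * co x k + co y k.
Proof.
have [n [hn hx]] := bcoordP x; have [m [hm hy]] := bcoordP y.
move: k; apply: (@bcoord_uniq _ _ (maxn n m)) => [k|].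
  by rewrite geq_max => /andP[/hn -> /hm ->]; rewrite mulr0 addr0.
under eq_bigr do rewrite scalerDl -scalerA.
rewrite big_split -scaler_sumr (@widen_sum _ (co x) _ _ (leq_maxl n m)) // -hx.
by rewrite (@widen_sum _ (co y) _ _ (leq_maxr n m)) // -hy.
Qed.

Lemma bcoord0 k : co 0 k = 0.
Proof. by have := bcoordZD (-1) 0 0 k; rewrite scaler0 addr0 mulN1r addNr. Qed.

Lemma bcoordD x y k : co (x + y) k = co x k + co y k.
Proof. by have := bcoordZD 1 x y k; rewrite scale1r mul1r. Qed.

Lemma bcoordZ a x k : co (a *: x) k = a * co x k.
Proof. by have := bcoordZD a x 0 k; rewrite bcoord0 !addr0. Qed.

Lemma bcoord_sum (I : Type) (s : seq I) (p : pred I) (F : I -> V) k :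
  co (\sum_(i <- s | p i) F i) k = \sum_(i <- s | p i) co (F i) k.
Proof.
by apply: (big_morph (fun x => co x k)) => [x y|]; [exact: bcoordD|exact: bcoord0].
Qed.

Lemma bcoord_basis l k : co (v l) k = (k == l)%:R.
Proof.
move: k; apply: (@bcoord_uniq _ _ l.+1).
  by move=> k; case: eqP => // ->; rewrite ltnn.
rewrite big_ord_recr /= eqxx scale1r big1 ?add0r // => i _.
by rewrite (ltn_eqF (ltn_ord i)) scale0r.
Qed.

Lemma bcoord_inj x y : (forall k, co x k = co y k) -> x = y.
Proof.
move=> h; have [n [hn hx]] := bcoordP x; have [m [hm hy]] := bcoordP y.
rewrite [LHS]hx [RHS]hy -(@widen_sum _ (co x) _ _ (leq_maxl n m)) //.
rewrite -(@widen_sum _ (co y) _ _ (leq_maxr n m)) //.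
by apply: eq_bigr => k _; rewrite h.
Qed.

Lemma bcoord_neq0 x : x <> 0 -> exists k, co x k != 0.
Proof.
move=> x0; apply: contrapT => h; apply: x0; apply: bcoord_inj => k.
by rewrite bcoord0; apply: contrapT => /eqP hk; apply: h; exists k.
Qed.

Lemma lspan_coord P x : lspan v P x <-> forall k, ~ P k -> co x k = 0.
Proof.
split=> [/lspanE[n [c [hn hP hx]]] k Pk|h].
  by rewrite (bcoord_uniq hn hx) hP.
by have [n [hn hx]] := bcoordP x; apply/lspanE; exists n, (co x).
Qed.

End OneBasis.

(** As [V] is infinite-dimensional, dimension arguments are made over finite sets of indices,
    where they reduce to this: a homogeneous system with more unknowns (in [A]) than
    equations (in [B]) has a nonzero solution. *)
Lemma homog_system (A B : seq nat) (M : nat -> nat -> K) :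
  uniq A -> (size B < size A)%N ->
  exists c : nat -> K, [/\ forall k, k \notin A -> c k = 0,
    exists2 k, k \in A & c k != 0 &
    forall b, b \in B -> \sum_(a <- A) c a * M a b = 0].
Proof.
move=> uA BA.
pose X := \matrix_(i < size A, j < size B) M (nth 0%N A i) (nth 0%N B j).
have : kermx X != 0.
  rewrite -mxrank_eq0 mxrank_ker subn_eq0 -ltnNge.
  exact: leq_ltn_trans (rank_leq_col _) BA.
case/rowV0Pn => u /sub_kermxP uX u0.
have /rV0Pn[i ui] := u0.
exists (fun k => oapp (u 0) 0 (insub (index k A))); split=> [k kA||b bB].
- by rewrite insubN // index_mem.
- exists (nth 0%N A i); first by rewrite mem_nth.
  by rewrite index_uniq // valK.
- rewrite (big_nth 0%N) big_mkord.
  have bs : (index b B < size B)%N by rewrite index_mem.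
  have := congr1 (fun Y : 'rV_(size B) => Y 0 (Ordinal bs)) uX.
  rewrite !mxE => uXb; rewrite -[RHS]uXb; apply: eq_bigr => k _.
  by rewrite index_uniq // valK /= !mxE /= nth_index.
Qed.

End Bases.

(** * Finite windows, flags and triangular changes of basis *)

Lemma count_ltn (T : eqType) (p q : pred T) (s : seq T) x :
  {in s, forall y, p y -> q y} -> x \in s -> q x -> ~~ p x ->
  (count p s < count q s)%N.
Proof.
elim: s => [//|y s IHs] h xs qx px /=.
have hs : {in s, forall z, p z -> q z} by move=> z zs; apply: h; rewrite inE zs orbT.
have le : (count p s <= count q s)%N.
  elim: s {IHs h xs} hs => //= z s IHs hs; apply: leq_add.
    by have := hs z (mem_head _ _); case: (p z); case: (q z) => // /(_ isT).
  by apply: IHs => t ts; apply: hs; rewrite inE ts orbT.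
move: xs; rewrite inE => /predU1P[<-|xs].
  by rewrite qx (negbTE px) add0n add1n ltnS.
rewrite -addnS; apply: leq_add; last exact: IHs.
by have := h y (mem_head _ _); case: (p y); case: (q y) => // /(_ isT).
Qed.

Lemma count_add (T : eqType) (a b c : pred T) (s : seq T) :
  {in s, forall x, (a x = b x + c x :> nat)%N} ->
  count a s = (count b s + count c s)%N.
Proof.
elim: s => //= x s IHs h; rewrite IHs => [|y ys]; last by rewrite h ?inE ?ys ?orbT.
by rewrite (h x (mem_head _ _)); lia.
Qed.

Lemma count_invol (T : eqType) (f : T -> T) (p : pred T) (s : seq T) :
  involutive f -> uniq s -> {in s, forall x, f x \in s} ->
  count (p \o f) s = count p s.
Proof.
move=> fK us fs; rewrite -count_map; apply/permP; apply: uniq_perm => //.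
  by rewrite map_inj_uniq //; apply: inv_inj.
move=> x; apply/mapP/idP => [[y ys ->]|xs]; first exact: fs.
by exists (f x); rewrite ?fK ?fs.
Qed.

Lemma half_moved (w : nat -> nat) (p : pred nat) (S : seq nat) :
  involutive w -> uniq S -> {in S, forall k, w k \in S} ->
  (forall k, w k != k -> p (w k) = ~~ p k) ->
  (2 * count (fun k => (w k != k) && p k) S = count (fun k => w k != k) S)%N.
Proof.
move=> wK uS wS pw.
rewrite (@count_add _ (fun k => w k != k) (fun k => (w k != k) && p k)
  (fun k => (w k != k) && ~~ p k)) => [|k _]; last by case: (w k != k); case: (p k).
rewrite mulSn mul1n; congr (_ + _)%N.
rewrite -(count_invol _ wK uS wS); apply: eq_count => k /=.
by rewrite wK (eq_sym k); case: eqVneq => //= wk; rewrite pw ?negbK.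
Qed.

Lemma invol_closure (f : nat -> nat) (S : seq nat) : involutive f ->
  exists S' : seq nat, [/\ uniq S', {subset S <= S'}, {in S', forall k, f k \in S'} &
    forall g, (forall k, f (g k) = g (f k)) -> {in S, forall k, g k \in S} ->
      {in S', forall k, g k \in S'}].
Proof.
move=> fK; exists (undup (S ++ map f S)); split; first exact: undup_uniq.
- by move=> k kS; rewrite mem_undup mem_cat kS.
- move=> k; rewrite !mem_undup !mem_cat => /orP[kS|/mapP[l lS ->]].
    by rewrite map_f ?orbT.
  by rewrite fK lS.
- move=> g fg gS k; rewrite !mem_undup !mem_cat => /orP[/gS ->//|/mapP[l lS ->]].
  by rewrite -fg map_f ?orbT // gS.
Qed.

Section Adapted.
Variables (K : fieldType) (V : lmodType K) (E : nat -> V).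
Hypothesis bE : is_basis E.
Implicit Types (v : nat -> V) (S : seq nat).

Lemma indep_seq v S c : indep v -> uniq S -> \sum_(k <- S) c k *: v k = 0 ->
  {in S, forall k, c k = 0}.
Proof.
move=> iv uS h k kS.
pose n := (\max_(k <- S) k.+1)%N.
have hn l : l \in S -> (l < n)%N by move=> lS; rewrite /n (big_rem l) //= leq_max ltnSn.
pose c' l := if l \in S then c l else 0.
suff : c' k = 0 by rewrite /c' kS.
apply: (iv n c') => [l nl|].
  by rewrite /c'; case: ifP => // /hn; rewrite ltnNge nl.
rewrite -[RHS]h -(big_mkord predT (fun l => c' l *: v l)).
rewrite [LHS](bigID (mem S)) /= [X in _ + X]big1 ?addr0 => [|l /negbTE lS]; last first.
  by rewrite /c' lS scale0r.
rewrite -big_filter; rewrite (perm_big S) /=; last first.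
  apply: uniq_perm => //; first by rewrite filter_uniq ?iota_uniq.
  move=> l; rewrite mem_filter mem_index_iota /=.
  by case: (boolP (l \in S)) => // /hn ->.
by rewrite [LHS]big_seq [RHS]big_seq; apply: eq_bigr => l lS; rewrite /c' lS.
Qed.

(** The equations [f b], evaluated on the [v a], form a system with unknowns in [A]. *)
Lemma dimension_count v (A B : seq nat) (f : nat -> V -> K) : indep v -> uniq A ->
  (size B < size A)%N ->
  (forall b a x y, f b (a *: x + y) = a * f b x + f b y) ->
  exists x, [/\ x <> 0, lspan v [set` A] x & {in B, forall b, f b x = 0}].
Proof.
move=> iv uA BA fZD.
have [c [_ [k kA ck] hc]] := homog_system (fun a b => f b (v a)) uA BA.
exists (\sum_(a <- A) c a *: v a); split=> [x0||b bB].
- by move: ck; rewrite (indep_seq iv uA x0 kA) eqxx.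
- by apply: lspan_sum => a aA; apply: lspanZ; apply: lspan_mem.
- have f0 : f b 0 = 0 by have := fZD b (-1) 0 0; rewrite scaler0 addr0 mulN1r addNr.
  rewrite -[RHS](hc b bB); elim: (A) => [|a A' IHA]; first by rewrite !big_nil.
  by rewrite !big_cons fZD IHA.
Qed.

(** Makes finite-dimensional linear algebra over [S] available: outside [S] nothing happens,
    and the vectors of [v] in [S] stay in the span of those of [E]. *)
Definition adapted S v := [/\ uniq S, forall k, k \notin S -> v k = E k &
  forall k, k \in S -> lspan E [set` S] (v k)].

Lemma adapted_mono S S' v : adapted S v -> uniq S' -> {subset S <= S'} -> adapted S' v.
Proof.
move=> [uS h1 h2] uS' sub; split=> // k; first by move=> kS'; apply: h1; apply: contra (sub k) kS'.
move=> kS'; have [kS|kS] := boolP (k \in S).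
  by apply: lspan_subset (h2 k kS) => l /=; apply: sub.
by rewrite h1 //; apply: lspan_mem.
Qed.

Lemma finite_change v v' (D : set nat) : finite_set [set l | v l != E l] -> finite_set D ->
  (forall k, v k = E k -> ~ D k -> v' k = E k) -> finite_set [set l | v' l != E l].
Proof.
move=> fv fD h; apply: (@sub_finite_set _ _ ([set l | v l != E l] `|` D)); last first.
  by rewrite finite_setU.
move=> k /= v'k; apply: contrapT => /not_orP[/negP/negPn/eqP vk Dk].
by rewrite h // eqxx in v'k.
Qed.

Lemma adapted_exists v : finite_set [set l | v l != E l] -> exists S, adapted S v.
Proof.
case/finite_seqP => S0 hS0.
have [f hf] : exists f : nat -> nat, forall k l, (f k <= l)%N -> basis_coord E (v k) l = 0.
  have := fun k => bcoordP bE (v k) => /choice[f hf].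
  by exists f => k l; case: (hf k) => [+ _]; apply.
exists (undup (S0 ++ flatten [seq iota 0 (f k) | k <- S0])); split.
- exact: undup_uniq.
- move=> k; rewrite mem_undup mem_cat => /norP[kS _]; apply/eqP; apply: contraNT kS => vk.
  by have : [set l | v l != E l] k by []; rewrite hS0.
- move=> k; rewrite mem_undup mem_cat; case: (boolP (k \in S0)) => [kS _|kS /= kS'].
    apply/(lspan_coord bE) => l /= lS; apply: contrapT => /eqP cl; apply: lS.
    rewrite mem_undup mem_cat; apply/orP; right; apply/flattenP.
    exists (iota 0 (f k)); first by apply/mapP; exists k.
    by rewrite mem_iota /= add0n ltnNge; apply: contra cl => /hf ->.
  have -> : v k = E k.
    apply/eqP; apply: contraNT kS => vk.
    by have : [set l | v l != E l] k by []; rewrite hS0.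
  by apply: lspan_mem; rewrite /= mem_undup mem_cat kS' orbT.
Qed.

(** Together with the [v_k], [k \in S], the vector [E j] makes one vector more than the
    dimension of the window, so there is a linear relation, and [E j] occurs in it because
    [v] is independent. *)
Lemma adapted_span v S j : indep v -> adapted S v -> j \in S -> lspan v [set` S] (E j).
Proof.
move=> iv [uS h1 h2] jS.
(* an index outside [S], standing for the additional vector [E j] *)
pose m := (\max_(k <- S) k.+1)%N.
have mS : m \notin S.
  apply/negP => mS; have : (m < m)%N by rewrite {2}/m (big_rem m) //= leq_max ltnSn.
  by rewrite ltnn.
pose y a := if a == m then E j else v a.
have [c [c0 [k kA ck] hc]] :=
  @homog_system K (m :: S) S (fun a b => basis_coord E (y a) b)
    (introT andP (conj mS uS)) (ltnSn _).
have ym : y m = E j by rewrite /y eqxx.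
have yS a : a \in S -> y a = v a.
  by move=> aS; rewrite /y; case: eqP => // am; rewrite am (negbTE mS) in aS.
have sum0 : c m *: E j + \sum_(a <- S) c a *: v a = 0.
  rewrite -ym (eq_big_seq (fun a => c a *: y a)); last by move=> a /yS ->.
  transitivity (\sum_(a <- m :: S) c a *: y a); first by rewrite big_cons.
  apply: (bcoord_inj bE) => b; rewrite (bcoord0 bE) (bcoord_sum bE).
  under eq_bigr do rewrite (bcoordZ bE).
  have [bS|bS] := boolP (b \in S); first exact: hc.
  rewrite big_cons ym (bcoord_basis bE) (negbTE (_ : b != j)) ?mulr0 ?add0r; last first.
    by apply: contraNneq bS => ->.
  apply: big1_seq => a /andP[_ aS]; rewrite yS //.
  by rewrite ((lspan_coord bE _ _).1 (h2 a aS)) ?mulr0 // => /= bS'; rewrite bS' in bS.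
have cm : c m != 0.
  apply/eqP => cm; move: sum0; rewrite cm scale0r add0r => /(indep_seq iv uS) cS.
  by move: kA ck; rewrite inE => /predU1P[->|/cS ->]; rewrite ?cm eqxx.
have -> : E j = - (c m)^-1 *: \sum_(a <- S) c a *: v a.
  move/eqP: sum0; rewrite addr_eq0 => /eqP h.
  by rewrite scaleNr -scalerN -h scalerA mulVf // scale1r.
apply: lspanZ; apply: lspan_sum => a aS; apply: lspanZ; exact: lspan_mem.
Qed.

Definition cofin_basis v := is_basis v /\ finite_set [set l | v l != E l].

Lemma cofin_basis_indep v : indep v -> finite_set [set l | v l != E l] -> cofin_basis v.
Proof.
move=> iv fv; split=> //; apply/is_basisE; split=> // x.
have [S aS] := adapted_exists fv.
have /is_basisE[_ /(_ x)] := bE; apply: lspan_sub => k _.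
have [kS|kS] := boolP (k \in S).
  by apply: lspan_subset (adapted_span iv aS kS).
by case: aS => _ /(_ _ kS) <- _; apply: lspan_mem.
Qed.

Lemma basis_indep v : is_basis v -> indep v.
Proof. by move=> /is_basisE[]. Qed.

Lemma lspan_adapted v S : is_basis v -> adapted S v ->
  lspan v [set` S] = lspan E [set` S].
Proof.
move=> bv aS; apply/seteqP; split; apply: lspan_sub => k kS.
  by case: aS => _ _; apply.
exact: adapted_span (basis_indep bv) aS kS.
Qed.

Lemma adapted2 v v' (T : seq nat) : finite_set [set l | v l != E l] ->
  finite_set [set l | v' l != E l] ->
  exists S, [/\ {subset T <= S}, adapted S v & adapted S v'].
Proof.
move=> /adapted_exists[S aS] /adapted_exists[S' aS'].
exists (undup (T ++ S ++ S')); split=> [k kT||].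
- by rewrite mem_undup mem_cat kT.
- by apply: adapted_mono aS _ _ => [|k kS]; rewrite ?undup_uniq // mem_undup !mem_cat kS orbT.
- by apply: adapted_mono aS' _ _ => [|k kS]; rewrite ?undup_uniq // mem_undup !mem_cat kS !orbT.
Qed.

Lemma lspan_filter v S P x : adapted S v -> lspan v [set` [seq k <- S | k \in P]] x ->
  lspan v P x /\ lspan E [set` S] x.
Proof.
move=> [_ _ hin] h; split; move: x h; apply: lspan_sub => k /=;
  rewrite mem_filter => /andP[/set_mem kP kS]; [exact: lspan_mem|exact: hin].
Qed.

End Adapted.

Section Flags.
Variables (K : fieldType) (V : lmodType K) (E : nat -> V).
Hypothesis bE : is_basis E.
Variables (d : Order.disp_t) (A : orderType d) (sigma : nat -> A).
Implicit Types (v : nat -> V) (P : set nat).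

Definition below k := [set l | (sigma l < sigma k)%O].
Definition upto k := [set l | (sigma l <= sigma k)%O].

Definition lower P := forall k l, P l -> (sigma k <= sigma l)%O -> P k.

Lemma lower_below k : lower (below k).
Proof. by move=> l m /= h1 h2; apply: le_lt_trans h2 h1. Qed.

Lemma lower_upto k : lower (upto k).
Proof. by move=> l m /= h1 h2; apply: le_trans h2 h1. Qed.

Lemma lower_total P P' l : lower P -> lower P' -> P' l -> ~ P l -> P `<=` P'.
Proof.
move=> lP lP' Pl nPl k Pk; apply: lP' Pl _.
by case: (leP (sigma k) (sigma l)) => // /ltW /(lP _ _ Pk).
Qed.

(** Otherwise [P], being comparable with [P'], is strictly smaller than it in some window.
    Then a nonzero combination of the [v'_k], [k \in P'], has no coordinate along any [v_k],
    [k \in P], although it lies in their span. *)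
Lemma lspan_lower_le v v' P P' : cofin_basis E v -> cofin_basis E v' ->
  lower P -> lower P' -> lspan v' P' `<=` lspan v P -> P' `<=` P.
Proof.
move=> [bv fv] [bv' fv'] lP lP' sub l P'l; apply: contrapT => Pl.
have PP' := lower_total lP lP' P'l Pl.
have [S [lS aS aS']] := adapted2 bE [:: l] fv fv'.
have {}lS : l \in S by apply: lS; rewrite inE.
have [uS _ _] := aS.
have sz : (size [seq k <- S | k \in P] < size [seq k <- S | k \in P'])%N.
  rewrite !size_filter; apply: (count_ltn (x := l)) => //.
  - by move=> k kS /set_mem /PP' /mem_set.
  - exact: mem_set.
  - by apply/negP => /set_mem.
have [x [x0 /(lspan_filter aS')[xP' xS] xB]] := dimension_count (f := fun b x => basis_coord v x b)
  (basis_indep bv') (filter_uniq _ uS) sz (fun b a x y => bcoordZD bv a x y b).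
apply: x0; apply: (bcoord_inj bv) => b; rewrite (bcoord0 bv).
case: (pselect (P b)) => Pb; last exact: ((lspan_coord bv _ _).1 (sub _ xP')).
have [bS|bS] := boolP (b \in S); first by apply: xB; rewrite mem_filter bS mem_set.
by move: xS; rewrite -(lspan_adapted bE bv aS) => /(lspan_coord bv); apply; apply/negP.
Qed.

Lemma lspan_lower_inj v v' P P' : cofin_basis E v -> cofin_basis E v' ->
  lower P -> lower P' -> lspan v P = lspan v' P' -> P = P'.
Proof.
move=> ev ev' lP lP' h; apply/seteqP; split.
  by apply: lspan_lower_le ev' ev lP' lP _; rewrite h.
by apply: lspan_lower_le ev ev' lP lP' _; rewrite h.
Qed.

(** Flags are compared index by index; for generalized flags as sets of subspaces this is
    justified by [Fl_same_flag]. *)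
Definition same_flag v v' := forall k, lspan v (upto k) = lspan v' (upto k).

Lemma same_flag_below v v' k : same_flag v v' -> lspan v (below k) = lspan v' (below k).
Proof.
have half u u' : same_flag u u' -> lspan u (below k) `<=` lspan u' (below k).
  move=> h; apply: lspan_sub => l lk.
  have : lspan u' (upto l) (u l) by rewrite -h; apply: lspan_mem; rewrite /upto /=.
  by apply: lspan_subset => m /= ml; apply: le_lt_trans ml lk.
by move=> h; apply/seteqP; split; apply: half => // l; rewrite h.
Qed.

Lemma same_flag_sym v v' : same_flag v v' -> same_flag v' v.
Proof. by move=> h k; rewrite h. Qed.

Lemma same_flag_trans v1 v2 v3 : same_flag v1 v2 -> same_flag v2 v3 -> same_flag v1 v3.
Proof. by move=> h h' k; rewrite h h'. Qed.

End Flags.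

Section TriangularCoordinates.
Variables (K : fieldType) (V : lmodType K).
Variables (d : Order.disp_t) (A : orderType d) (sigma : nat -> A).
Hypothesis injs : injective sigma.
Variables (v v' : nat -> V).
Hypotheses (bv : is_basis v) (bv' : is_basis v') (sf : same_flag sigma v v').

Lemma tri_coord0 k l : (sigma k < sigma l)%O -> basis_coord v (v' k) l = 0.
Proof.
move=> kl; have : lspan v (upto sigma k) (v' k) by rewrite sf; apply: lspan_mem; apply: lexx.
move/(lspan_coord bv); apply => /=; rewrite /upto /= leNgt kl; exact.
Qed.

Lemma tri_rest k :
  lspan v (below sigma k) (v' k - basis_coord v (v' k) k *: v k).
Proof.
apply/(lspan_coord bv) => l; rewrite /below /= => lk.
rewrite -scaleNr addrC (bcoordZD bv) (bcoord_basis bv).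
have [->|kl] := eqVneq l k; first by rewrite mulr1 addNr.
rewrite mulr0 add0r; apply: tri_coord0; rewrite lt_neqAle eq_sym (inj_eq injs) kl /=.
by rewrite leNgt; apply/negP.
Qed.

Lemma tri_diag k : basis_coord v (v' k) k != 0.
Proof.
apply/eqP => h; have := tri_rest k; rewrite h scale0r subr0 (same_flag_below k sf).
move/(lspan_coord bv') => /(_ k); rewrite (bcoord_basis bv') eqxx => /(_ _)/eqP.
by rewrite oner_eq0 => /(_ _) h'; apply/notF/h'; rewrite /below /= ltxx.
Qed.

(** A triangular matrix and its inverse have inverse diagonals. *)
Lemma tri_diagV k : basis_coord v (v' k) k * basis_coord v' (v k) k = 1.
Proof.
have := tri_rest k; rewrite (same_flag_below k sf) => /(lspan_coord bv') /(_ k).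
rewrite -scaleNr addrC (bcoordZD bv') (bcoord_basis bv') eqxx mulNr => h.
by apply/eqP; rewrite -subr_eq0 -oppr_eq0 opprB addrC h // /below /= ltxx.
Qed.

End TriangularCoordinates.

Lemma basis_collinear (K : fieldType) (V : lmodType K) (v : nat -> V) a b k l :
  is_basis v -> a != 0 -> a *: v k = b *: v l -> k = l /\ a = b.
Proof.
move=> bv a0 h; have := congr1 (fun x => basis_coord v x k) h.
rewrite !(bcoordZ bv) !(bcoord_basis bv) eqxx mulr1; case: eqP => [->|_].
  by rewrite mulr1.
by rewrite mulr0 => a_0; rewrite a_0 eqxx in a0.
Qed.

Lemma basis_neq0 (K : fieldType) (V : lmodType K) (v : nat -> V) k : is_basis v -> v k != 0.
Proof.
move=> bv; apply/eqP => vk; have := bcoord_basis bv k k.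
by rewrite vk (bcoord0 bv) eqxx => /esym/eqP; rewrite oner_eq0.
Qed.

(** * Bilinear forms and isotropic flags *)

(** The sign [e] allows symmetric and symplectic forms to be treated together. *)
Record eps_form (K : fieldType) (V : lmodType K) (e : K) (om : V -> V -> K) : Prop :=
  EpsForm {
    omZDl : forall a x y z, om (a *: x + y) z = a * om x z + om y z;
    omC : forall x y, om y x = e * om x y;
    om_ee : e * e = 1 }.

Section FormCalculus.
Variables (K : fieldType) (V : lmodType K) (e : K) (om : V -> V -> K).
Hypothesis H : eps_form e om.

Lemma om0l z : om 0 z = 0.
Proof. by have := omZDl H (-1) 0 0 z; rewrite scaler0 addr0 mulN1r addNr. Qed.

Lemma omDl x y z : om (x + y) z = om x z + om y z.
Proof. by have := omZDl H 1 x y z; rewrite scale1r mul1r. Qed.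

Lemma omZl a x z : om (a *: x) z = a * om x z.
Proof. by have := omZDl H a x 0 z; rewrite om0l !addr0. Qed.

Lemma omNl x z : om (- x) z = - om x z.
Proof. by rewrite -scaleN1r omZl mulN1r. Qed.

Lemma omBl x y z : om (x - y) z = om x z - om y z.
Proof. by rewrite omDl omNl. Qed.

Lemma om0r z : om z 0 = 0.
Proof. by rewrite (omC H) om0l mulr0. Qed.

Lemma omDr x y z : om z (x + y) = om z x + om z y.
Proof. by rewrite (omC H) omDl mulrDr -!(omC H). Qed.

Lemma omZr a x z : om z (a *: x) = a * om z x.
Proof. by rewrite (omC H) omZl mulrCA -(omC H). Qed.

Lemma omNr x z : om z (- x) = - om z x.
Proof. by rewrite -scaleN1r omZr mulN1r. Qed.

Lemma omBr x y z : om z (x - y) = om z x - om z y.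
Proof. by rewrite omDr omNr. Qed.

Lemma om_suml (I : Type) (s : seq I) (p : pred I) (F : I -> V) z :
  om (\sum_(i <- s | p i) F i) z = \sum_(i <- s | p i) om (F i) z.
Proof. by apply: (big_morph (om^~ z)) => [x y|]; [exact: omDl|exact: om0l]. Qed.

Lemma eps_neq0 : e != 0.
Proof. by apply/eqP => e0; have /eqP := om_ee H; rewrite e0 mul0r eq_sym oner_eq0. Qed.

Lemma om_eq0C x y : om x y = 0 -> om y x = 0.
Proof. by rewrite (omC H x y) => ->; rewrite mulr0. Qed.

Lemma om_neq0C x y : om x y != 0 -> om y x != 0.
Proof. by apply: contraNneq => /om_eq0C ->. Qed.

Lemma om_lspan0 v P x : (forall k, P k -> om x (v k) = 0) ->
  forall y, lspan v P y -> om x y = 0.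
Proof.
move=> h; apply: lspan_ind => //; first exact: om0r.
by move=> a y z hy hz; rewrite omDr omZr hy hz mulr0 addr0.
Qed.

Lemma om_lspan20 v P v' P' : (forall k l, P k -> P' l -> om (v k) (v' l) = 0) ->
  forall x y, lspan v P x -> lspan v' P' y -> om x y = 0.
Proof.
move=> h x y hx hy; apply: (om_lspan0 _ hy) => l hl; apply: om_eq0C.
by apply: (om_lspan0 _ hx) => k hk; apply: om_eq0C; apply: h.
Qed.

End FormCalculus.

Lemma seq_argmax (d : Order.disp_t) (A : orderType d) (f : nat -> A) (s : seq nat) k :
  k \in s -> exists2 m, m \in s & forall l, l \in s -> (f l <= f m)%O.
Proof.
elim: s k => // a [_ k _|b s IHs k _].
  by exists a => [|l]; rewrite !inE // => /eqP ->.
have [m ms hm] := IHs b (mem_head _ _).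
case: (leP (f a) (f m)) => am.
  by exists m => [|l]; rewrite inE ?ms ?orbT // => /predU1P[->|/hm].
exists a => [|l]; rewrite inE ?eqxx // => /predU1P[->//|/hm h].
exact: le_trans h (ltW am).
Qed.

Section StarredOrthogonal.
Variables (K : fieldType) (V : lmodType K) (e : K) (om : V -> V -> K).
Variable (iota : nat -> nat).
Hypotheses (oH : eps_form e om) (iK : involutive iota).

Definition starred_by (v : nat -> V) :=
  forall k l, (om (v k) (v l) != 0) = (l == iota k).

Definition orth (F : set V) : set V := [set x | forall y, F y -> om x y = 0].

(** The only basis vector that does not annihilate [v_k] is [v_(iota k)]. *)
Lemma starred_orth (v : nat -> V) (P : set nat) : is_basis v -> starred_by v ->
  orth (lspan v P) = lspan v [set l | ~ P (iota l)].
Proof.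
move=> bv sv; apply/seteqP; split=> x hx.
  apply/(lspan_coord bv) => k /contrapT Pk.
  have [n [hn xE]] := bcoordP bv x.
  have : om x (v (iota k)) = 0 by apply: hx; apply: lspan_mem.
  rewrite {1}xE (om_suml oH); under eq_bigr do rewrite (omZl oH).
  have [kn|/hn//] := ltnP k n.
  rewrite (bigD1 (Ordinal kn)) //= big1 ?addr0 => [/eqP|l lk].
    by rewrite mulf_eq0 (negbTE (_ : om _ _ != 0)) ?sv // orbF => /eqP.
  suff /eqP -> : om (v l) (v (iota k)) == 0 by rewrite mulr0.
  apply/negbFE; rewrite sv (inj_eq (inv_inj iK)).
  by apply/negbTE; rewrite eq_sym; apply: contraNneq lk => lk; apply/eqP/val_inj.
move=> y hy; apply: (om_lspan20 oH _ hx hy) => k l /= Pk Pl.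
by apply/eqP/negbFE; rewrite sv; apply/negbTE; apply/eqP => lk; apply: Pk; rewrite -lk.
Qed.

End StarredOrthogonal.

Section Isotropy.
Variables (K : fieldType) (V : lmodType K) (e : K) (om : V -> V -> K).
Variables (E : nat -> V) (iota : nat -> nat).
Variables (d : Order.disp_t) (A : orderType d) (sigma : nat -> A).
Implicit Types (v : nat -> V) (P Q : set nat).

(** The condition [is_anti] is the isotropy of the flag of [E], see [iota_anti]. *)
Record iso_setting : Prop := IsoSetting {
  is_form : eps_form e om;
  is_base : is_basis E;
  is_starE : starred_by om iota E;
  is_iotaK : involutive iota;
  is_inj : injective sigma;
  is_anti : forall k l, (sigma k <= sigma l)%O -> (sigma (iota l) <= sigma (iota k))%O }.

Hypothesis H : iso_setting.
Let oH := is_form H.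
Let bE := is_base H.
Let iK := is_iotaK H.

Lemma iota_ltE k l : (sigma (iota k) < sigma (iota l))%O = (sigma l < sigma k)%O.
Proof.
have h k' l' : (sigma l' < sigma k')%O -> (sigma (iota k') < sigma (iota l'))%O.
  move=> lk; rewrite lt_neqAle (is_anti H (ltW lk)) andbT.
  by apply/eqP => /(is_inj H) /(inv_inj iK) kl; rewrite kl ltxx in lk.
by apply/idP/idP; [rewrite -{2}[k]iK -{2}[l]iK; apply: h|apply: h].
Qed.

Lemma iota_leE k l : (sigma (iota k) <= sigma (iota l))%O = (sigma l <= sigma k)%O.
Proof. by rewrite !leNgt iota_ltE. Qed.

Lemma om_nondeg x : (forall k, om x (E k) = 0) -> x = 0.
Proof.
move=> h; suff : lspan E set0 x.
  by case/lspanE => n [c [_ c0 ->]]; apply: big1 => i _; rewrite c0 ?scale0r.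
have : orth om (lspan E setT) x by move=> y; apply: (om_lspan0 oH) => k _.
rewrite (starred_orth oH iK) //; last exact: is_starE H.
by apply: lspan_sub => k /=.
Qed.

Lemma om_nondeg_basis v x : is_basis v -> (forall k, om x (v k) = 0) -> x = 0.
Proof.
move=> /is_basisE[_ bv] h; apply: om_nondeg => k.
by apply: (om_lspan0 oH) (bv (E k)) => l _.
Qed.

Definition iclosed (S : seq nat) := {in S, forall k, iota k \in S}.

Lemma iota_in S k : iclosed S -> (iota k \in S) = (k \in S).
Proof. by move=> h; apply/idP/idP => /h //; rewrite iK. Qed.

Lemma adapted_off v S x k : adapted E S v -> iclosed S -> lspan E [set` S] x ->
  k \notin S -> om x (v k) = 0.
Proof.
move=> [_ h _] cS hx kS; rewrite h //; apply: (om_eq0C oH).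
apply: (om_lspan0 oH) hx => l /= lS; apply/eqP/negbFE.
rewrite (is_starE H); apply/negbTE; apply: contra kS => /eqP lk.
by rewrite -(iota_in k cS) -lk.
Qed.

(** By counting dimensions in a finite window stable under [iota]. If [P'] were larger than
    expected, some nonzero vector of [lspan v P'] would annihilate all of [v]; if it were
    smaller, some nonzero combination of the [v_k] with [k] not in [P'] would annihilate
    [lspan v P]. *)
Lemma orth_lower v P P' : cofin_basis E v -> lower sigma P -> lower sigma P' ->
  orth om (lspan v P) = lspan v P' -> P' = [set l | ~ P (iota l)].
Proof.
move=> [bv fv] lP lP' hP; set Q := [set l | _].
have lQ : lower sigma Q.
  by move=> k l Ql kl Pk; apply: Ql; apply: lP Pk _; rewrite iota_leE.
have cntQ S : uniq S -> iclosed S ->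
    count (fun k => k \in Q) S = count (fun k => k \in ~` P) S.
  move=> uS cS; rewrite -(count_invol _ iK) //; apply: eq_count => k /=.
  rewrite in_setC; apply/idP/negP => [/set_mem|h].
    by rewrite /Q /= iK => h /set_mem.
  by apply/mem_set; rewrite /Q /= iK => /mem_set.
have small P1 P2 l :
    (forall S, l \in S -> uniq S -> iclosed S ->
      (count (fun k => k \in P2) S < count (fun k => k \in P1) S)%N) ->
    exists x, [/\ x <> 0, lspan v P1 x & forall b, P2 b -> om x (v b) = 0].
  move=> hcnt; have [S0 aS0] := adapted_exists bE fv.
  have [S [uS sub cS _]] := invol_closure (l :: S0) iK.
  have lS : l \in S by apply: sub; rewrite mem_head.
  have aS : adapted E S v.
    by apply: adapted_mono aS0 _ _ => // k kS; apply: sub; rewrite inE kS orbT.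
  have sz := hcnt S lS uS cS; rewrite -!size_filter in sz.
  have [x [x0 /(lspan_filter aS)[xP xS] xB]] := dimension_count (f := fun b x => om x (v b))
    (basis_indep bv) (filter_uniq _ uS) sz (fun b a x y => omZDl oH a x y (v b)).
  exists x; split=> // b b2; have [bS|bS] := boolP (b \in S).
    by apply: xB; rewrite mem_filter bS mem_set.
  exact: adapted_off aS cS xS bS.
apply/seteqP; split=> l hl; apply: contrapT => nl.
  have QP' := lower_total lQ lP' hl nl.
  have [S lS uS cS|x [x0 xP' xP]] := small P' (~` P) l.
    rewrite -cntQ //; apply: (count_ltn (x := l)) => //.
    - by move=> k kS /set_mem /QP' /mem_set.
    - exact: mem_set.
    - by apply/negP => /set_mem.
  apply/x0/(om_nondeg_basis bv) => b; case: (pselect (P b)) => Pb; last exact: xP.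
  by move: xP'; rewrite -hP; apply; apply: lspan_mem.
have P'Q := lower_total lP' lQ hl nl.
have [S lS uS cS|x [x0 xP' xP]] := small (~` P') P l.
  have tot (X : set nat) :
      (count (fun k => k \in X) S + count (fun k => k \in ~` X) S = size S)%N.
    rewrite -(count_predC (fun k => k \in X)); congr addn.
    by apply: eq_count => k; rewrite in_setC.
  have lt : (count (fun k => k \in P') S < count (fun k => k \in ~` P) S)%N.
    rewrite -cntQ //; apply: (count_ltn (x := l)) => //.
    - by move=> k kS /set_mem /P'Q /mem_set.
    - exact: mem_set.
    - by apply/negP => /set_mem.
  by move: lt (tot P) (tot P'); lia.
have xPP : lspan v P' x by rewrite -hP => y; apply: (om_lspan0 oH).
apply/x0/(bcoord_inj bv) => b; rewrite (bcoord0 bv).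
case: (pselect (P' b)) => Pb; last exact: ((lspan_coord bv _ _).1 xPP).
by apply: ((lspan_coord bv _ _).1 xP') => /=; apply.
Qed.

(** The matrix form of isotropy: the Gram matrix is triangular with respect to the
    antidiagonal [l = iota k]. *)
Definition antitri v := forall k,
  om (v k) (v (iota k)) != 0 /\
  forall l, (sigma l < sigma (iota k))%O -> om (v k) (v l) = 0.

Lemma starred_antitri v : starred_by om iota v -> antitri v.
Proof.
move=> sv k; split=> [|l lk]; first by rewrite sv.
by apply/eqP/negbFE; rewrite sv; apply: contraTF lk => /eqP ->; rewrite ltxx.
Qed.

(** By [orth_lower] the orthogonal of [lspan v P] is spanned by the [v_k] with [iota k] not in
    [P]. For the [P] just below and just at [iota k], this puts [v_k] into the first
    orthogonal and keeps it out of the second one. *)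
Lemma isotropic_antitri v : cofin_basis E v ->
  (forall k, exists2 P, lower sigma P & orth om (lspan v (upto sigma k)) = lspan v P) ->
  (forall k, exists2 P, lower sigma P & orth om (lspan v (below sigma k)) = lspan v P) ->
  antitri v.
Proof.
move=> ev hle hlt k; have [bv fv] := ev; split=> [|l lk].
  apply/eqP => h0.
  have [P lP hP] := hle (iota k).
  have PE := orth_lower ev (@lower_upto _ _ _ _) lP hP.
  have : lspan v P (v k).
    rewrite -hP => y; apply: (om_lspan0 oH) => l.
    rewrite /upto /= le_eqVlt => /predU1P[/(is_inj H) -> //|lk].
    have [P' lP' hP'] := hlt (iota k).
    have P'E := orth_lower ev (@lower_below _ _ _ _) lP' hP'.
    have : lspan v P' (v k) by apply: lspan_mem; rewrite P'E /below /= ltxx.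
    by rewrite -hP'; apply; apply: lspan_mem.
  move/(lspan_coord bv) => /(_ k); rewrite bcoord_basis // eqxx => hk.
  suff : 1 = 0 :> K by move/eqP; rewrite oner_eq0.
  by apply: hk; rewrite PE /=; apply; apply: lexx.
have [P lP hP] := hlt (iota k).
have PE := orth_lower ev (@lower_below _ _ _ _) lP hP.
have : lspan v P (v k) by apply: lspan_mem; rewrite PE /below /= ltxx.
by rewrite -hP; apply; apply: lspan_mem.
Qed.

Section Antitri.
Variable v : nat -> V.
Hypothesis av : antitri v.

Lemma antitri_upto k l x y : lspan v (upto sigma k) x -> lspan v (upto sigma l) y ->
  (sigma l < sigma (iota k))%O -> om x y = 0.
Proof.
move=> hx hy lk; apply: (om_lspan20 oH _ hx hy) => i j /= ik jl.
apply: (av i).2; apply: le_lt_trans jl _; apply: lt_le_trans lk _.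
by rewrite iota_leE.
Qed.

Lemma antitri_below k x y : lspan v (below sigma k) x ->
  lspan v (upto sigma (iota k)) y -> om x y = 0.
Proof.
move=> hx hy; apply: (om_lspan20 oH _ hx hy) => i j /= ik jl.
by apply: (av i).2; apply: le_lt_trans jl _; rewrite iota_ltE.
Qed.

(** In an antitriangular basis, pairing with the vector at [iota m] detects the highest
    term [m] of a combination. *)
Lemma antitri_leading n c j : (j < n)%N -> c j != 0 ->
  exists m, [/\ (sigma j <= sigma m)%O, c m != 0 &
    om (\sum_(k < n) c k *: v k) (v (iota m)) != 0].
Proof.
move=> jn cj; pose s := [seq l <- index_iota 0 n | c l != 0].
have js : j \in s by rewrite mem_filter cj mem_index_iota.
have [m ms hm] := seq_argmax sigma js.
exists m; move: (hm _ js) ms; rewrite mem_filter mem_index_iota => jm /andP[cm /= mn].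
split=> //; rewrite (om_suml oH); under eq_bigr do rewrite (omZl oH).
rewrite (bigD1 (Ordinal mn)) //= big1 ?addr0 => [|l lm].
  by rewrite mulf_neq0 // (av m).1.
have [->|cl] := eqVneq (c l) 0; first by rewrite mul0r.
rewrite (av l).2 ?mulr0 // iota_ltE lt_neqAle hm ?andbT.
  by apply: contraNneq lm => /(is_inj H) lm; apply/eqP/val_inj.
by rewrite mem_filter cl mem_index_iota /=.
Qed.

Lemma antitri_indep : indep v.
Proof.
move=> n c hn h k; apply/eqP; apply: contraT => ck.
have kn : (k < n)%N by rewrite ltnNge; apply: contra ck => /hn ->.
by have [m [_ _]] := antitri_leading kn ck; rewrite h (om0l oH) eqxx.
Qed.

Hypothesis bv : is_basis v.

Lemma upto_orth k x :
  (forall l, (sigma l < sigma (iota k))%O -> om x (v l) = 0) ->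
  lspan v (upto sigma k) x.
Proof.
move=> h; have [n [hn xE]] := bcoordP bv x.
apply/(lspan_coord bv) => j /= /negP; rewrite -ltNge => kj; apply/eqP; apply: contraT => cj.
have jn : (j < n)%N by rewrite ltnNge; apply: contra cj => /hn ->.
have [m [jm _]] := antitri_leading jn cj; rewrite -xE h ?eqxx //.
by rewrite iota_ltE (lt_le_trans kj jm).
Qed.

Lemma upto_orthE k x : lspan v (upto sigma k) x <->
  forall l, (sigma l < sigma (iota k))%O -> om x (v l) = 0.
Proof.
split=> [hx l lk|]; last exact: upto_orth.
by apply: antitri_upto hx _ lk; apply: lspan_mem; apply: lexx.
Qed.

End Antitri.

Lemma antitri_same_flag v v' : antitri v -> is_basis v -> antitri v' -> is_basis v' ->
  (forall k, lspan v (upto sigma k) (v' k)) -> same_flag sigma v v'.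
Proof.
move=> av bv av' bv' h k; apply/seteqP; split=> x.
  move/(upto_orthE av bv) => hx; apply: (upto_orth av' bv') => l lk.
  apply: (om_lspan0 oH) (h l) => j /= jl; apply: hx; exact: le_lt_trans jl lk.
apply: lspan_sub => l /= lk; apply: lspan_subset (h l) => j /= jl.
exact: le_trans jl lk.
Qed.

(** The tool for changing the basis of an isotropic flag. Triangularity alone gives the zeros
    of the Gram matrix, so only its antidiagonal has to be checked; independence and the
    equality of the flags follow from the shape of the Gram matrix. *)
Lemma antitri_change v v' : antitri v -> cofin_basis E v ->
  (forall k, lspan v (upto sigma k) (v' k)) ->
  (forall k, om (v' k) (v' (iota k)) != 0) ->
  finite_set [set l | v' l != E l] ->
  [/\ antitri v', cofin_basis E v' & same_flag sigma v v'].
Proof.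
move=> av [bv _] hv' hn fv'.
have av' : antitri v'.
  move=> k; split=> // l lk; exact (antitri_upto av (hv' k) (hv' l) lk).
have ev' := cofin_basis_indep bE (antitri_indep av') fv'.
by split=> //; apply: antitri_same_flag => //; case: ev'.
Qed.

End Isotropy.

(** * Simultaneous normal form of a form and a semilinear operator *)

Section SemilinearReduction.
Variables (K : fieldType) (V : lmodType K) (e : K) (om : V -> V -> K).
Variables (E : nat -> V) (iota : nat -> nat).
Variables (d : Order.disp_t) (A : orderType d) (sigma : nat -> A).
Hypothesis H : iso_setting e om E iota sigma.
Hypothesis two_neq0 : 2%:R != 0 :> K.
Variables (theta : {rmorphism K -> K}) (T : V -> V) (kappa eta : K).

(** Common to the linear map [delta], with [theta] the identity, and to the antilinear maps
    that represent hermitian forms, with [theta] the conjugation. *)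
Record semi_sym : Prop := SemiSym {
  ss_thetaK : involutive theta;
  ss_ZD : forall a x y, T (a *: x + y) = theta a *: T x + T y;
  ss_sq : forall x, T (T x) = kappa *: x;
  ss_om : forall x y, om (T x) (T y) = eta * theta (om x y);
  ss_kappa : kappa * kappa = 1;
  ss_eta : eta * eta = 1 }.

Hypothesis HT : semi_sym.
Implicit Types (v : nat -> V) (S Q : seq nat) (x y : V).

Let oH := is_form H.
Let bE := is_base H.
Let iK := is_iotaK H.
Let tK := ss_thetaK HT.

Lemma sq1P (a : K) : a * a = 1 -> a = 1 \/ a = -1.
Proof. by rewrite -expr2 => /eqP; rewrite sqrf_eq1 => /orP[/eqP|/eqP]; [left|right]. Qed.

Lemma theta_sq1 (a : K) : a * a = 1 -> theta a = a.
Proof. by move=> /sq1P[->|->]; rewrite ?rmorphN rmorph1. Qed.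

Lemma neq0_sq1 (a : K) : a * a = 1 -> a != 0.
Proof. by move=> aa; apply/eqP => a0; move/eqP: aa; rewrite a0 mul0r eq_sym oner_eq0. Qed.

Lemma theta_eq0 a : (theta a == 0) = (a == 0).
Proof. exact: fmorph_eq0. Qed.

Lemma T0 : T 0 = 0.
Proof.
by have := ss_ZD HT (-1) 0 0; rewrite scaler0 addr0 rmorphN rmorph1 scaleN1r addNr.
Qed.

Lemma TD x y : T (x + y) = T x + T y.
Proof. by have := ss_ZD HT 1 x y; rewrite rmorph1 !scale1r. Qed.

Lemma TZ a x : T (a *: x) = theta a *: T x.
Proof. by have := ss_ZD HT a x 0; rewrite T0 !addr0. Qed.

Lemma Tinj_eq0 x : T x = 0 -> x = 0.
Proof.
move=> Tx; have := ss_sq HT x; rewrite Tx T0 => /esym/eqP.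
by rewrite scaler_eq0 (negbTE (neq0_sq1 (ss_kappa HT))) => /eqP.
Qed.

Lemma om_TC x y : om (T y) x = e * kappa * eta * theta (om (T x) y).
Proof.
have := ss_om HT x (T y).
rewrite (ss_sq HT) (omZr oH) (omC oH (T y) x) rmorphM (theta_sq1 (om_ee oH)) => h.
apply: (can_inj tK); rewrite !rmorphM (theta_sq1 (om_ee oH)) tK.
rewrite (theta_sq1 (ss_kappa HT)) (theta_sq1 (ss_eta HT)).
have -> : theta (om (T y) x) = e * eta * (eta * (e * theta (om (T y) x))).
  transitivity ((e * e) * (eta * eta) * theta (om (T y) x)); last by ring.
  by rewrite (om_ee oH) (ss_eta HT) !mul1r.
rewrite -h; ring.
Qed.

Lemma om_combine a b u w u' w' : om (u + a *: w) (u' + b *: w') =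
  om u u' + b * om u w' + a * om w u' + a * b * om w w'.
Proof. by rewrite (omDl oH) (omZl oH) !(omDr oH) !(omZr oH); ring. Qed.

(** A state of the reduction: outside the finite window [S] the basis is in normal form, and
    neither [om] nor [T] mixes it with the window. *)
Record stage v S : Prop := Stage {
  st_cof : cofin_basis E v;
  st_anti : antitri om iota sigma v;
  st_uniq : uniq S;
  st_closed : iclosed iota S;
  st_om : forall k l, k \notin S -> l <> iota k -> om (v k) (v l) = 0;
  st_T : forall k, k \notin S -> exists m c, m \notin S /\ T (v k) = c *: v m }.

(** The span of the [v_k], [k \in S], described as the orthogonal of the other [v_l]. *)
Definition inwindow v S x := forall l, l \notin S -> om x (v l) = 0.

Section Stage.
Variables (v : nat -> V) (S : seq nat).
Hypothesis st : stage v S.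
Let bv : is_basis v := proj1 (st_cof st).
Let av := st_anti st.

Lemma inwindow_v k : k \in S -> inwindow v S (v k).
Proof.
move=> kS l lS; apply: (om_eq0C oH); apply: (st_om st) => // kl.
by rewrite kl (iota_in H l (st_closed st)) (negbTE lS) in kS.
Qed.

Lemma inwindowZD a x y : inwindow v S x -> inwindow v S y -> inwindow v S (a *: x + y).
Proof. by move=> hx hy l lS; rewrite (omDl oH) (omZl oH) hx // hy // mulr0 addr0. Qed.

Lemma inwindow_T x : inwindow v S x -> inwindow v S (T x).
Proof.
move=> hx l lS; have [m [c [mS hm]]] := st_T st lS.
have -> : v l = kappa *: (theta c *: T (v m)).
  by rewrite -TZ -hm (ss_sq HT) scalerA (ss_kappa HT) scale1r.
by rewrite !(omZr oH) (ss_om HT) hx // rmorph0 !mulr0.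
Qed.

Lemma inwindow_eq0 x : inwindow v S x -> {in S, forall l, om x (v l) = 0} -> x = 0.
Proof.
move=> h1 h2; apply: (om_nondeg_basis H bv) => k.
by have [/h2|/h1] := boolP (k \in S).
Qed.

Lemma inwindow_upto k x : inwindow v S x ->
  (forall l, l \in S -> (sigma l < sigma (iota k))%O -> om x (v l) = 0) ->
  lspan v (upto sigma k) x.
Proof.
move=> h1 h2; apply: (upto_orth H av bv) => l lk.
by have [lS|/h1//] := boolP (l \in S); apply: h2.
Qed.

(** Splitting off the non-degenerate [T]-stable span of the [q_k], [k \in Q], placed at the
    indices where they fit the flag. The other vectors of the window are projected onto its
    orthogonal, which is [T]-stable as well; the vector [q_r] enters the projection of [v_k]
    only if [r] is lower than [k], so that the flag does not change. *)
Lemma stage_split Q (q : nat -> V) : uniq Q -> {subset Q <= S} -> iclosed iota Q ->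
  {in Q, forall k, inwindow v S (q k)} ->
  {in Q, forall k l, l \in S -> (sigma l < sigma (iota k))%O -> om (q k) (v l) = 0} ->
  {in Q &, forall k l, (om (q k) (q l) != 0) = (l == iota k)} ->
  {in Q, forall k, exists m c, m \in Q /\ T (q k) = c *: q m} ->
  exists2 v', stage v' [seq k <- S | k \notin Q] & same_flag sigma v v'.
Proof.
move=> uQ QS cQ hin hlow hstar hT.
pose p k := \sum_(r <- Q) (om (v k) (q (iota r)) / om (q r) (q (iota r))) *: q r.
pose v' k := if k \in Q then q k else if k \in S then v k - p k else v k.
have v'Q k : k \in Q -> v' k = q k by rewrite /v' => ->.
have v'S k : k \in S -> k \notin Q -> v' k = v k - p k.
  by rewrite /v' => -> /negbTE ->.
have v'o k : k \notin S -> v' k = v k.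
  by rewrite /v' => kS; rewrite (negbTE kS) ifF //; apply: contraNF kS; apply: QS.
have qup k : k \in Q -> lspan v (upto sigma k) (q k).
  by move=> kQ; apply: inwindow_upto; [exact: hin|exact: hlow].
have vup k : lspan v (upto sigma k) (v k) by apply: lspan_mem; apply: lexx.
have pbel k : k \notin Q -> lspan v (below sigma k) (p k).
  move=> kQ; apply: lspan_sum => r rQ.
  have [->|c0] := eqVneq (om (v k) (q (iota r))) 0.
    by rewrite mul0r scale0r; apply: lspan0.
  apply: lspanZ; apply: lspan_subset (qup _ rQ) => j /= jr; apply: le_lt_trans jr _.
  rewrite lt_neqAle (inj_eq (is_inj H)) (contraNneq _ kQ) => [/=|<-//].
  rewrite leNgt; apply: contra c0 => kr; apply/eqP.
  by apply: (antitri_upto H av (vup k) (qup _ (cQ _ rQ))); rewrite (iota_ltE H).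
have v'up k : lspan v (upto sigma k) (v' k).
  have [kQ|kQ] := boolP (k \in Q); first by rewrite v'Q //; apply: qup.
  have [kS|kS] := boolP (k \in S); last by rewrite v'o.
  rewrite v'S //; apply: lspanB => //; apply: lspan_subset (pbel _ kQ) => j /=.
  exact: ltW.
have iQ := iota_in H _ cQ.
have iS := iota_in H _ (st_closed st).
have v'n k : om (v' k) (v' (iota k)) != 0.
  have [kQ|kQ] := boolP (k \in Q); first by rewrite !v'Q ?iQ // hstar ?iQ.
  have [kS|kS] := boolP (k \in S); last by rewrite !v'o ?iS //; exact: (av k).1.
  rewrite v'S // (omBl oH) (antitri_below H av (pbel _ kQ) (v'up _)) subr0.
  rewrite v'S ?iS ?iQ // (omBr oH) [X in _ - X](om_eq0C oH) ?subr0; first exact: (av k).1.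
  by apply: (antitri_below H av (k := iota k)); rewrite ?iK //; apply: pbel; rewrite iQ.
have fv' : finite_set [set l | v' l != E l].
  by apply: finite_change (st_cof st).2 (finite_seq S) _ => k vk /negP kS; rewrite v'o.
have [av' ev' sf] := antitri_change H av (st_cof st) v'up v'n fv'.
have projQ k r : k \in S -> k \notin Q -> r \in Q -> om (v' k) (q r) = 0.
  move=> kS kQ rQ; rewrite v'S // (omBl oH) (om_suml oH).
  under eq_bigr do rewrite (omZl oH).
  rewrite (bigD1_seq (iota r)) ?iQ //= iK big1_seq ?addr0 => [|s /andP[sr sQ]].
    by rewrite mulfVK ?subrr // hstar ?iQ // iK.
  suff /eqP -> : om (q s) (q r) == 0 by rewrite mulr0.
  apply/negbFE; rewrite hstar //; apply/negbTE; apply: contra sr => /eqP ->.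
  by rewrite iK.
have in' k : k \in S -> inwindow v S (v' k).
  move=> kS; have [kQ|kQ] := boolP (k \in Q); first by rewrite v'Q //; apply: hin.
  rewrite v'S // => l lS; rewrite (omBl oH) (inwindow_v kS) // (om_suml oH).
  rewrite big1_seq ?subr0 // => r /andP[_ rQ].
  by rewrite (omZl oH) (hin _ rQ) // mulr0.
exists v' => //; split=> //.
- by rewrite filter_uniq ?(st_uniq st).
- by move=> k; rewrite !mem_filter iQ iS.
- move=> k l; rewrite mem_filter => /nandP[/negPn kQ lk|kS lk].
    have [lQ|lQ] := boolP (l \in Q).
      by rewrite !v'Q //; apply/eqP/negbFE; rewrite hstar //; apply/eqP.
    have [lS|lS] := boolP (l \in S).
      by apply: (om_eq0C oH); rewrite (v'Q k) //; apply: projQ.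
    by rewrite (v'o l lS); apply: in' => //; apply: QS.
  have [lS|lS] := boolP (l \in S); last by rewrite !v'o //; apply: (st_om st).
  by apply: (om_eq0C oH); rewrite (v'o k kS); apply: in'.
- move=> k; rewrite mem_filter => /nandP[/negPn kQ|kS].
    have [m [c [mQ hm]]] := hT k kQ; exists m, c.
    by rewrite mem_filter mQ !v'Q.
  have [m [c [mS hm]]] := st_T st kS; exists m, c.
  by rewrite mem_filter (negbTE mS) andbF !v'o.
Qed.

End Stage.

Lemma dbl_neq0 (u : K) : (u + u == 0) = (u == 0).
Proof. by rewrite -mulr2n -mulr_natl mulf_eq0 (negbTE two_neq0). Qed.

Lemma size_removed (Q S : seq nat) : Q != [::] -> {subset Q <= S} ->
  (size [seq k <- S | k \notin Q] < size S)%N.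
Proof.
case: Q => // q0 Q _ QS; rewrite size_filter -(count_predT S).
apply: (count_ltn (x := q0)) => //; first by rewrite QS ?mem_head.
by rewrite negbK mem_head.
Qed.

(** The pieces of dimension 2: a hyperbolic pair placed at the lowest index [iota N] and the
    highest index [N] of the window. The second vector fits the flag automatically, as
    nothing in the window is below [iota N]. The map [T] preserves both lines or exchanges
    them, according to [m] and [n]. *)
Lemma splitting_pair v S N x y m n c c' (st : stage v S) : N \in S -> iota N != N ->
  (forall l, l \in S -> (sigma l <= sigma N)%O) ->
  {in S, forall l, l != N -> om x (v l) = 0} -> inwindow v S x -> inwindow v S y ->
  om x x = 0 -> om y y = 0 -> om x y != 0 ->
  (m, n) = (iota N, N) \/ (m, n) = (N, iota N) ->
  T x = c *: (if m == N then y else x) -> T y = c' *: (if n == N then y else x) ->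
  exists v' S', [/\ stage v' S', same_flag sigma v v' & (size S' < size S)%N].
Proof.
move=> NS oN' Nmax x0 xin yin xx yy xy mn Tx Ty; set o := iota N in oN' mn *.
have oN : iota o = N by rewrite /o iK.
have oS : o \in S by exact: (st_closed st).
have QS : {subset [:: o; N] <= S} by move=> k; rewrite !inE => /orP[/eqP ->|/eqP ->].
pose q k := if k == N then y else x.
have qo : q o = x by rewrite /q (negbTE oN').
have qN : q N = y by rewrite /q eqxx.
have [|//||||||v' st' sf'] := @stage_split v S st [:: o; N] q.
- by rewrite /= inE oN'.
- by move=> k; rewrite !inE => /orP[/eqP ->|/eqP ->]; rewrite ?oN eqxx ?orbT.
- by move=> k; rewrite !inE => /orP[/eqP ->|/eqP ->]; rewrite ?qo ?qN.
- move=> k; rewrite !inE => /orP[/eqP ->|/eqP ->] l lS; rewrite ?qo ?qN => lk.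
    by apply: x0 => //; apply: contraTneq lk => ->; rewrite oN ltxx.
  by move: lk; rewrite -(iota_ltE H) iK ltNge Nmax //; exact: (st_closed st).
- move=> k l; rewrite !inE => /orP[/eqP ->|/eqP ->] /orP[/eqP ->|/eqP ->];
    rewrite ?qo ?qN ?oN -/o ?eqxx ?xx ?yy ?eqxx ?(negbTE oN') //.
  + by rewrite (om_neq0C oH).
  + by rewrite eq_sym (negbTE oN').
- have mQ : m \in [:: o; N] /\ n \in [:: o; N].
    by case: mn => -[-> ->]; rewrite !inE !eqxx ?orbT.
  by move=> k; rewrite !inE => /orP[/eqP ->|/eqP ->];
    [exists m, c; rewrite qo|exists n, c'; rewrite qN]; case: mQ; rewrite !inE.
by exists v', [seq k <- S | k \notin [:: o; N]]; split=> //; apply: size_removed.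
Qed.

(** The image of the lowest vector [x] is, like [x], orthogonal to all vectors of the window
    but the highest one, [v N], so [x] is an eigenvector of [T]. If [iota N = N] the line of
    [x] splits off. Otherwise [x] is isotropic; an average of [v N] over [T] is an
    eigenvector not orthogonal to [x], and adding a multiple of [x] makes it isotropic. *)
Lemma splitting_eigen v S N (st : stage v S) :
  N \in S -> (forall l, l \in S -> (sigma l <= sigma N)%O) ->
  let x := v (iota N) in
  (forall l, l \in S -> (sigma l < sigma N)%O -> om (T x) (v l) = 0) ->
  exists v' S', [/\ stage v' S', same_flag sigma v v' & (size S' < size S)%N].
Proof.
move=> NS Nmax x hm; set o := iota N.
have oN : iota o = N by rewrite /o iK.
have oS : o \in S by exact: (st_closed st).
have omin l : l \in S -> ~~ (sigma l < sigma o)%O.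
  by move=> lS; rewrite -leNgt -(iota_leE H) oN Nmax ?(st_closed st).
have bv : is_basis v := proj1 (st_cof st).
have av := st_anti st.
have x0 : forall l, l \in S -> l != N -> om x (v l) = 0.
  move=> l lS lN; apply: (av o).2; rewrite oN lt_neqAle Nmax // andbT.
  by apply: contra lN => /eqP /(is_inj H) ->.
pose z := om x (v N).
have z0 : z != 0 by have := (av o).1; rewrite oN.
pose c := om (T x) (v N) / z.
have xin : inwindow v S x by apply: (inwindow_v st).
have hTx : T x = c *: x.
  apply/eqP; rewrite -subr_eq0; apply/eqP; rewrite -scaleNr addrC.
  apply: (inwindow_eq0 st); first exact: (inwindowZD _ xin (inwindow_T st xin)).
  move=> l lS; rewrite (omDl oH) (omZl oH); have [->|lN] := eqVneq l N.
    by rewrite mulNr mulfVK ?addNr.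
  rewrite x0 // mulr0 add0r hm // lt_neqAle Nmax // andbT.
  by apply: contra lN => /eqP /(is_inj H) ->.
clearbody c.
have [oN'|oN'] := eqVneq o N.
  have QS : {subset [:: o] <= S} by move=> k; rewrite inE => /eqP ->.
  have [//|//||||||v' st' sf'] := @stage_split v S st [:: o] v.
  - by move=> k; rewrite inE => /eqP ->; rewrite oN oN' inE.
  - by move=> k /QS kS; apply: inwindow_v.
  - by move=> k /QS kS l _; apply: (av k).2.
  - move=> k l; rewrite !inE => /eqP -> /eqP ->; rewrite oN {3}oN' eqxx.
    by have := z0; rewrite /z -oN'.
  - by move=> k; rewrite inE => /eqP ->; exists o, c; rewrite inE eqxx.
  - by exists v', [seq k <- S | k \notin [:: o]]; split=> //; apply: size_removed.
have xx0 : om x x = 0 by apply: x0.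
have x_neq0 : x != 0 by apply: contraNneq z0 => x_0; rewrite /z x_0 (om0l oH).
have kap0 := neq0_sq1 (ss_kappa HT).
have ct : theta c * c = kappa.
  have := ss_sq HT x; rewrite hTx TZ hTx scalerA => /eqP.
  by rewrite -subr_eq0 -scalerBl scaler_eq0 (negbTE x_neq0) orbF subr_eq0 => /eqP.
have c0 : c != 0 by apply: contraNneq kap0 => c_0; rewrite -ct c_0 mulr0.
have tc0 : theta c != 0 by rewrite theta_eq0.
have tz0 : theta z != 0 by rewrite theta_eq0.
have eta0 := neq0_sq1 (ss_eta HT).
have ceta : theta eta = eta := theta_sq1 (ss_eta HT).
have xTN : om x (T (v N)) = c^-1 * (eta * theta z).
  by rewrite -(ss_om HT) hTx (omZl oH) mulKf.
(* the eigenvalue of a partner of [x], dictated by the behaviour of [om] under [T] *)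
pose c' := c^-1 * eta * theta z / z.
have c'0 : c' != 0 by rewrite !mulf_neq0 ?invr_eq0.
have c't : theta c' * c' = kappa.
  transitivity ((theta c * c)^-1 * (eta * eta)); last first.
    rewrite ct (ss_eta HT) mulr1; apply: (mulfI kap0).
    by rewrite mulfV // (ss_kappa HT).
  rewrite /c' !rmorphM !fmorphV tK ceta.
  by field; rewrite ?c0 ?tc0 ?z0 ?tz0.
pose y0 := v N + c'^-1 *: T (v N).
have Ty0 : T y0 = c' *: y0.
  rewrite /y0 TD TZ (ss_sq HT) scalerA scalerDr scalerA mulfV // scale1r addrC.
  congr (_ *: _ + _); rewrite fmorphV -c't mulrA mulVf ?mul1r //.
  by rewrite theta_eq0.
have xy0 : om x y0 = z + z.
  rewrite /y0 (omDr oH) (omZr oH) xTN; congr (_ + _).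
  by rewrite /c'; field; rewrite ?z0 ?c0 ?eta0 ?tz0.
pose g := om y0 y0.
have g_e : g = e * g by rewrite /g; exact: (omC oH).
have tg : eta * theta g = c' * c' * g.
  by rewrite -(ss_om HT) Ty0 (omZl oH) (omZr oH) mulrA.
have tz : eta * theta z = c * c' * z by rewrite /c'; field; rewrite ?z0 ?c0.
(* solves [om (y0 + b *: x) (y0 + b *: x) = 0] if [e = 1]; if [e = -1], then [g = 0];
   by [tb], the sum is still an eigenvector *)
pose b := - g / (2%:R * (z + z)).
have tb : theta b * c = c' * b.
  have -> : theta b = - (eta * theta g) / (2%:R * (eta * theta z + eta * theta z)).
    rewrite /b !(rmorphM, rmorphN, rmorphD, fmorphV, rmorph1, rmorph_nat).
    by field; rewrite -?mulrDr ?mulf_eq0 ?dbl_neq0 ?(negbTE eta0) ?(negbTE tz0) ?oner_eq0.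
  rewrite tg tz /b; field.
  by rewrite !dbl_neq0 oner_eq0 z0 /= (mulf_neq0 (mulf_neq0 c0 c'0) z0).
pose y := y0 + b *: x.
have Ty : T y = c' *: y.
  by rewrite /y TD TZ Ty0 hTx !scalerDr !scalerA tb.
have xy : om x y = z + z by rewrite /y (omDr oH) (omZr oH) xx0 mulr0 addr0.
have yy : om y y = 0.
  rewrite /y om_combine xx0 (omC oH x y0) xy0 -/g.
  case: (sq1P (om_ee oH)) => e1.
    by rewrite e1 /b; field; rewrite ?dbl_neq0 ?oner_eq0 ?z0 ?two_neq0.
  have g0 : g = 0.
    by move: g_e; rewrite e1 mulN1r => /eqP; rewrite -subr_eq0 opprK dbl_neq0 => /eqP.
  by rewrite /b g0 e1; ring.
have zz : z + z != 0 by rewrite dbl_neq0.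
have hN := inwindow_v st NS.
have y0in : inwindow v S y0.
  by rewrite /y0 addrC; apply: inwindowZD => //; apply: inwindow_T.
have yin : inwindow v S y by rewrite /y addrC; apply: inwindowZD.
apply: (splitting_pair (m := o) (n := N) st NS oN' Nmax x0 xin yin xx0 yy).
- by rewrite xy.
- by left.
- by rewrite (negbTE oN'); exact: hTx.
- by rewrite eqxx; exact: Ty.
Qed.

(** Let [x] be the lowest vector of the window, [x' = T x], and [m] the lowest index with
    [om x' (v m) <> 0]. If [m] is the highest index [N], this is [splitting_eigen]. If
    [m = iota N], the vectors [x] and [x'] form a hyperbolic pair exchanged by [T].
    Otherwise they span a [T]-stable isotropic plane, and a second one, spanned by a
    correction [y'] of [v m] and by [T y'], is dual to it. *)
Lemma splitting_step v S (st : stage v S) : S != [::] ->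
  exists v' S', [/\ stage v' S', same_flag sigma v v' & (size S' < size S)%N].
Proof.
move=> Sn0.
have [k0 k0S] : exists k, k \in S by case: (S) Sn0 => // k S' _; exists k; rewrite mem_head.
have [N NS Nmax] := seq_argmax sigma k0S; set o := iota N.
have oN : iota o = N by rewrite /o iK.
have oS : o \in S by exact: (st_closed st).
have omin l : l \in S -> (sigma o <= sigma l)%O.
  by move=> lS; rewrite -(iota_leE H) oN Nmax ?(st_closed st).
have bv : is_basis v := proj1 (st_cof st).
have av := st_anti st.
have ltl k l : (sigma k <= sigma l)%O -> k != l -> (sigma k < sigma l)%O.
  by move=> kl nkl; rewrite lt_neqAle kl andbT (inj_eq (is_inj H)).
set x := v o; pose x' := T x.
have x0 : forall l, l \in S -> l != N -> om x (v l) = 0.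
  by move=> l lS lN; apply: (av o).2; rewrite oN ltl ?Nmax.
have z0 : om x (v N) != 0 by have := (av o).1; rewrite oN.
have xin : inwindow v S x by apply: inwindow_v.
have x'in : inwindow v S x' by apply: inwindow_T.
have [m0 m0S] : exists m, m \in [seq l <- S | om x' (v l) != 0].
  apply: contrapT => h; move: z0.
  have -> : x = 0; last by rewrite (om0l oH) eqxx.
  apply: Tinj_eq0; apply: (inwindow_eq0 st) => // l lS; apply/eqP.
  by apply: contrapT => /negP hl; apply: h; exists l; rewrite mem_filter hl.
(* the lowest [m] is the one whose image by [iota] is highest *)
have [m] := seq_argmax (fun k => sigma (iota k)) m0S.
rewrite mem_filter => /andP[beta0 mS] mmin.
have hm l : l \in S -> (sigma l < sigma m)%O -> om x' (v l) = 0.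
  move=> lS lm; apply/eqP; apply: contraTT lm => hl.
  by rewrite -leNgt -(iota_leE H) mmin // mem_filter hl.
have [mN|mN] := eqVneq m N.
  by apply: (splitting_eigen st NS Nmax) => l lS lN; apply: hm => //; rewrite mN.
have oN' : o != N.
  apply: contra mN => /eqP oN'; rewrite -(inj_eq (is_inj H)) eq_le Nmax //=.
  by rewrite -oN' omin.
have xx : om x x = 0 by apply: x0.
have x'x' : om x' x' = 0 by rewrite (ss_om HT) xx rmorph0 mulr0.
have [mo|mo] := eqVneq m o.
  rewrite mo -/x in beta0.
  apply: (splitting_pair (c := 1) (c' := kappa) (m := N) (n := o)
    st NS oN' Nmax x0 xin x'in xx x'x').
  - exact: (om_neq0C oH).
  - by right.
  - by rewrite eqxx scale1r.
  - by rewrite (negbTE oN') /x' (ss_sq HT).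
pose j := iota m.
have jm : iota j = m by rewrite /j iK.
have jS : j \in S by exact: (st_closed st).
have jo : j != o by rewrite (inj_eq (inv_inj iK)).
have jN : j != N by apply: contra mo => /eqP h; rewrite -jm h.
have x'j : lspan v (upto sigma j) x'.
  by apply: (inwindow_upto st) => // l lS; rewrite jm; apply: hm.
have xx' : om x' x = 0 by apply: hm => //; apply: ltl; rewrite ?omin // eq_sym.
(* if [j = m], the top term of [x'] is at [m] and [om (v m) (v m) <> 0], which
   contradicts [om x' x' = 0] *)
have jmn : j != m.
  apply/eqP => jm'; rewrite jm' in x'j.
  pose a := basis_coord v x' m.
  have rlow : lspan v (below sigma m) (x' - a *: v m).
    apply/(lspan_coord bv) => l; rewrite /below /= => lm.
    rewrite -scaleNr addrC (bcoordZD bv) (bcoord_basis bv).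
    have [->|lm'] := eqVneq l m; first by rewrite mulr1 addNr.
    rewrite mulr0 add0r; apply: ((lspan_coord bv _ _).1 x'j) => /= lm2.
    by apply: lm; apply: ltl.
  have vmm : lspan v (upto sigma (iota m)) (v m).
    by apply: lspan_mem; rewrite -/j jm'; apply: lexx.
  have x'E : x' = (x' - a *: v m) + a *: v m by rewrite subrK.
  have rm : om (x' - a *: v m) (v m) = 0 := antitri_below H av rlow vmm.
  have rr : om (x' - a *: v m) (x' - a *: v m) = 0.
    apply: (antitri_below H av rlow); rewrite -/j jm'.
    by apply: lspan_subset rlow => l; apply: ltW.
  have a0 : a = 0.
    move: x'x'; rewrite x'E (omDl oH) (omDr oH) rr add0r (omDr oH) !(omZl oH) !(omZr oH).
    rewrite rm (om_eq0C oH rm) !mulr0 !add0r => /eqP; rewrite mulrA !mulf_eq0 orbb.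
    have := (av m).1; rewrite -/j jm' => /negbTE ->; rewrite orbF.
    by move/eqP.
  by move: beta0; rewrite x'E (omDl oH) rm a0 (omZl oH) mul0r addr0 eqxx.
have xvm : om x (v m) = 0 by apply: x0.
pose beta := om x' (v m).
have b2 : 2%:R * beta != 0 by rewrite mulf_neq0.
(* makes [y1] isotropic if [e = 1]; if [e = -1], then [v m] is isotropic and [a = 0] *)
pose a := - om (v m) (v m) / (2%:R * beta).
pose y1 := v m + a *: x'.
have y1y1 : om y1 y1 = 0.
  rewrite /y1 om_combine x'x' (omC oH x' (v m)) -/beta.
  have := omC oH (v m) (v m); case: (sq1P (om_ee oH)) => e1.
    move=> _; rewrite e1 /a; field; exact/andP.
  rewrite e1 mulN1r => /eqP; rewrite -subr_eq0 opprK dbl_neq0 => /eqP vm0.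
  by rewrite /a vm0; ring.
have x'y1 : om x' y1 = beta by rewrite /y1 (omDr oH) (omZr oH) x'x' mulr0 addr0.
have xy1 : om x y1 = 0.
  by rewrite /y1 (omDr oH) (omZr oH) xvm (om_eq0C oH xx') mulr0 addr0.
pose g := om (T y1) y1.
have gE : g = e * kappa * eta * theta g by rewrite /g {1}om_TC.
have Ty1x : om (T y1) x = e * kappa * eta * theta beta by rewrite om_TC -/x' x'y1.
(* makes [T y'] orthogonal to [y']: both terms that [b] adds to [om (T y1) y1] contribute
   half of it, because of [gE] *)
pose b := - theta g / (2%:R * theta beta).
have tb0 : theta beta != 0 by rewrite theta_eq0.
pose y' := y1 + b *: x.
pose y := T y'.
have y'y : om y y' = 0.
  rewrite /y /y' TD TZ om_combine -/x' xx' Ty1x x'y1 -/g.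
  have -> : theta b = - g / (2%:R * beta).
    by rewrite /b rmorphM rmorphN fmorphV rmorphM rmorph_nat !tK.
  have -> : b * (e * kappa * eta * theta beta) =
      - (e * kappa * eta * theta g) / 2%:R.
    by rewrite /b; field; rewrite ?two_neq0 ?tb0.
  by rewrite -gE; field; rewrite ?two_neq0 ?beta0.
have xy' : om x y' = 0 by rewrite /y' (omDr oH) (omZr oH) xx mulr0 addr0.
have x'y' : om x' y' = beta by rewrite /y' (omDr oH) (omZr oH) xx' mulr0 addr0.
have y'y' : om y' y' = 0.
  rewrite /y' om_combine y1y1 xx xy1 (om_eq0C oH xy1).
  by rewrite !mulr0 !addr0.
have yy : om y y = 0 by rewrite (ss_om HT) y'y' rmorph0 mulr0.
have x'y : om x' y = 0 by rewrite (ss_om HT) xy' rmorph0 mulr0.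
have xy : om x y != 0.
  have := ss_om HT x' y'; rewrite /x' (ss_sq HT) (omZl oH) -/y -/x' x'y' => h.
  apply/eqP => xy; move: h; rewrite xy mulr0 => /esym/eqP.
  by rewrite mulf_eq0 (negbTE tb0) (negbTE (neq0_sq1 (ss_eta HT))).
have y1in : inwindow v S y1.
  by rewrite /y1 addrC; apply: inwindowZD => //; apply: inwindow_v.
have y'in : inwindow v S y' by rewrite /y' addrC; apply: inwindowZD.
have yin : inwindow v S y by apply: inwindow_T.
pose Q := [:: o; j; m; N].
have inQ k : k \in Q -> [\/ k = o, k = j, k = m | k = N].
  by rewrite !inE => /or4P[] /eqP ->; [constructor 1|constructor 2|constructor 3|constructor 4].
have QS : {subset Q <= S} by move=> k /inQ[] ->.
pose q k := if k == o then x else if k == j then x' else if k == m then y' else y.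
have qo : q o = x by rewrite /q eqxx.
have qj : q j = x' by rewrite /q (negbTE jo) eqxx.
have qm : q m = y' by rewrite /q (negbTE mo) eq_sym (negbTE jmn) eqxx.
have qN : q N = y.
  by rewrite /q eq_sym (negbTE oN') eq_sym (negbTE jN) eq_sym (negbTE mN).
have sym := fun a b => eq_sym (a : nat) b.
have [|//||||||v' st' sf'] := @stage_split v S st Q q.
- by rewrite /= !inE !negb_or (sym o j) jo (sym o m) mo oN' jmn jN mN.
- by move=> k /inQ[] ->; rewrite ?oN ?jm -/o -/j !inE eqxx ?orbT.
- by move=> k /inQ[] ->; rewrite ?qo ?qj ?qm ?qN.
- move=> k /inQ[] -> l lS; rewrite ?qo ?qj ?qm ?qN ?oN ?jm -/o -/j => lk.
  + by apply: (av o).2; rewrite oN.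
  + exact: hm.
  + have lN : l != N by apply: contraTneq lk => ->; rewrite -leNgt Nmax.
    rewrite /y' /y1 !(omDl oH) !(omZl oH) (av m).2 // (x0 l lS lN) mulr0 addr0 add0r.
    (* [y'] contains [x'], which belongs to the flag from [j] on; but if [a <> 0] then
       [om (v m) (v m) <> 0], so [j] is lower than [m] *)
    have [->|a0] := eqVneq a 0; first by rewrite mul0r.
    rewrite hm ?mulr0 //; apply: lt_trans lk _; rewrite ltNge; apply: contra a0 => mj.
    apply/eqP; rewrite /a (av m).2 ?oppr0 ?mul0r // -/j.
    by apply: ltl; rewrite 1?eq_sym.
  + by have := omin _ lS; rewrite leNgt lk.
- have xx'' := om_eq0C oH xx'; have y'x := om_eq0C oH xy'; have y'x' := x'y'.
  have nx'y' : om x' y' != 0 by rewrite x'y'.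
  have ny'x' := om_neq0C oH nx'y'; have nyx := om_neq0C oH xy.
  have yx' := om_eq0C oH x'y; have yy' := om_eq0C oH y'y.
  have F a' b' : a' != b' -> (a' == b' :> nat) = false /\ (b' == a' :> nat) = false.
    by move=> h; split; [|rewrite eq_sym]; apply/negbTE.
  have [f1 f1'] := F _ _ jo; have [f2 f2'] := F _ _ jN; have [f3 f3'] := F _ _ jmn.
  have [f4 f4'] := F _ _ mo; have [f5 f5'] := F _ _ mN; have [f6 f6'] := F _ _ oN'.
  move=> k l /inQ[] -> /inQ[] ->; rewrite ?qo ?qj ?qm ?qN ?oN ?jm -/o -/j;
  by rewrite ?(f1, f1', f2, f2', f3, f3', f4, f4', f5, f5', f6, f6') ?eqxx
     ?(xx, xx'', xx', x'x', xy', y'x, x'y, yx', y'y', yy, y'y, yy') ?eqxx ?nx'y' ?ny'x' ?nyx ?xy.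
- move=> k /inQ[] ->.
  + by exists j, 1; rewrite !inE eqxx orbT qo qj scale1r.
  + by exists o, kappa; rewrite !inE eqxx qj qo (ss_sq HT).
  + by exists N, 1; rewrite !inE eqxx !orbT qm qN scale1r.
  + by exists m, kappa; rewrite !inE eqxx !orbT qN qm (ss_sq HT).
by exists v', [seq k <- S | k \notin Q]; split=> //; apply: size_removed.
Qed.

Lemma stage_finish v S : stage v S -> exists2 v', stage v' [::] & same_flag sigma v v'.
Proof.
have [n le_n] := ubnP (size S); elim: n => // n IHn in v S le_n *.
move=> st; have [S0|Sn0] := eqVneq S [::]; first by exists v; rewrite -?S0.
have [v1 [S1 [st1 sf1 lt1]]] := splitting_step st Sn0.
have [v2 st2 sf2] := IHn _ _ (leq_trans lt1 le_n) st1.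
by exists v2 => //; apply: same_flag_trans sf1 sf2.
Qed.

(** The last hypothesis says that [E] is in normal form, so the reduction starts from a window
    off which [v] is [E]. *)
Theorem normal_basis v : cofin_basis E v -> antitri om iota sigma v ->
  (forall k, exists m c, (m = k \/ m = iota k) /\ T (E k) = c *: E m) ->
  exists v', [/\ cofin_basis E v', starred_by om iota v', same_flag sigma v v' &
    forall k, exists m c, T (v' k) = c *: v' m].
Proof.
move=> ev av hTE.
have [S0 aS0] := adapted_exists bE ev.2.
have [S [uS sub cS _]] := invol_closure S0 iK.
have aS := adapted_mono aS0 uS sub.
have iS := iota_in H _ cS.
have [v' st sf] : exists2 v', stage v' [::] & same_flag sigma v v'.
  apply: (@stage_finish v S); split=> //.
  - move=> k l kS lk; case: aS => _ hout hin.
    have [lS|lS] := boolP (l \in S).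
      apply: (om_eq0C oH); exact: (adapted_off H (And3 uS hout hin) cS (hin l lS) kS).
    rewrite !hout //; apply/eqP/negbFE; rewrite (is_starE H).
    exact/eqP.
  - move=> k kS; have [m [c [hmk hm]]] := hTE k.
    have mS : m \notin S by case: hmk => ->; rewrite ?iS.
    by exists m, c; case: aS => _ hout _; rewrite !hout.
exists v'; split=> //.
- exact: st_cof st.
- move=> k l; have [->|lk] := eqVneq l (iota k); first by rewrite ((st_anti st) k).1.
  by apply/negbTE; rewrite negbK (st_om st) //; apply/eqP.
- by move=> k; have [m [c [_ hm]]] := st_T st (erefl : k \notin [::]); exists m, c.
Qed.

End SemilinearReduction.

(** * Hermitian forms as antilinear operators *)

Section SemilinearExtension.
Variables (K : fieldType) (V : lmodType K) (theta : {rmorphism K -> K}).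
Variables (v F : nat -> V).
Hypothesis bv : is_basis v.

Definition semi_ext (x : V) : V :=
  \sum_(k \in [set: nat]) theta (basis_coord v x k) *: F k.

Lemma semi_extE x n : (forall k, (n <= k)%N -> basis_coord v x k = 0) ->
  semi_ext x = \sum_(k < n) theta (basis_coord v x k) *: F k.
Proof. by move=> hn; apply: fsumTE => k /hn ->; rewrite rmorph0 scale0r. Qed.

Lemma semi_ext_ZD a x y : semi_ext (a *: x + y) = theta a *: semi_ext x + semi_ext y.
Proof.
have [n [hn _]] := bcoordP bv x; have [m [hm _]] := bcoordP bv y.
have hx k : (maxn n m <= k)%N -> basis_coord v x k = 0.
  by rewrite geq_max => /andP[/hn].
have hy k : (maxn n m <= k)%N -> basis_coord v y k = 0.
  by rewrite geq_max => /andP[_ /hm].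
rewrite !(@semi_extE _ (maxn n m)) //; last first.
  by move=> k hk; rewrite (bcoordZD bv) hx // hy // mulr0 addr0.
rewrite scaler_sumr -big_split; apply: eq_bigr => k _ /=.
by rewrite (bcoordZD bv) rmorphD rmorphM scalerDl scalerA.
Qed.

Lemma semi_ext_basis k : semi_ext (v k) = F k.
Proof.
rewrite (@semi_extE _ k.+1) => [|l kl].
  rewrite big_ord_recr /= (bcoord_basis bv) eqxx rmorph1 scale1r big1 ?add0r // => i _.
  by rewrite (bcoord_basis bv) (ltn_eqF (ltn_ord i)) rmorph0 scale0r.
by rewrite (bcoord_basis bv) (gtn_eqF kl).
Qed.

End SemilinearExtension.

Lemma basis_ind (K : fieldType) (V : lmodType K) (v : nat -> V) (Q : V -> Prop) :
  is_basis v -> Q 0 -> (forall a x y, Q x -> Q y -> Q (a *: x + y)) ->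
  (forall k, Q (v k)) -> forall x, Q x.
Proof.
move=> /is_basisE[_ sp] Q0 QD Qv x; apply: lspan_ind (sp x) => //.
Qed.

Section Hermitian.
Variables (C : numClosedFieldType) (V : lmodType C).

Record sesq_form (phi : V -> V -> C) : Prop := Sesqui {
  ph_ZDl : forall a x y z, phi (a *: x + y) z = a^* * phi x z + phi y z;
  ph_ZDr : forall a x y z, phi z (a *: x + y) = a * phi z x + phi z y }.

Section Calculus.
Variable phi : V -> V -> C.
Hypothesis P : sesq_form phi.

Lemma ph0l z : phi 0 z = 0.
Proof.
by have := ph_ZDl P (-1) 0 0 z; rewrite scaler0 addr0 rmorphN rmorph1 mulN1r addNr.
Qed.
Lemma ph0r z : phi z 0 = 0.
Proof. by have := ph_ZDr P (-1) 0 0 z; rewrite scaler0 addr0 mulN1r addNr. Qed.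
Lemma phDl x y z : phi (x + y) z = phi x z + phi y z.
Proof. by have := ph_ZDl P 1 x y z; rewrite scale1r rmorph1 mul1r. Qed.
Lemma phDr x y z : phi z (x + y) = phi z x + phi z y.
Proof. by have := ph_ZDr P 1 x y z; rewrite scale1r mul1r. Qed.
Lemma phZl a x z : phi (a *: x) z = a^* * phi x z.
Proof. by have := ph_ZDl P a x 0 z; rewrite ph0l !addr0. Qed.
Lemma phZr a x z : phi z (a *: x) = a * phi z x.
Proof. by have := ph_ZDr P a x 0 z; rewrite ph0r !addr0. Qed.
Lemma phBr x y z : phi z (x - y) = phi z x - phi z y.
Proof. by rewrite -scaleN1r phDr phZr mulN1r. Qed.
Lemma ph_suml (I : Type) (s : seq I) (p : pred I) (F : I -> V) z :
  phi (\sum_(i <- s | p i) F i) z = \sum_(i <- s | p i) phi (F i) z.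
Proof. by apply: (big_morph (phi^~ z)) => [x y|]; [exact: phDl|exact: ph0l]. Qed.
Lemma ph_sumr (I : Type) (s : seq I) (p : pred I) (F : I -> V) z :
  phi z (\sum_(i <- s | p i) F i) = \sum_(i <- s | p i) phi z (F i).
Proof. by apply: (big_morph (phi z)) => [x y|]; [exact: phDr|exact: ph0r]. Qed.

Lemma ph_lspan0 v D x : (forall k, D k -> phi x (v k) = 0) ->
  forall y, lspan v D y -> phi x y = 0.
Proof.
move=> h; apply: lspan_ind => //; first exact: ph0r.
by move=> a y z hy hz; rewrite (ph_ZDr P) hy hz mulr0 addr0.
Qed.

Lemma ph_lspan20 v D v' D' : (forall k l, D k -> D' l -> phi (v k) (v' l) = 0) ->
  forall x y, lspan v D x -> lspan v' D' y -> phi x y = 0.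
Proof.
move=> h x y hx hy; move: x hx; apply: lspan_ind => [|a x z hx hz|k hk].
- exact: ph0l.
- by rewrite (ph_ZDl P) hx hz mulr0 addr0.
- by apply: (ph_lspan0 _ hy) => l; apply: h.
Qed.

End Calculus.

Definition diag_form (E : nat -> V) (sg : nat -> C) (phi : V -> V -> C) :=
  forall k l, phi (E k) (E l) = if l == k then sg k else 0.

Section Tau.
Variables (e : C) (om : V -> V -> C) (E : nat -> V) (iota : nat -> nat).
Variables (d : Order.disp_t) (A : orderType d) (sigma : nat -> A).
Hypothesis H : iso_setting e om E iota sigma.
Hypothesis om_sq : forall k, om (E k) (E (iota k)) * om (E k) (E (iota k)) = 1.
Variables (phi : V -> V -> C) (sg : nat -> C) (eta : C).
Hypothesis P : sesq_form phi.
Hypothesis D : diag_form E sg phi.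
Hypothesis sg_sq : forall k, sg k * sg k = 1.
Hypothesis eta_sq : eta * eta = 1.
Hypothesis sg_iota : forall k, sg (iota k) = eta * sg k.

Let oH := is_form H.
Let bE := is_base H.
Let iK := is_iotaK H.

Lemma conj_sq1 (a : C) : a * a = 1 -> a^* = a.
Proof. exact: (@theta_sq1 C Num.conj). Qed.

Lemma diag_form_sym x y : phi y x = (phi x y)^*.
Proof.
move: x y; apply: (basis_ind bE) => [y|a x x' hx hx' y|k].
- by rewrite (ph0l P) (ph0r P) rmorph0.
- by rewrite (ph_ZDr P) (ph_ZDl P) hx hx' rmorphD rmorphM /= conjCK.
apply: (basis_ind bE) => [|a x x' hx hx'|l].
- by rewrite (ph0l P) (ph0r P) rmorph0.
- by rewrite (ph_ZDr P) (ph_ZDl P) hx hx' rmorphD rmorphM.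
by rewrite !D eq_sym; case: eqP => [->|]; rewrite ?rmorph0 ?conj_sq1.
Qed.

(** Composing the hermitian form with the isomorphism of [V] with its dual given
    by [om] gives an antilinear operator. *)
Definition tau := semi_ext Num.conj E
  (fun k => (sg k * (e * om (E k) (E (iota k)))) *: E (iota k)).

Lemma tau_E k : tau (E k) = (sg k * (e * om (E k) (E (iota k)))) *: E (iota k).
Proof. exact: semi_ext_basis. Qed.

Lemma tau_ZD a x y : tau (a *: x + y) = a^* *: tau x + tau y.
Proof. exact: semi_ext_ZD. Qed.

Lemma tau0 : tau 0 = 0.
Proof.
have := tau_ZD (-1) 0 0; rewrite scaler0 addr0 rmorphN rmorph1 scaleN1r.
by rewrite addNr.
Qed.

Lemma om_EE k l : om (E k) (E l) = if l == iota k then om (E k) (E (iota k)) else 0.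
Proof.
case: eqP => [->//|/eqP lk]; apply/eqP/negbFE; rewrite (is_starE H).
exact/negbTE.
Qed.

Lemma phi_tau x y : phi x y = om (tau x) y.
Proof.
move: x y; apply: (basis_ind bE) => [y|a x x' hx hx' y|k].
- by rewrite tau0 (ph0l P) (om0l oH).
- by rewrite tau_ZD (ph_ZDl P) hx hx' (omDl oH) (omZl oH).
apply: (basis_ind bE) => [|a x x' hx hx'|l].
- by rewrite (ph0r P) (om0r oH).
- by rewrite (ph_ZDr P) hx hx' (omDr oH) (omZr oH).
rewrite D tau_E (omZl oH) (om_EE (iota k)) iK; case: eqP => _; last by rewrite mulr0.
rewrite (omC oH (E k) (E (iota k))).
transitivity (sg k * ((e * e) * (om (E k) (E (iota k)) * om (E k) (E (iota k))))).
  by rewrite (om_ee oH) om_sq !mulr1.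
by ring.
Qed.

(** All these identities may be checked on [E], where they come down to signs. *)
Lemma tau_semi_sym : semi_sym om Num.conj tau (eta * e) eta.
Proof.
have cE k : (sg k * (e * om (E k) (E (iota k))))^* = sg k * (e * om (E k) (E (iota k))).
  by rewrite !rmorphM /= (conj_sq1 (sg_sq k)) (conj_sq1 (om_ee oH)) (conj_sq1 (om_sq k)).
have zi k : om (E (iota k)) (E k) = e * om (E k) (E (iota k)) by exact: (omC oH).
have tauZ a x : tau (a *: x) = a^* *: tau x.
  by have := tau_ZD a x 0; rewrite tau0 !addr0.
split=> //; first exact: conjCK; first exact: tau_ZD.
- apply: (basis_ind bE) => [|a x x' hx hx'|k]; first by rewrite !tau0 scaler0.
    by rewrite !tau_ZD conjCK hx hx' scalerDr !scalerA mulrC.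
  rewrite tau_E tauZ tau_E iK scalerA cE sg_iota zi; congr (_ *: _).
  transitivity (eta * e * (e * e) * (sg k * sg k) *
    (om (E k) (E (iota k)) * om (E k) (E (iota k)))); first by ring.
  by rewrite (om_ee oH) om_sq sg_sq !mulr1.
- apply: (basis_ind bE) => [y|a x x' hx hx' y|k].
  + by rewrite tau0 !(om0l oH) rmorph0 mulr0.
  + rewrite tau_ZD !(omDl oH) !(omZl oH) hx hx' rmorphD rmorphM /= ?conjCK; ring.
  apply: (basis_ind bE) => [|a x x' hx hx'|l].
  + by rewrite tau0 !(om0r oH) rmorph0 mulr0.
  + rewrite tau_ZD !(omDr oH) !(omZr oH) hx hx' rmorphD rmorphM /= ?conjCK; ring.
  rewrite !tau_E (omZl oH) (omZr oH) (om_EE (iota k)) (inj_eq (inv_inj iK)) iK (om_EE k l).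
  have [->|lk] := eqVneq l (iota k); last by rewrite !mulr0 rmorph0 mulr0.
  rewrite /= (conj_sq1 (om_sq k)) iK sg_iota !zi.
  transitivity (eta * (e * e) * (e * e) * (sg k * sg k) *
    (om (E k) (E (iota k)) * om (E k) (E (iota k))) * om (E k) (E (iota k))).
    by ring.
  by rewrite (om_ee oH) om_sq sg_sq !mulr1.
- by rewrite mulrACA eta_sq (om_ee oH) mulr1.
Qed.

(** As [phi x y = om (tau x) y], each [v'_k] has a single partner for [phi] as soon as [tau]
    permutes the lines of a starred basis. *)
Lemma dual_normal v : cofin_basis E v -> antitri om iota sigma v ->
  exists v', [/\ cofin_basis E v', starred_by om iota v', same_flag sigma v v' &
    forall k, exists m, forall l, l <> m -> phi (v' k) (v' l) = 0].
Proof.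
move=> ev av.
have [||v' [ev' sv' sf hv']] :=
  normal_basis H _ tau_semi_sym ev av; first by rewrite pnatr_eq0.
  by move=> k; exists (iota k); eexists; split; [right|exact: tau_E].
exists v'; split=> // k; have [m [c hm]] := hv' k; exists (iota m) => l lm.
rewrite phi_tau hm (omZl oH); suff /eqP -> : om (v' m) (v' l) == 0 by rewrite mulr0.
by apply/negbFE; rewrite sv'; apply/eqP.
Qed.

End Tau.

End Hermitian.

(** * Relabelings and sign choices *)

Section Relabeling.

(** Compares the least elements of the [b]-orbits of [k] and of [a k]. This is a sign that [b]
    preserves, and that [a] reverses if [a k] is not in the [b]-orbit of [k]. *)
Definition sign_choice (a b : nat -> nat) k := (minn k (b k) < minn (a k) (b (a k)))%N.

Lemma sign_choice_pres a b k : involutive b -> (forall k, a (b k) = b (a k)) ->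
  sign_choice a b (b k) = sign_choice a b k.
Proof. by move=> bK ab; rewrite /sign_choice !ab !bK minnC [minn (b (a k)) _]minnC. Qed.

Lemma sign_choice_neg a b k : involutive a -> involutive b -> (forall k, a (b k) = b (a k)) ->
  a k != k -> a k != b k -> sign_choice a b (a k) = ~~ sign_choice a b k.
Proof.
move=> aK bK ab ak akb; rewrite /sign_choice aK -leqNgt [RHS]leq_eqVlt.
suff /negbTE -> : minn (a k) (b (a k)) != minn k (b k) by [].
have h : b (a k) != k by apply: contra akb => /eqP h; rewrite -[a k]bK h.
have h' : b (a k) != b k by rewrite (inj_eq (inv_inj bK)).
by move: ak akb h h'; rewrite /minn; do 2!case: ifP => _.
Qed.

Definition swap (a b x : nat) := if x == a then b else if x == b then a else x.

Lemma swapK a b : involutive (swap a b).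
Proof.
move=> x; rewrite /swap; case: (eqVneq x a) => [->|xa].
  by rewrite eqxx; case: eqP.
case: (eqVneq x b) => [->|xb]; first by rewrite eqxx.
by rewrite (negbTE xa) (negbTE xb).
Qed.

Lemma swap_inj (f : nat -> nat) a b x : injective f ->
  f (swap a b x) = swap (f a) (f b) (f x).
Proof. by move=> fi; rewrite /swap !(inj_eq fi); case: ifP => // _; case: ifP. Qed.

Lemma swapC (a b a' b' x : nat) : a != a' -> a != b' -> b != a' -> b != b' ->
  swap a b (swap a' b' x) = swap a' b' (swap a b x).
Proof.
move=> h1 h2 h3 h4; rewrite /swap.
have F (u v : nat) : u != v -> (u == v = false) * (v == u = false).
  by move=> /negbTE uv; split=> //; rewrite eq_sym.
have [->|/F n1] := eqVneq x a; first by rewrite !(F _ _ h1, F _ _ h2, F _ _ h3, F _ _ h4, eqxx).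
have [->|/F n2] := eqVneq x b.
  by rewrite !(F _ _ h1, F _ _ h2, F _ _ h3, F _ _ h4, eqxx); case: eqP.
have [_|/F n3] := eqVneq x a'; first by rewrite !(F _ _ h1, F _ _ h2, F _ _ h3, F _ _ h4, eqxx).
have [_|/F n4] := eqVneq x b'; first by rewrite !(F _ _ h1, F _ _ h2, F _ _ h3, F _ _ h4, eqxx).
by rewrite !(n1, n2, n3, n4).
Qed.

(** As long as the signs differ somewhere, the equality of the counts provides an index [k] to
    be made negative and an index [l] to be made positive, and one exchanges their
    [rho]-orbits; these have the same size by [hfix]. *)
Lemma relabel (rho : nat -> nat) (s s' : pred nat) (S : seq nat) :
  involutive rho -> (forall k, s (rho k) = s k) -> (forall k, s' (rho k) = s' k) ->
  uniq S -> {in S, forall k, rho k \in S} ->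
  {in S &, forall k l, (rho k == k) = (rho l == l)} ->
  (forall k, k \notin S -> s k = s' k) -> count s S = count s' S ->
  exists b : nat -> nat, [/\ injective b, forall k, b (rho k) = rho (b k),
    forall k, k \notin S -> b k = k & forall k, s (b k) = s' k].
Proof.
move=> rK + hs' uS cS hfix.
have [n] := ubnP (count (fun k => s k != s' k) S).
elim: n s => // n IHn s; rewrite ltnS => le_n hs off cnt.
have [/hasP[k kS /andP[sk sk']]|none] := boolP (has (fun k => s k && ~~ s' k) S); last first.
  have none' : ~~ has (fun k => ~~ s k && s' k) S.
    apply/negP => /hasP[l lS /andP[sl sl']]; move/hasPn: none => none.
    suff : (count s S < count s' S)%N by rewrite cnt ltnn.
    apply: (count_ltn (x := l)) => // y yS sy.
    by have := none y yS; rewrite sy /= negbK.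
  exists id; split=> // k; have [kS|/off//] := boolP (k \in S).
  have := hasPn none k kS; have := hasPn none' k kS.
  by case: (s k); case: (s' k).
have [/hasP[l lS /andP[sl sl']]|none] := boolP (has (fun k => ~~ s k && s' k) S); last first.
  suff : (count s' S < count s S)%N by rewrite cnt ltnn.
  apply: (count_ltn (x := k)) => // y yS sy.
  by have := hasPn none y yS; rewrite sy andbT negbK.
have ri := inv_inj rK.
have ne a b : s a -> ~~ s b -> a != b by move=> sa; apply: contraNneq => <-.
have kl : k != l by apply: ne.
have krl : k != rho l by apply: ne => //; rewrite hs.
(* the second exchange would undo the first one if [rho] fixes [k] and [l] *)
pose b x := if rho k == k then swap k l x else swap k l (swap (rho k) (rho l) x).
have bi : injective b.
  move=> x y; rewrite /b; case: ifP => _ /(inv_inj (swapK k l)) //.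
  exact: (inv_inj (swapK _ _)).
have brho x : b (rho x) = rho (b x).
  rewrite /b; case: eqP => [rk|/eqP rk].
    have rl : rho l = l by apply/eqP; rewrite -(hfix k) // rk.
    by rewrite (swap_inj _ _ _ ri) rk rl.
  rewrite !(swap_inj _ _ _ ri) !rK swapC // 1?eq_sym //.
  - by apply: contra krl => /eqP <-; rewrite rK.
  - by rewrite -(hfix k) //; apply/eqP.
have bK : involutive b.
  move=> x; rewrite /b; case: eqP => [_|/eqP rk]; first exact: swapK.
  have comm y : swap k l (swap (rho k) (rho l) y) = swap (rho k) (rho l) (swap k l y).
    apply: swapC => //; first by rewrite eq_sym.
      by apply: contra krl => /eqP ->; rewrite rK.
    by rewrite eq_sym -(hfix k).
  by rewrite [swap k l (swap _ _ x)]comm !swapK.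
have rl : (rho l == l) = (rho k == k) by rewrite (hfix l k).
have bk : b k = l.
  rewrite /b /swap; case: eqVneq => [_|rk]; first by rewrite eqxx.
  by rewrite (negbTE krl) eqxx.
have bl : b l = k by rewrite -bk bK.
have bo x : x != k -> x != l -> x != rho k -> x != rho l -> b x = x.
  rewrite /b /swap => /negbTE h1 /negbTE h2 /negbTE h3 /negbTE h4.
  by rewrite h3 h4 h1 h2 if_same.
have bS x : x \notin S -> b x = x.
  move=> xS; have ns y : y \in S -> x != y by move=> yS; apply: contraNneq xS => ->.
  by apply: bo; apply: ns => //; apply: cS.
have bS' : {in S, forall x, b x \in S}.
  move=> x xS; apply/negPn/negP => bxS; have := bS _ bxS; rewrite bK => xb.
  by rewrite -xb xS in bxS.
pose s1 x := s (b x).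
have hs1 x : s1 (rho x) = s1 x by rewrite /s1 brho hs.
have [||||b2 [b2i b2r b2S b2s]] := IHn s1.
- apply: leq_trans le_n; apply: (count_ltn (x := k)) => //.
  + move=> y yS; rewrite /s1.
    have [->|yk] := eqVneq y k; first by rewrite bk (negbTE sl) (negbTE sk').
    have [->|yl] := eqVneq y l; first by rewrite bl sk sl'.
    have [->|yrk] := eqVneq y (rho k).
      by rewrite -/(s1 _) hs1 hs' /s1 bk (negbTE sl) (negbTE sk').
    have [->|yrl] := eqVneq y (rho l); first by rewrite -/(s1 _) hs1 hs' /s1 bl sk sl'.
    by rewrite bo.
  + by rewrite sk (negbTE sk').
  + by rewrite /s1 bk (negbTE sl) (negbTE sk').
- exact: hs1.
- by move=> x xS; rewrite /s1 bS // off.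
- by rewrite -cnt -(count_invol s bK uS bS').
exists (b \o b2); split=> //=.
- exact: inj_comp.
- by move=> x; rewrite b2r brho.
- by move=> x xS; rewrite b2S // bS.
Qed.

End Relabeling.

(** * The involution, the hermitian form and the inner product *)

Section Geometry.
Variables (C : numClosedFieldType) (V : lmodType C) (e eta : C).
Variables (om phi : V -> V -> C) (delta : V -> V).
Variables (E : nat -> V) (iota : nat -> nat) (pos : pred nat).
Variables (d : Order.disp_t) (A : orderType d) (sigma : nat -> A).

Definition sg (k : nat) : C := if pos k then 1 else -1.

(** What is used of the matrices: in the basis [E], the two forms and [delta] have one nonzero
    entry in each row, which is a sign. *)
Record geometry : Prop := Geometry {
  g_iso : iso_setting e om E iota sigma;
  g_sq : forall k, om (E k) (E (iota k)) * om (E k) (E (iota k)) = 1;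
  g_sesqui : sesq_form phi;
  g_diag : diag_form E sg phi;
  g_delta : forall a x y, delta (a *: x + y) = a *: delta x + delta y;
  g_deltaE : forall k, delta (E k) = sg k *: E k;
  g_eta : eta * eta = 1;
  g_sgi : forall k, sg (iota k) = eta * sg k }.

Hypothesis G : geometry.
Let H := g_iso G.
Let oH := is_form H.
Let bE := is_base H.
Let iK := is_iotaK H.
Let P := g_sesqui G.
Let D := g_diag G.

Lemma m1_eq1F : (-1 == 1 :> C) = false.
Proof. exact: lt_eqF (lt_trans (ltrN10 C) ltr01). Qed.

Lemma sg_sq k : sg k * sg k = 1.
Proof. by rewrite /sg; case: ifP => _; rewrite ?mulrNN mulr1. Qed.

Lemma sg_conj k : (sg k)^* = sg k.
Proof. exact: conj_sq1 (sg_sq k). Qed.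

Lemma deltaZD a x y : delta (a *: x + y) = a *: delta x + delta y.
Proof. exact: g_delta G a x y. Qed.

Lemma delta0 : delta 0 = 0.
Proof. by have := deltaZD (-1) 0 0; rewrite scaler0 addr0 scaleN1r addNr. Qed.

Lemma deltaZ a x : delta (a *: x) = a *: delta x.
Proof. by have := deltaZD a x 0; rewrite delta0 !addr0. Qed.

Lemma deltaD x y : delta (x + y) = delta x + delta y.
Proof. by have := deltaZD 1 x y; rewrite !scale1r. Qed.

Lemma deltaB x y : delta (x - y) = delta x - delta y.
Proof. by rewrite deltaD -scaleN1r deltaZ scaleN1r. Qed.

Lemma delta_sum (I : Type) (s : seq I) (p : pred I) (F : I -> V) :
  delta (\sum_(i <- s | p i) F i) = \sum_(i <- s | p i) delta (F i).
Proof. by apply: (big_morph delta) => [x y|]; [exact: deltaD|exact: delta0]. Qed.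

Lemma deltaK : involutive delta.
Proof.
apply: (basis_ind bE) => [|a x y hx hy|k]; first by rewrite !delta0.
  by rewrite !deltaZD hx hy.
by rewrite (g_deltaE G) deltaZ (g_deltaE G) scalerA sg_sq scale1r.
Qed.

Lemma delta_om x y : om (delta x) (delta y) = eta * om x y.
Proof.
move: x y; apply: (basis_ind bE) => [y|a x x' hx hx' y|k].
- by rewrite delta0 !(om0l oH) mulr0.
- by rewrite deltaZD !(omDl oH) !(omZl oH) hx hx'; ring.
apply: (basis_ind bE) => [|a x x' hx hx'|l].
- by rewrite delta0 !(om0r oH) mulr0.
- by rewrite deltaZD !(omDr oH) !(omZr oH) hx hx'; ring.
rewrite !(g_deltaE G) (omZl oH) (omZr oH) (om_EE H).
case: eqP => [->|]; last by rewrite !mulr0.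
by rewrite (g_sgi G); transitivity ((sg k * sg k) * eta * om (E k) (E (iota k)));
  [ring|rewrite sg_sq mul1r].
Qed.

Lemma phiC x y : phi y x = (phi x y)^*.
Proof. exact (diag_form_sym H P D sg_sq x y). Qed.

Lemma phi_delta x y : phi (delta x) y = phi x (delta y).
Proof.
move: x y; apply: (basis_ind bE) => [y|a x x' hx hx' y|k].
- by rewrite delta0 !(ph0l P).
- by rewrite deltaZD !(ph_ZDl P) hx hx'.
apply: (basis_ind bE) => [|a x x' hx hx'|l].
- by rewrite delta0 !(ph0r P).
- by rewrite deltaZD !(ph_ZDr P) hx hx'.
rewrite !(g_deltaE G) (phZl P) (phZr P) sg_conj D.
by case: eqP => [->|]; rewrite ?mulr0.
Qed.

(** The positive definite hermitian form for which [E] is orthonormal. *)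
Definition hprod x y := phi (delta x) y.

Lemma hprod_sesqui : sesq_form hprod.
Proof.
split=> a x y z; rewrite /hprod; first by rewrite deltaZD (ph_ZDl P).
by rewrite (ph_ZDr P).
Qed.

Let hP := hprod_sesqui.

Lemma hprod_diag : diag_form E (fun=> 1) hprod.
Proof.
move=> k l; rewrite /hprod (g_deltaE G) (phZl P) sg_conj D.
by case: eqP => _; rewrite ?sg_sq ?mulr0.
Qed.

Lemma hprod_delta x y : hprod (delta x) (delta y) = hprod x y.
Proof. by rewrite /hprod -phi_delta !deltaK. Qed.

Lemma phi_hprod x y : phi x y = hprod (delta x) y.
Proof. by rewrite /hprod deltaK. Qed.

Lemma phi_hprodr x y : phi x y = hprod x (delta y).
Proof. by rewrite /hprod phi_delta deltaK. Qed.

Lemma phi_sumE x y n : (forall k, (n <= k)%N -> basis_coord E y k = 0) ->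
  phi x y = \sum_(k < n) sg k * (basis_coord E x k)^* * basis_coord E y k.
Proof.
move=> hn; have phiE k u : phi u (E k) = sg k * (basis_coord E u k)^*.
  move: u; apply: (basis_ind bE) => [|a u u' hu hu'|l].
  - by rewrite (ph0l P) (bcoord0 bE) rmorph0 mulr0.
  - by rewrite (ph_ZDl P) hu hu' (bcoordZD bE) rmorphD rmorphM /=; ring.
  - by rewrite D (bcoord_basis bE); case: eqP => [->|_]; rewrite ?rmorph1 ?rmorph0 ?mulr1 ?mulr0.
have -> : phi x y = phi x (\sum_(k < n) basis_coord E y k *: E k).
  congr phi; apply: (bcoord_inj bE) => l; rewrite (bcoord_sum bE).
  have [ln|/hn nl] := ltnP l n.
    rewrite (bigD1 (Ordinal ln)) //= (bcoordZ bE) (bcoord_basis bE) eqxx mulr1.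
    rewrite big1 ?addr0 // => k kl; rewrite (bcoordZ bE) (bcoord_basis bE).
    rewrite (negbTE (_ : l != k)) ?mulr0 //.
    by apply: contraNneq kl => lk; apply/eqP/val_inj.
  rewrite nl big1 // => k _; rewrite (bcoordZ bE) (bcoord_basis bE).
  by case: eqP => [lk|]; rewrite ?mulr0 // -lk nl mul0r.
rewrite (ph_sumr P); apply: eq_bigr => k _; rewrite (phZr P) phiE; ring.
Qed.

Lemma delta_coord x k : basis_coord E (delta x) k = sg k * basis_coord E x k.
Proof.
move: x; apply: (basis_ind bE) => [|a u u' hu hu'|l].
- by rewrite delta0 (bcoord0 bE) mulr0.
- by rewrite deltaZD !(bcoordZD bE) hu hu'; ring.
- rewrite (g_deltaE G) (bcoordZ bE) (bcoord_basis bE).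
  by case: eqP => [->|]; rewrite ?mulr0.
Qed.

Lemma hprod_gt0 x : x != 0 -> 0 < hprod x x.
Proof.
move=> x0; have [n [hn _]] := bcoordP bE x.
have [k xk] : exists k, basis_coord E x k != 0.
  by apply: bcoord_neq0 => //; apply/eqP.
have kn : (k < n)%N by rewrite ltnNge; apply: contra xk => /hn ->.
rewrite /hprod (phi_sumE _ hn).
rewrite (eq_bigr (fun i : 'I_n => `|basis_coord E x i| ^+ 2)) => [|i _].
  rewrite (bigD1 (Ordinal kn)) //= ltr_wpDr ?sumr_ge0 // => [i _|].
    by rewrite exprn_ge0.
  by rewrite exprn_gt0 ?normr_gt0.
rewrite delta_coord rmorphM /= sg_conj normCKC !mulrA sg_sq mul1r //.
Qed.

(** On such vectors [delta] is [1] or [-1], so [phi] is, up to this sign, the positive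
    definite form. *)
Lemma phi_sign b x : (forall k, pos k != b -> basis_coord E x k = 0) -> x != 0 ->
  0 < (if b then 1 else -1) * phi x x.
Proof.
move=> hb /hprod_gt0; rewrite phi_hprod.
suff {1}-> : x = (if b then 1 else -1) *: delta x.
  by rewrite (phZl hP); case: (b); rewrite ?rmorphN rmorph1.
apply: (bcoord_inj bE) => k; rewrite (bcoordZ bE) delta_coord /sg.
have [<-|/hb ->] := eqVneq (pos k) b; last by rewrite !mulr0.
by case: (pos k); rewrite ?mulN1r ?opprK ?mul1r.
Qed.

Lemma delta_semi_sym : semi_sym om idfun delta 1 eta.
Proof.
split=> //; [exact: deltaZD| |exact: delta_om|by rewrite mulr1|exact: g_eta].
by move=> x; rewrite deltaK scale1r.
Qed.

Lemma two_neq0 : 2%:R != 0 :> C.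
Proof. by rewrite pnatr_eq0. Qed.

Lemma conj_normal v : cofin_basis E v -> antitri om iota sigma v ->
  exists v', [/\ cofin_basis E v', starred_by om iota v', same_flag sigma v v' &
    forall k, exists m c, delta (v' k) = c *: v' m].
Proof.
move=> ev av; apply: (normal_basis H two_neq0 delta_semi_sym ev av) => k.
by exists k, (sg k); split; [left|exact: g_deltaE].
Qed.

Lemma phi_normal v : cofin_basis E v -> antitri om iota sigma v ->
  exists v', [/\ cofin_basis E v', starred_by om iota v', same_flag sigma v v' &
    forall k, exists m, forall l, l <> m -> phi (v' k) (v' l) = 0].
Proof. exact (dual_normal H (g_sq G) P D sg_sq (g_eta G) (g_sgi G) (v := v)). Qed.

(** Since the form is definite, each vector of a normal basis is its own partner. *)
Lemma hprod_normal v : cofin_basis E v -> antitri om iota sigma v ->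
  exists v', [/\ cofin_basis E v', starred_by om iota v', same_flag sigma v v' &
    forall k l, l <> k -> hprod (v' k) (v' l) = 0].
Proof.
move=> ev av.
have [|||v' [ev' sv' sf hv']] :=
  dual_normal H (g_sq G) hP hprod_diag (eta := 1) _ _ _ ev av; rewrite ?mulr1 //.
exists v'; split=> // k l lk; have [m hm] := hv' k; apply: (hm).
suff -> : m = k by [].
apply: contrapT => mk; have := hprod_gt0 (basis_neq0 k ev'.1).
by rewrite hm ?ltxx // => /esym.
Qed.

Lemma rescale v c : cofin_basis E v -> starred_by om iota v ->
  (forall k, c k != 0) -> finite_set [set k | c k != 1] ->
  let v' := fun k => c k *: v k in
  [/\ cofin_basis E v', starred_by om iota v' & same_flag sigma v v'].
Proof.
move=> [bv fv] sv c0 c1 v'.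
have sv' : starred_by om iota v'.
  move=> k l; rewrite /v' (omZl oH) (omZr oH) !mulf_eq0 !negb_or !c0 /=.
  exact: sv.
have fv' : finite_set [set l | v' l != E l].
  by apply: finite_change fv c1 _ => k vk /= /negP/negPn/eqP ck; rewrite /v' ck scale1r.
have [av' ev' sf] := antitri_change H (v' := v') (starred_antitri sigma sv) (conj bv fv)
  (fun k => lspanZ _ (lspan_mem v (lexx _ : upto sigma k k)))
  (fun k => (starred_antitri sigma sv' k).1) fv'.
by split.
Qed.

Lemma cofin_scale (v : nat -> V) (c : nat -> C) : cofin_basis E v ->
  (forall k, v k = E k -> c k = 1) -> finite_set [set k | c k != 1].
Proof.
move=> [_ fv] h; apply: sub_finite_set fv => k /=.
by apply: contraNneq => /h ->.
Qed.

(** * Conjugate and dual bases: existence, uniqueness of the pair, constraints *)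

Implicit Types (rho w : nat -> nat) (eps : nat -> int) (u v : nat -> V).
Implicit Types (z : nat -> C).
Local Notation sgn b := (if b then 1 else -1 : C).

(** Lets the fixed and the moved points of [w] be treated by one formula. *)
Definition pair_coef w eps k : C := if w k == k then (eps k)%:~R else 1.
Definition signed_invol w eps :=
  involutive w /\ forall k, w k = k -> eps k = 1 \/ eps k = -1.
Definition conjugate_by w eps v := forall k, delta (v k) = pair_coef w eps k *: v (w k).
Definition dual_by w eps v := forall k l,
  phi (v k) (v l) = if l == w k then pair_coef w eps k else 0.

Lemma pair_coef_sq w eps k : signed_invol w eps -> pair_coef w eps k * pair_coef w eps k = 1.
Proof.
move=> [_ h]; rewrite /pair_coef; case: eqP => [/h[->|->]|_]; rewrite ?mulr1 //.
by rewrite mulrNN mulr1.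
Qed.

Lemma pair_coef_neq0 w eps k : signed_invol w eps -> pair_coef w eps k != 0.
Proof. by move=> /(pair_coef_sq k)/neq0_sq1. Qed.

Lemma pair_coef_conj w eps k : signed_invol w eps -> (pair_coef w eps k)^* = pair_coef w eps k.
Proof. by move=> /(pair_coef_sq k)/conj_sq1. Qed.

Lemma pair_coef_w w eps k : signed_invol w eps -> pair_coef w eps (w k) = pair_coef w eps k.
Proof. by move=> [wK _]; rewrite /pair_coef wK eq_sym; case: eqP => [->|]. Qed.

Lemma conj_coord w eps v x k : is_basis v -> signed_invol w eps -> conjugate_by w eps v ->
  basis_coord v (delta x) (w k) = pair_coef w eps k * basis_coord v x k.
Proof.
move=> bv [wK he] cv; move: x; apply: (basis_ind bv) => [|a u u' hu hu'|l].
- by rewrite delta0 !(bcoord0 bv) mulr0.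
- by rewrite deltaZD !(bcoordZD bv) hu hu'; ring.
- rewrite cv (bcoordZ bv) !(bcoord_basis bv) (inj_eq (inv_inj wK)).
  by case: eqP => [->|]; rewrite ?mulr0.
Qed.

Lemma dual_coord w eps v x k : is_basis v -> dual_by w eps v ->
  phi (v k) x = pair_coef w eps k * basis_coord v x (w k).
Proof.
move=> bv dv; move: x; apply: (basis_ind bv) => [|a u u' hu hu'|l].
- by rewrite (ph0r P) (bcoord0 bv) mulr0.
- by rewrite (ph_ZDr P) (bcoordZD bv) hu hu'; ring.
- by rewrite dv (bcoord_basis bv) eq_sym; case: eqP; rewrite ?mulr1 ?mulr0.
Qed.

(** In a normal basis for [delta], the lines are permuted by an involution [w] with
    coefficients [c k * c (w k) = 1]. They are signs at the fixed points of [w], and become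
    [1] elsewhere after rescaling one vector in each 2-cycle. *)
Lemma conjugate_exists v : cofin_basis E v -> antitri om iota sigma v ->
  exists w eps v', [/\ signed_invol w eps, cofin_basis E v', starred_by om iota v',
    same_flag sigma v v' & conjugate_by w eps v'].
Proof.
move=> ev av; have [u [eu su sfu]] := conj_normal ev av.
move=> /choice[w /choice[c hc]]; have bu := eu.1.
have h k : w (w k) = k /\ c k * c (w k) = 1.
  have := deltaK (u k); rewrite hc deltaZ hc scalerA -[RHS]scale1r => h.
  have [//|h1 h2] := basis_collinear bu _ (esym h); first exact: oner_neq0.
  by split.
have wK k : w (w k) = k := (h k).1.
have cw k : c k * c (w k) = 1 := (h k).2.
have c0 k : c k != 0 by apply/eqP => ck; have /eqP := cw k; rewrite ck mul0r eq_sym oner_eq0.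
pose eps k : int := if c k == 1 then 1 else -1.
have wE k : u k = E k -> w k = k.
  move=> uk; have := hc k; rewrite uk (g_deltaE G) -uk => hk.
  by have [<- _] := basis_collinear bu (neq0_sq1 (sg_sq k)) hk.
(* the greater index of each 2-cycle is rescaled *)
pose a k := if (w k < k)%N then c (w k) else 1.
have a0 k : a k != 0 by rewrite /a; case: ifP; rewrite ?oner_eq0.
have a1 k : u k = E k -> a k = 1 by move=> /wE wk; rewrite /a wk ltnn.
have [e' s' sf'] := rescale eu su a0 (cofin_scale eu a1).
exists w, eps, (fun k => a k *: u k); split=> //.
- by split=> // k _; rewrite /eps; case: ifP; [left|right].
- exact: same_flag_trans sfu sf'.
move=> k; rewrite deltaZ hc !scalerA; congr (_ *: _).
rewrite /a /pair_coef wK; case: ltngtP => [wk|wk|wk].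
- by rewrite mulrC cw mul1r.
- by [].
- rewrite mul1r mulr1 /eps.
  have := cw k; rewrite wk => /sq1P[->|->]; first by rewrite eqxx.
  by rewrite m1_eq1F.
Qed.

(** In a normal basis for [phi], each vector has exactly one partner, since [phi] is
    non-degenerate. Rescaling makes the values [1] on the 2-cycles of [w], and turns the
    nonzero real values at its fixed points into signs. *)
Lemma dual_exists v : cofin_basis E v -> antitri om iota sigma v ->
  exists w eps v', [/\ signed_invol w eps, cofin_basis E v', starred_by om iota v',
    same_flag sigma v v' & dual_by w eps v'].
Proof.
move=> ev av; have [u [eu su sfu]] := phi_normal ev av.
move=> /choice[w hw]; have bu := eu.1.
pose b k := phi (u k) (u (w k)).
have b0 k : b k != 0.
  apply/eqP => bk; have h0 : forall x, phi (u k) x = 0.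
    apply: (basis_ind bu) => [|a x y hx hy|l]; first exact: (ph0r P).
      by rewrite (ph_ZDr P) hx hy mulr0 addr0.
    by have [->|/eqP] := eqVneq l (w k); [|exact: hw].
  have := hprod_gt0 (basis_neq0 k bu).
  by rewrite /hprod phi_delta h0 ltxx.
have wK k : w (w k) = k.
  apply: contrapT => wk; have := b0 k; rewrite /b phiC hw ?rmorph0 ?eqxx //.
  exact/nesym.
have bw k : b (w k) = (b k)^* by rewrite /b wK phiC.
pose eps k : int := if 0 < b k then 1 else -1.
have wE k : u k = E k -> w k = k.
  move=> uk; apply: contrapT => wk; have := hw k k; rewrite uk D eqxx.
  move=> /(_ (nesym wk))/eqP; apply/negP; exact: neq0_sq1 (sg_sq _).
pose a k := if (w k < k)%N then (b (w k))^-1 else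
  if w k == k then (sqrtC `|b k|)^-1 else 1.
have a0 k : a k != 0.
  rewrite /a; case: ifP => _; first by rewrite invr_eq0.
  case: ifP => _; last exact: oner_neq0.
  by rewrite invr_eq0 sqrtC_eq0 normr_eq0.
have a1 k : u k = E k -> a k = 1.
  move=> uk; have wk := wE _ uk; rewrite /a wk ltnn eqxx /b wk uk D eqxx.
  by rewrite /sg; case: ifP => _; rewrite ?normrN normr1 sqrtC1 invr1.
have [e' s' sf'] := rescale eu su a0 (cofin_scale eu a1).
exists w, eps, (fun k => a k *: u k); split=> //.
- by split=> // k _; rewrite /eps; case: ifP; [left|right].
- exact: same_flag_trans sfu sf'.
move=> k l; rewrite (phZl P) (phZr P); case: eqP => [->|lk]; last first.
  by rewrite hw // !mulr0.
rewrite -/(b k) /a /pair_coef wK; case: ltngtP => [wk|wk|wk].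
- by rewrite bw -fmorphV conjCK mul1r mulVf.
- by rewrite rmorph1 mul1r mulVf.
have br : (b k)^* = b k by rewrite -bw wk.
have n0 : sqrtC `|b k| != 0 by rewrite sqrtC_eq0 normr_eq0.
have nr : (sqrtC `|b k|)^* = sqrtC `|b k|.
  by apply/CrealP; apply: ger0_real; rewrite sqrtC_ge0.
rewrite wk fmorphV /= nr mulrA -invfM -expr2 sqrtCK mulrC /eps.
have bR : b k \is Num.real by apply/CrealP.
have [lt0|lt0|/eqP] := real_ltgt0P bR.
- by rewrite mulfV.
- by rewrite invrN mulrN mulfV.
- by rewrite (negbTE (b0 k)).
Qed.

(** The coordinate of [v'_k] at [v_k] is nonzero, hence so is that of [delta v'_k] at
    [v_(w k)]. But [delta v'_k] is a multiple of [v'_(w' k)], which has no coordinate above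
    [w' k]. *)
Lemma conj_pair_le v v' w eps w' eps' : is_basis v -> is_basis v' -> same_flag sigma v v' ->
  signed_invol w eps -> signed_invol w' eps' ->
  conjugate_by w eps v -> conjugate_by w' eps' v' ->
  forall k, (sigma (w k) <= sigma (w' k))%O.
Proof.
move=> bv bv' sf sw sw' cv cv' k; rewrite leNgt; apply/negP => lt.
have := conj_coord (v' k) k bv sw cv; rewrite cv' (bcoordZ bv).
rewrite (tri_coord0 bv sf lt) mulr0 => /esym/eqP; rewrite mulf_eq0.
by rewrite (negbTE (pair_coef_neq0 k sw)) (negbTE (tri_diag (is_inj H) bv bv' sf k)).
Qed.

Lemma conj_pair_uniq v v' w eps w' eps' : is_basis v -> is_basis v' -> same_flag sigma v v' ->
  signed_invol w eps -> signed_invol w' eps' ->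
  conjugate_by w eps v -> conjugate_by w' eps' v' ->
  w = w' /\ forall k, pair_coef w eps k = pair_coef w' eps' k.
Proof.
move=> bv bv' sf sw sw' cv cv'.
have ww' : w = w'.
  apply/funext => k; apply: (is_inj H); apply/eqP; rewrite eq_le.
  by rewrite (conj_pair_le bv bv' sf sw sw' cv cv')
    (conj_pair_le bv' bv (same_flag_sym sf) sw' sw cv' cv).
split=> // k; subst w'.
have [wk|wk] := eqVneq (w k) k; last by rewrite /pair_coef (negbTE wk).
have := conj_coord (v' k) k bv sw cv; rewrite cv' (bcoordZ bv) wk => /mulIf -> //.
exact (tri_diag (is_inj H) bv bv' sf k).
Qed.

(** The coordinate of [v'_(w k)] at [v_(w k)] is nonzero, hence so is [phi (v_k) (v'_(w k))].
    Up to conjugation and sign this is the coordinate of [v_k] at [v'_(w' (w k))], which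
    vanishes above [k]. *)
Lemma dual_pair_le v v' w eps w' eps' : is_basis v -> is_basis v' -> same_flag sigma v v' ->
  signed_invol w eps -> signed_invol w' eps' ->
  dual_by w eps v -> dual_by w' eps' v' ->
  forall k, (sigma (w' (w k)) <= sigma k)%O.
Proof.
move=> bv bv' sf sw sw' dv dv' k; rewrite leNgt; apply/negP => lt.
have := dual_coord (v' (w k)) k bv dv; rewrite phiC (dual_coord _ _ bv' dv').
rewrite (tri_coord0 bv' (same_flag_sym sf) lt) mulr0 rmorph0 => /esym/eqP.
rewrite mulf_eq0 (negbTE (pair_coef_neq0 k sw)) /=; apply/negP.
exact (tri_diag (is_inj H) bv bv' sf _).
Qed.

Lemma dual_pair_uniq v v' w eps w' eps' : is_basis v -> is_basis v' -> same_flag sigma v v' ->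
  signed_invol w eps -> signed_invol w' eps' ->
  dual_by w eps v -> dual_by w' eps' v' ->
  w = w' /\ forall k, pair_coef w eps k = pair_coef w' eps' k.
Proof.
move=> bv bv' sf sw sw' dv dv'.
have [wK _] := sw; have [wK' _] := sw'.
have ww' : w = w'.
  apply/funext => k; apply: (inv_inj wK'); rewrite wK'.
  apply: (is_inj H); apply/eqP; rewrite eq_le (dual_pair_le bv bv' sf sw sw' dv dv') /=.
  have := dual_pair_le bv' bv (same_flag_sym sf) sw' sw dv' dv (w' (w k)).
  by rewrite wK' wK.
split=> // k; subst w'.
have [wk|wk] := eqVneq (w k) k; last by rewrite /pair_coef (negbTE wk).
have := dual_coord (v' k) k bv dv; rewrite phiC (dual_coord _ _ bv' dv') wk.
rewrite rmorphM /= (pair_coef_conj _ sw') => h.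
have b0 := tri_diag (is_inj H) bv bv' sf k.
(* the two signs differ by a positive factor *)
have h2 : pair_coef w eps' k = pair_coef w eps k * `|basis_coord v (v' k) k| ^+ 2.
  rewrite normCK mulrA -h -mulrA -rmorphM mulrC /=.
  by rewrite [_ * basis_coord v (v' k) k]mulrC (tri_diagV (is_inj H) bv bv' sf) rmorph1 mul1r.
have p0 : 0 < `|basis_coord v (v' k) k| ^+ 2 by rewrite exprn_gt0 ?normr_gt0.
move: (sq1P (pair_coef_sq k sw)) (sq1P (pair_coef_sq k sw')) => [h1|h1] [h1'|h1'];
  rewrite h1 h1' //; move: h2 p0; rewrite h1 h1'.
- by rewrite mul1r => <-; rewrite oppr_gt0 ltr10.
- by rewrite mulN1r => /eqP; rewrite -eqr_oppLR => /eqP <-; rewrite oppr_gt0 ltr10.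
Qed.

Lemma starred_eq v k l : starred_by om iota v -> om (v k) (v l) != 0 -> l = iota k.
Proof. by move=> sv; rewrite sv => /eqP. Qed.

(** Compare [om (delta v_k) (delta v_(iota k))] with [om (v_k) (v_(iota k))]. *)
Lemma conj_omE v w eps : is_basis v -> starred_by om iota v ->
  signed_invol w eps -> conjugate_by w eps v ->
  (forall k, iota (w k) = w (iota k)) /\
  forall k, pair_coef w eps k * pair_coef w eps (iota k) * om (v (w k)) (v (iota (w k))) =
    eta * om (v k) (v (iota k)).
Proof.
move=> bv sv sw cv; have eta0 := neq0_sq1 (g_eta G).
have h k : pair_coef w eps k * (pair_coef w eps (iota k) * om (v (w k)) (v (w (iota k)))) =
    eta * om (v k) (v (iota k)).
  by rewrite -delta_om !cv (omZl oH) (omZr oH).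
have z0 k : om (v k) (v (iota k)) != 0 by rewrite sv.
have comm k : iota (w k) = w (iota k).
  apply/esym/(starred_eq sv); have := mulf_neq0 eta0 (z0 k).
  by rewrite -h; apply: contraNneq => ->; rewrite !mulr0.
by split=> // k; rewrite comm -mulrA h.
Qed.

(** If [w k = k], the relation of [conj_omE] compares the signs at [k] and [iota k]. If
    [w k = iota k], it compares [om (v_(iota k)) (v_k)] with [om (v_k) (v_(iota k))] and gives
    [e = eta]. *)
Lemma conj_admissible v w eps : is_basis v -> starred_by om iota v ->
  signed_invol w eps -> conjugate_by w eps v ->
  [/\ forall k, iota (w k) = w (iota k),
      forall k, w k = k -> (eps (iota k))%:~R = eta * (eps k)%:~R :> C &
      eta * e = -1 -> forall k, w k <> iota k].
Proof.
move=> bv sv sw cv; have [comm h] := conj_omE bv sv sw cv.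
have z0 k : om (v k) (v (iota k)) != 0 by rewrite sv.
split=> // [k wk|he k wk].
  have wik : w (iota k) = iota k by rewrite -comm wk.
  have := h k; rewrite wk => /(mulIf (z0 k)) <-.
  have := pair_coef_sq k sw; rewrite /pair_coef wk wik !eqxx => h1.
  by rewrite mulrC mulrA h1 mul1r.
have wik : w (iota k) = k by rewrite -wk; case: sw => ->.
have zi : om (v (iota k)) (v k) = e * om (v k) (v (iota k)) by apply: (omC oH).
have fi : pair_coef w eps (iota k) = pair_coef w eps k by rewrite -wk (pair_coef_w _ sw).
have := h k; rewrite wk iK zi fi (pair_coef_sq _ sw) mul1r.
move=> /(mulIf (z0 k)) ee.
by move: he; rewrite -ee (om_ee oH) => /eqP; rewrite eq_sym m1_eq1F.
Qed.

(** The operator [tau] permutes the lines of a starred dual basis by [iota \o w]; then use its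
    compatibility with [om], as for [delta]. *)
Lemma dual_omE v w eps : is_basis v -> starred_by om iota v ->
  signed_invol w eps -> dual_by w eps v ->
  (forall k, iota (w k) = w (iota k)) /\
  forall k, om (v (w k)) (v (iota (w k))) * (om (v k) (v (iota k)))^* =
    eta * (pair_coef w eps k * pair_coef w eps (iota k)).
Proof.
move=> bv sv sw dv; have eta0 := neq0_sq1 (g_eta G); have [wK _] := sw.
have pT := phi_tau H (g_sq G) P D.
have tS := tau_semi_sym H (g_sq G) sg_sq (g_eta G) (g_sgi G).
set T := tau e om E iota sg in pT tS.
have z0 k : om (v k) (v (iota k)) != 0 by rewrite sv.
pose r k := pair_coef w eps k / om (v (iota (w k))) (v (w k)).
have zi k : om (v (iota k)) (v k) != 0 by have := z0 (iota k); rewrite iK.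
have hT k : T (v k) = r k *: v (iota (w k)).
  apply/eqP; rewrite -subr_eq0; apply/eqP; apply: (om_nondeg_basis H bv) => l.
  rewrite (omBl oH) -pT dv (omZl oH); case: eqP => [->|lk].
    by rewrite /r mulfVK ?subrr.
  suff /eqP -> : om (v (iota (w k))) (v l) == 0 by rewrite mulr0 subr0.
  by apply/negbFE; rewrite sv iK; apply/eqP.
have h k : r k * (r (iota k) * om (v (iota (w k))) (v (iota (w (iota k))))) =
    eta * (om (v k) (v (iota k)))^*.
  by rewrite -(ss_om tS) !hT (omZl oH) (omZr oH).
have comm k : iota (w k) = w (iota k).
  have : om (v (iota (w k))) (v (iota (w (iota k)))) != 0.
    have : eta * (om (v k) (v (iota k)))^* != 0 by rewrite mulf_neq0 ?fmorph_eq0.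
    by rewrite -h; apply: contraNneq => ->; rewrite !mulr0.
  by rewrite sv => /eqP /(inv_inj iK).
split=> // k; have := h k; rewrite -comm iK /r -comm iK.
set z := om (v (w k)) _; set z' := om (v (iota (w k))) _ => hk.
have zz : z' != 0 by exact: zi.
have z1 : z != 0 by exact: z0.
transitivity (eta * eta * z * (om (v k) (v (iota k)))^*).
  by rewrite (g_eta G) mul1r.
set q := (om (v k) _)^* in hk *.
have -> : eta * eta * z * q = eta * z * (eta * q) by ring.
rewrite -hk.
by field; rewrite zz z1.
Qed.

(** If [w k] is [k] or [iota k], the left-hand side of [dual_omE] is, up to the factor [e] in
    the second case, a complex number times its conjugate, hence positive, and this
    determines the signs on the right. *)
Lemma dual_admissible v w eps : is_basis v -> starred_by om iota v ->
  signed_invol w eps -> dual_by w eps v ->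
  [/\ forall k, iota (w k) = w (iota k),
      forall k, w k = k -> (eps (iota k))%:~R = eta * (eps k)%:~R :> C &
      eta * e = -1 -> forall k, w k <> iota k].
Proof.
move=> bv sv sw dv; have [comm h] := dual_omE bv sv sw dv.
have z0 k : om (v k) (v (iota k)) != 0 by rewrite sv.
have zz k : 0 < om (v k) (v (iota k)) * (om (v k) (v (iota k)))^*.
  by rewrite mul_conjC_gt0.
have pos1 (a : C) : a * a = 1 -> 0 < a -> a = 1.
  by move=> /sq1P[//|->]; rewrite oppr_gt0 ltr10.
split=> // [k wk|he k wk].
  have wik : w (iota k) = iota k by rewrite -comm wk.
  have := zz k; have := h k; rewrite wk => -> /pos1.
  have := pair_coef_sq k sw; have := pair_coef_sq (iota k) sw.
  rewrite /pair_coef wk wik !eqxx => h2 h1 h3.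
  have {}h3 : eta * ((eps k)%:~R * (eps (iota k))%:~R) = 1 :> C.
    apply: h3; rewrite mulrACA (g_eta G) mul1r mulrACA h1 h2 mulr1 //.
  transitivity (eta * ((eps k)%:~R * (eps (iota k))%:~R) * (eps (iota k))%:~R : C).
    by rewrite h3 mul1r.
  by rewrite -!mulrA h2 mulr1.
have wik : w (iota k) = k by rewrite -wk; case: sw => ->.
have := h k; rewrite wk iK (omC oH (v k)) -wk (pair_coef_w _ sw) (pair_coef_sq _ sw) wk mulr1.
rewrite -mulrA => h1; have := zz k.
have -> : om (v k) (v (iota k)) * (om (v k) (v (iota k)))^* = e * eta.
  by rewrite -h1 mulrA (om_ee oH) mul1r.
by rewrite mulrC he oppr_gt0 ltr10.
Qed.

(** * Comparing two bases of one flag *)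

Local Notation h := hprod.

Definition h_orthonormal u := forall k l, h (u k) (u l) = if l == k then 1 else 0.

Lemma orthonormal_coord u x k : is_basis u -> h_orthonormal u ->
  h (u k) x = basis_coord u x k.
Proof.
move=> bu ou; move: x; apply: (basis_ind bu) => [|a y z hy hz|l].
- by rewrite (ph0r hP) (bcoord0 bu).
- by rewrite (ph_ZDr hP) (bcoordZD bu) hy hz.
- by rewrite ou (bcoord_basis bu) eq_sym; case: eqP.
Qed.

Lemma orthonormal_line u x j : is_basis u -> h_orthonormal u ->
  (forall b, b != j -> h (u b) x = 0) -> exists c, x = c *: u j.
Proof.
move=> bu ou hx; exists (h (u j) x); apply: (bcoord_inj bu) => b.
rewrite -(orthonormal_coord _ _ bu ou) (bcoordZ bu) (bcoord_basis bu).
by have [->|/hx ->] := eqVneq b j; rewrite ?mulr1 ?mulr0.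
Qed.

Lemma orthonormal_exists v : cofin_basis E v -> antitri om iota sigma v ->
  exists u, [/\ cofin_basis E u, starred_by om iota u, same_flag sigma v u & h_orthonormal u].
Proof.
move=> ev av; have [u [eu su sf hu]] := hprod_normal ev av.
have h0 k : 0 < h (u k) (u k) by apply: hprod_gt0; apply: basis_neq0 eu.1.
pose a k := (sqrtC (h (u k) (u k)))^-1.
have s0 k : sqrtC (h (u k) (u k)) != 0 by rewrite sqrtC_eq0 gt_eqF.
have a0 k : a k != 0 by rewrite invr_eq0.
have a1 k : u k = E k -> a k = 1.
  by move=> uk; rewrite /a uk hprod_diag eqxx sqrtC1 invr1.
have [e' s' sf'] := rescale eu su a0 (cofin_scale eu a1).
exists (fun k => a k *: u k); split=> //; first exact: same_flag_trans sf sf'.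
move=> k l; rewrite (phZl hP) (phZr hP); case: eqP => [->|lk]; last first.
  by rewrite hu // !mulr0.
have -> : (a k)^* = a k.
  by apply/CrealP; apply: ger0_real; rewrite invr_ge0 sqrtC_ge0 ltW.
by rewrite mulrA -invfM -expr2 sqrtCK mulVf // gt_eqF.
Qed.

Lemma conj_fix v w eps k : is_basis v -> signed_invol w eps ->
  conjugate_by w eps v -> v k = E k -> w k = k /\ pair_coef w eps k = sg k.
Proof.
move=> bv sw cv vk; have := cv k; rewrite {1}vk (g_deltaE G) -vk => hk.
have [kw fk] := basis_collinear bv (neq0_sq1 (sg_sq k)) hk.
by split.
Qed.

Lemma dual_fix v w eps k : dual_by w eps v -> v k = E k ->
  w k = k /\ pair_coef w eps k = sg k.
Proof.
move=> dv vk; have := dv k k; rewrite {1 2}vk D eqxx; case: eqP => // _ h0.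
by have := sg_sq k; rewrite h0 mulr0 => /esym/eqP; rewrite oner_eq0.
Qed.

(** The vector [delta u_k] is orthogonal to every [u_b] with [b <> w k]. If [w b] is lower than
    [k], then [u_b] is on the line of [delta u_(w b)] and [delta] is an isometry. Otherwise
    [u_k] may be replaced by the vector at [k] of another basis of the flag, the lower terms
    being harmless: the conjugate basis [v1] settles the [b] above [w k], and the dual basis
    [v2] those below. *)
Lemma delta_lines_step v1 v2 u w eps k :
  is_basis v1 -> is_basis v2 -> is_basis u ->
  same_flag sigma v1 u -> same_flag sigma v2 u ->
  signed_invol w eps -> conjugate_by w eps v1 -> dual_by w eps v2 ->
  h_orthonormal u ->
  (forall a, (sigma a < sigma k)%O -> exists c, delta (u a) = c *: u (w a)) ->
  exists c, delta (u k) = c *: u (w k).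
Proof.
move=> b1 b2 bu s1 s2 sw c1 d2 ou IH; have [wK _] := sw.
apply: orthonormal_line => // b bk.
have [wbk|wbk] := boolP (sigma (w b) < sigma k)%O.
  have [c hc] := IH _ wbk; rewrite wK in hc.
  have c0 : c != 0.
    apply: contraNneq (basis_neq0 (w b) bu) => c0.
    by rewrite -[u _]deltaK hc c0 scale0r delta0.
  apply/eqP; have := hprod_delta (u (w b)) (u k).
  rewrite hc (phZl hP) ou ifN; last by apply: contraNneq bk => ->; rewrite wK.
  by move/eqP; rewrite mulf_eq0 fmorph_eq0 (negbTE c0).
have low f : lspan u (below sigma k) f -> h (u b) (delta f) = 0.
  move: f; apply: lspan_ind => [|a x y hx hy|a ak]; first by rewrite delta0 (ph0r hP).
    by rewrite deltaZD (ph_ZDr hP) hx hy mulr0 addr0.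
  have [c ->] := IH _ ak; rewrite (phZr hP) ou ifN ?mulr0 //.
  by apply: contraNneq wbk => <-; rewrite wK.
have dec v : is_basis v -> same_flag sigma v u ->
    h (u b) (delta (u k)) = basis_coord v (u k) k * h (u b) (delta (v k)).
  move=> bv sf; have := tri_rest (is_inj H) bv sf k.
  rewrite (same_flag_below k sf) => /low.
  rewrite deltaB deltaZ (phBr hP) (phZr hP) => /eqP.
  by rewrite subr_eq0 => /eqP.
have [bw|bw|/(is_inj H) bw] := ltgtP (sigma b) (sigma (w k)); last first.
- by rewrite bw eqxx in bk.
- rewrite (dec _ b1 s1) c1 (phZr hP).
  rewrite [h _ _](ph_lspan0 hP (v := u) (D := upto sigma (w k))) ?mulr0 //.
    move=> a; rewrite /upto /= => aw; rewrite ou ifN //.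
    by apply: contraTneq aw => ->; rewrite -ltNge.
  by rewrite -s1; apply: lspan_mem; apply: lexx.
- rewrite (dec _ b2 s2) -phi_hprodr.
  apply/eqP; rewrite mulf_eq0; apply/orP; right; apply/eqP.
  apply: (ph_lspan20 P (v := v2) (D := upto sigma b) (v' := v2) (D' := [set k])).
  + move=> i j; rewrite /upto /= => ib ->; rewrite d2 ifN //.
    by apply: contraTneq bw => ->; rewrite wK -leNgt.
  + by rewrite s2; apply: lspan_mem; apply: lexx.
  + exact: lspan_mem.
Qed.

(** Going along the flag, [delta_lines_step] shows that [delta] permutes the lines of an
    orthonormal starred basis. The coefficients have modulus 1 since [delta] is an isometry,
    so the rescaling that makes the basis conjugate keeps it orthonormal, and a conjugate
    orthonormal basis is dual. *)
Lemma common_basis v1 v2 w eps : cofin_basis E v1 -> cofin_basis E v2 ->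
  antitri om iota sigma v1 -> same_flag sigma v1 v2 ->
  signed_invol w eps -> conjugate_by w eps v1 -> dual_by w eps v2 ->
  exists u, [/\ cofin_basis E u, starred_by om iota u, same_flag sigma v1 u,
    conjugate_by w eps u & dual_by w eps u].
Proof.
move=> ev1 ev2 av sf sw c1 d2; have [u [eu su sfu ou]] := orthonormal_exists ev1 av.
have [wK _] := sw; have bu := eu.1.
have sf2 : same_flag sigma v2 u by apply: same_flag_trans sfu; apply: same_flag_sym.
have [S hS] : exists S : seq nat, forall k, k \notin S -> u k = E k /\ v1 k = E k.
  have /finite_seqP[S hS] : finite_set ([set k | u k != E k] `|` [set k | v1 k != E k]).
    by rewrite finite_setU; split; [exact: eu.2|exact: ev1.2].
  exists S => k kS; have : ~ ([set` S] k) by apply/negP.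
  by rewrite -hS /= => /not_orP[/negP/negPn/eqP ? /negP/negPn/eqP ?].
have lines k : exists c, delta (u k) = c *: u (w k).
  have [n] := ubnP (size [seq a <- S | (sigma a < sigma k)%O]).
  elim: n => // n IHn in k *; rewrite ltnS => le_n.
  have [kS|kS] := boolP (k \in S); last first.
    have [uk vk] := hS _ kS; exists (sg k).
    by rewrite (conj_fix ev1.1 sw c1 vk).1 uk (g_deltaE G).
  apply: (delta_lines_step ev1.1 ev2.1 bu sfu sf2 sw c1 d2 ou) => a ak.
  have [aS|aS] := boolP (a \in S); last first.
    have [ua va] := hS _ aS; exists (sg a).
    by rewrite (conj_fix ev1.1 sw c1 va).1 ua (g_deltaE G).
  apply: IHn; apply: leq_trans le_n; rewrite !size_filter.
  apply: (count_ltn (x := a)) => //; last by rewrite ltxx.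
  by move=> b _; move/lt_trans; apply.
move: lines => /choice[c hc].
have cc k : c k * c (w k) = 1.
  have := deltaK (u k); rewrite hc deltaZ hc wK scalerA -[RHS]scale1r => hk.
  by have [_ <-] := basis_collinear bu (oner_neq0 _) (esym hk).
have cn k : (c k)^* * c k = 1.
  have := hprod_delta (u k) (u k); rewrite hc (phZl hP) (phZr hP) !ou !eqxx.
  by rewrite mulr1.
have cfix k : w k = k -> c k = pair_coef w eps k.
  move=> wk; have := conj_coord (u k) k ev1.1 sw c1; rewrite hc (bcoordZ ev1.1) wk.
  by move/mulIf; apply; exact: (tri_diag (is_inj H) ev1.1 bu sfu k).
pose a k := if (w k < k)%N then c (w k) else 1.
have a0 k : a k != 0.
  rewrite /a; case: ifP; rewrite ?oner_eq0 // => _.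
  by apply/eqP => ck; have /eqP := cc (w k); rewrite ck mul0r eq_sym oner_eq0.
have an k : (a k)^* * a k = 1 by rewrite /a; case: ifP; rewrite ?cn ?rmorph1 ?mulr1.
have a1 k : u k = E k -> a k = 1.
  move=> uk; have := hc k; rewrite uk (g_deltaE G) -uk => hk.
  have [wk _] := basis_collinear bu (neq0_sq1 (sg_sq k)) hk.
  by rewrite /a -wk ltnn.
have [e' s' sf'] := rescale eu su a0 (cofin_scale eu a1).
have cu : conjugate_by w eps (fun k => a k *: u k).
  move=> k; rewrite deltaZ hc !scalerA; congr (_ *: _); rewrite /a wK.
  have := cfix k; rewrite /pair_coef; case: ltngtP => [wk _|wk _|wk ->//].
  - by rewrite mulrC cc mul1r.
  - by rewrite mul1r.
  - by rewrite mul1r mulr1.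
exists (fun k => a k *: u k); split=> //; first exact: same_flag_trans sfu sf'.
move=> k l; rewrite phi_hprod cu !(phZl hP) (phZr hP) ou (pair_coef_conj _ sw).
case: eqP => [->|_]; last by rewrite !mulr0.
by rewrite mulr1 an mulr1.
Qed.

(** Multiply [v_k] by a square root of the ratio [r k] of the two values of [om] at
    [(k, iota k)]. This ratio is invariant under [iota]; by [conj_omE] it is invariant under
    [w] for conjugate bases, and by [dual_omE] it is changed by [w] into the inverse of its
    conjugate for dual ones, so conjugacy or duality is preserved. *)
Lemma match_values v v' w eps :
  cofin_basis E v -> cofin_basis E v' -> starred_by om iota v -> starred_by om iota v' ->
  signed_invol w eps ->
  exists u, [/\ cofin_basis E u, same_flag sigma v u,
    forall k l, om (u k) (u l) = om (v' k) (v' l),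
    conjugate_by w eps v -> conjugate_by w eps v' -> conjugate_by w eps u &
    dual_by w eps v -> dual_by w eps v' -> dual_by w eps u].
Proof.
move=> ev ev' sv sv' sw; have [wK _] := sw.
pose z k := om (v k) (v (iota k)); pose z' k := om (v' k) (v' (iota k)).
have z0 k : z k != 0 by rewrite sv.
have z0' k : z' k != 0 by rewrite sv'.
have zi k : z (iota k) = e * z k by rewrite /z iK; apply: (omC oH).
have zi' k : z' (iota k) = e * z' k by rewrite /z' iK; apply: (omC oH).
pose r k := z' k / z k.
have e0 : e != 0 := eps_neq0 oH.
have ri k : r (iota k) = r k by rewrite /r zi zi'; field; rewrite e0 z0.
have r0 k : r k != 0 by rewrite mulf_neq0 ?invr_eq0.
pose c k := sqrtC (r k).
have c0 k : c k != 0 by rewrite sqrtC_eq0.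
have cc k : c k * c (iota k) = r k by rewrite /c ri -expr2 sqrtCK.
have fc : finite_set [set k | c k != 1].
  set F := [set k | v k != E k] `|` [set k | v' k != E k].
  have fF : finite_set F by rewrite finite_setU; split; [exact: ev.2|exact: ev'.2].
  apply: (@sub_finite_set _ _ (F `|` iota @` F)); last first.
    by rewrite finite_setU; split => //; apply: finite_image.
  move=> k /= ck; apply: contrapT => /not_orP[nF nF'].
  have nE j : ~ F j -> v j = E j /\ v' j = E j.
    by rewrite /F /= => /not_orP[/negP/negPn/eqP ? /negP/negPn/eqP ?].
  have [vk vk'] := nE _ nF.
  have [vi vi'] : v (iota k) = E (iota k) /\ v' (iota k) = E (iota k).
    by apply: nE => Fi; apply: nF'; exists (iota k); rewrite ?iK.
  move: ck; rewrite /c /r /z /z' vk vk' vi vi' divff ?sqrtC1 ?eqxx //.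
  by rewrite (is_starE H).
have [eu su sf] := rescale ev sv c0 fc.
have f0 k := pair_coef_neq0 k sw.
exists (fun k => c k *: v k); split=> //.
- move=> k l; have [->|lk] := eqVneq l (iota k).
    by rewrite (omZl oH) (omZr oH) mulrA cc /r -/(z k) mulfVK.
  have -> : om (v' k) (v' l) = 0 by apply/eqP/negbFE; rewrite sv'; apply/negbTE.
  by apply/eqP/negbFE; rewrite su; apply/negbTE.
- move=> cv cv' k; rewrite deltaZ cv !scalerA; congr (_ *: _).
  have [comm hz] := conj_omE ev.1 sv sw cv.
  have [_ hz'] := conj_omE ev'.1 sv' sw cv'.
  rewrite mulrC; congr (_ * _); rewrite /c; congr sqrtC.
  have eta0 := neq0_sq1 (g_eta G).
  have zw j : z (w j) = eta * z j / (pair_coef w eps j * pair_coef w eps (iota j)).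
    by rewrite -hz /z; field; rewrite !f0.
  have zw' j : z' (w j) = eta * z' j / (pair_coef w eps j * pair_coef w eps (iota j)).
    by rewrite -hz' /z'; field; rewrite !f0.
  by rewrite /r zw zw'; field; rewrite eta0 z0 !f0.
- move=> dv dv' k l; rewrite (phZl P) (phZr P) dv; case: eqP => [->|_]; last first.
    by rewrite !mulr0.
  have [comm hz] := dual_omE ev.1 sv sw dv.
  have [_ hz'] := dual_omE ev'.1 sv' sw dv'.
  suff cw : (c k)^* * c (w k) = 1 by rewrite mulrA cw mul1r.
  have rw : r (w k) * (r k)^* = 1.
    rewrite /r rmorphM fmorphV /=.
    have h1 := hz k; have h2 := hz' k; rewrite -/(z k) -/(z (w k)) in h1.
    rewrite -/(z' k) -/(z' (w k)) in h2.
    have zz : z (w k) * (z k)^* != 0 by rewrite mulf_neq0 ?fmorph_eq0.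
    have -> : z' (w k) / z (w k) * ((z' k)^* / (z k)^*) =
        (z' (w k) * (z' k)^*) / (z (w k) * (z k)^*).
      by field; rewrite fmorph_eq0 !z0.
    by rewrite h2 -h1 divff.
  have n0 : `|r k| != 0 by rewrite normr_eq0.
  have rwE : r (w k) = (`|r k|^-1 ^+ 2) * r k.
    apply: (mulIf (_ : (r k)^* != 0)); first by rewrite fmorph_eq0.
    by rewrite rw -mulrA -normCK exprVn mulVf // expf_neq0.
  have cE : sqrtC (`|r k|^-1 ^+ 2 * r k) = `|r k|^-1 * sqrtC (r k).
    by rewrite rootCMl ?exprn_ge0 ?invr_ge0 // sqrCK ?invr_ge0.
  rewrite /c rwE cE.
  rewrite mulrCA [_^* * _]mulrC -normCK.
  have -> : `|sqrtC (r k)| ^+ 2 = `|r k| by rewrite -normrX sqrtCK.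
  by rewrite mulVf.
Qed.

(** * Signature *)

(** The indices that account for the positive part of a conjugate or dual basis: the positive
    fixed points of [w] and one point of each 2-cycle. *)
Definition plus_index (w : nat -> nat) (eps : nat -> int) (k : nat) : bool :=
  if w k == k then eps k == 1 else (k < w k)%N.

Section Signature.
Variables (w : nat -> nat) (eps : nat -> int) (v : nat -> V).
Hypotheses (sw : signed_invol w eps) (ev : cofin_basis E v).
Let wK := sw.1.

Lemma plus_index_w k : w k != k -> plus_index w eps (w k) = ~~ plus_index w eps k.
Proof.
by rewrite /plus_index wK => wk; rewrite eq_sym (negbTE wk); case: ltngtP wk.
Qed.

(** The eigenvectors of [delta], respectively the definite vectors of [phi], that a
    conjugate, respectively dual, basis provides: one for each index. *)
Definition split_vec b k := v k + (if w k == k then 0 else sgn b) *: v (w k).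

Lemma split_vec_conj b k : conjugate_by w eps v -> plus_index w eps k = b ->
  delta (split_vec b k) = sgn b *: split_vec b k.
Proof.
move=> cv; rewrite /plus_index /split_vec deltaD deltaZ !cv (pair_coef_w _ sw) wK /pair_coef.
case: eqP => [wk <-|wk _]; last first.
  rewrite !scale1r scalerDr scalerA addrC; congr (_ + _).
  by case: (b); rewrite ?mulrNN mulr1 scale1r.
rewrite !scale0r !addr0 wk.
by case: (sw.2 _ wk) => ->.
Qed.

Lemma split_vec_dual b k : dual_by w eps v -> plus_index w eps k = b ->
  0 <= sgn b * phi (split_vec b k) (split_vec b k).
Proof.
move=> dv hk.
have cs : (if w k == k then 0 else sgn b)^* = if w k == k then 0 else sgn b.
  by case: ifP; case: (b); rewrite ?rmorphN ?rmorph0 ?rmorph1.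
rewrite /split_vec (phDl P) !(phDr P) !(phZl P) !(phZr P) !dv wK eqxx cs.
rewrite (pair_coef_w _ sw) /pair_coef !(eq_sym k (w k)).
move: hk; rewrite /plus_index; case: eqP => [wk|wk _].
  rewrite !mul0r !addr0 => <-.
  by case: (sw.2 _ wk) => -> /=; rewrite ?mulrNN mulr1 ler01.
rewrite eqxx !mulr0 !mulr1 addr0 add0r.
by case: (b); rewrite ?mul1r ?mulN1r ?opprD ?opprK addr_ge0.
Qed.

Lemma split_vec_ortho b k l : dual_by w eps v -> plus_index w eps k = b ->
  plus_index w eps l = b -> k != l -> phi (split_vec b k) (split_vec b l) = 0.
Proof.
move=> dv hk hl kl.
have lwk : l != w k.
  apply: contra kl => /eqP lw; move: hl; rewrite lw; have [->//|wk] := eqVneq (w k) k.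
  by rewrite plus_index_w // hk; case: (b).
have wlk : (w l == k) = false by apply/negbTE; apply: contra lwk => /eqP <-; rewrite wK.
rewrite /split_vec (phDl P) !(phDr P) !(phZl P) !(phZr P) !dv wK.
rewrite (negbTE lwk) (inj_eq (inv_inj wK)) !(eq_sym l k) (negbTE kl) wlk.
by rewrite !mulr0 !addr0.
Qed.

Lemma split_vec_coord b k l : plus_index w eps k = b -> plus_index w eps l = b ->
  basis_coord v (split_vec b k) l = (l == k)%:R.
Proof.
move=> hk hl; rewrite /split_vec (bcoordD ev.1) (bcoordZ ev.1) !(bcoord_basis ev.1).
have [wk|wk] := eqVneq (w k) k; first by rewrite mul0r addr0.
suff /negbTE -> : l != w k by rewrite mulr0 addr0.
apply/eqP => lw; move: hl; rewrite lw plus_index_w ?hk //.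
by case: (b).
Qed.

Variable S : seq nat.
Hypotheses (aS : adapted E S v) (wS : {in S, forall k, w k \in S}).
Hypothesis cdv : conjugate_by w eps v \/ dual_by w eps v.

(** With more such indices than dimensions, some nonzero combination [x] of the [split_vec]
    would be supported where [pos] has the value opposite to [b]. For a conjugate basis it is
    an eigenvector of [delta] for the sign [b], hence zero; for a dual basis [phi x x] would
    have both signs. *)
Lemma plus_index_count_le b :
  (count (fun k => plus_index w eps k == b) S <= count (fun k => pos k == b) S)%N.
Proof.
have [uS _ hin] := aS.
rewrite leqNgt; apply/negP => lt; rewrite -!size_filter in lt.
have [c [c0 [k kA ck] hc]] :=
  homog_system (fun a l => basis_coord E (split_vec b a) l) (filter_uniq _ uS) lt.
set Q := [seq k <- S | plus_index w eps k == b] in c0 kA hc.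
have Qh a : a \in Q -> plus_index w eps a = b by rewrite mem_filter => /andP[/eqP].
pose x := \sum_(a <- Q) c a *: split_vec b a.
have x0 : x != 0.
  apply/eqP => x_0; have : basis_coord v x k = 0 by rewrite x_0 (bcoord0 ev.1).
  rewrite (bcoord_sum ev.1) (bigD1_seq k) ?filter_uniq //= big1_seq.
    rewrite addr0 (bcoordZ ev.1) split_vec_coord ?Qh // eqxx mulr1 => ck0.
    by rewrite ck0 eqxx in ck.
  move=> a /andP[ak aQ]; rewrite (bcoordZ ev.1) split_vec_coord ?Qh //.
  by rewrite eq_sym (negbTE ak) mulr0.
have xb l : pos l == b -> basis_coord E x l = 0.
  move=> lb; have [lS|lS] := boolP (l \in S).
    rewrite (bcoord_sum bE); under eq_bigr do rewrite (bcoordZ bE).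
    by apply: hc; rewrite mem_filter lb.
  have : lspan E [set` S] x.
    apply: lspan_sum => a; rewrite mem_filter => /andP[_ aS']; apply: lspanZ.
    by apply: lspanD; [exact: hin|apply: lspanZ; apply: hin; apply: wS].
  by move/(lspan_coord bE); apply => /=; apply/negP.
case: cdv => [cv|dv].
  move/eqP: x0; apply; apply: (bcoord_inj bE) => l; rewrite (bcoord0 bE).
  have [/xb//|lb] := boolP (pos l == b).
  have dx : delta x = sgn b *: x.
    rewrite /x delta_sum scaler_sumr [LHS]big_seq [RHS]big_seq.
    apply: eq_bigr => a aQ; rewrite deltaZ split_vec_conj ?Qh //.
    by rewrite !scalerA mulrC.
  have := delta_coord x l; rewrite dx (bcoordZ bE) /sg => /eqP.
  rewrite -subr_eq0 -mulrBl mulf_eq0 subr_eq0 => /orP[|/eqP//].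
  have n1 : (-1 == 1 :> C) = false := lt_eqF (lt_trans (ltrN10 C) ltr01).
  by move: lb; case: (b); case: (pos l) => // _; rewrite ?n1 // eq_sym n1.
have := phi_sign (b := ~~ b) (x := x); rewrite x0 => /(_ _ isT) h.
have {}h : 0 < sgn (~~ b) * phi x x.
  by apply: h => l; rewrite -eqb_negLR ?negbK => lb; apply: xb; case: (b) (pos l) lb => [] [].
suff : 0 <= sgn b * phi x x.
  move: h; case: (b); rewrite ?mul1r ?mulN1r ?oppr_gt0 ?oppr_ge0 => h h';
  by have := lt_le_trans h h'; rewrite ltxx.
rewrite {1}/x (ph_suml P) mulr_sumr big_seq; apply: sumr_ge0 => a aQ.
rewrite (phZl P) (ph_sumr P) (bigD1_seq a) ?filter_uniq //= big1_seq => [|a' /andP[aa' a'Q]].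
  rewrite addr0 (phZr P); set q := phi _ _.
  have -> : sgn b * ((c a)^* * (c a * q)) = `|c a| ^+ 2 * (sgn b * q).
    by rewrite normCK; ring.
  by rewrite mulr_ge0 ?exprn_ge0 //; exact: split_vec_dual dv (Qh _ aQ).
rewrite (phZr P) (split_vec_ortho dv (Qh _ aQ) (Qh _ a'Q)) ?mulr0 //.
by rewrite eq_sym.
Qed.

(** The inequalities for the two signs have the same sum [size S] on both sides. *)
Lemma plus_index_count : count (plus_index w eps) S = count pos S.
Proof.
have tot (p : pred nat) : (count p S + count (fun k => p k == false) S = size S)%N.
  rewrite -(count_predC p); congr (_ + _)%N; apply: eq_count => k /=.
  by case: (p k).
have h1 := plus_index_count_le true; have h2 := plus_index_count_le false.
have e1 (p : pred nat) : count (fun k => p k == true) S = count p S.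
  by apply: eq_count => k; case: (p k).
rewrite !e1 in h1; have := tot (plus_index w eps); have := tot pos; lia.
Qed.

End Signature.

(** * Changing the pairing and the signs of an orthonormal basis *)

Definition om_shape rho z u := forall k l,
  om (u k) (u l) = if l == rho k then z k else 0.

Lemma orthonormal_cofin u : h_orthonormal u -> finite_set [set l | u l != E l] ->
  cofin_basis E u.
Proof.
move=> ou; apply: (cofin_basis_indep bE) => n c hn x0 k.
have [kn|/hn//] := ltnP k n.
have : h (u k) (\sum_(k < n) c k *: u k) = 0 by rewrite x0 (ph0r hP).
rewrite (ph_sumr hP) (bigD1 (Ordinal kn)) //= big1 => [|l lk].
  by rewrite addr0 (phZr hP) ou eqxx mulr1.
by rewrite (phZr hP) ou ifN ?mulr0.
Qed.

Lemma sgn_sq (b : bool) : sgn b * sgn b = 1.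
Proof. by case: b; rewrite ?mulrNN mulr1. Qed.

Lemma sgn_conj (b : bool) : (sgn b)^* = sgn b.
Proof. exact: conj_sq1 (sgn_sq b). Qed.

Lemma imaginary_sq : 'i * 'i = -1 :> C.
Proof. by rewrite -expr2 sqrCi. Qed.

(** The operator [(1 - i)/2 + (1 + i)/2 kappa] is a unitary and symmetric square root
    of the permutation [kappa]. It turns a basis whose [om]-partners are given by [rho]
    into one whose partners are given by [kappa \o rho]. *)
Lemma mix_permutation kappa rho w eps u : involutive kappa -> involutive rho ->
  (forall k, kappa (rho k) = rho (kappa k)) -> (forall k, kappa (w k) = w (kappa k)) ->
  finite_set [set k | kappa k != k] -> cofin_basis E u -> h_orthonormal u ->
  conjugate_by w eps u -> (forall k, pair_coef w eps (kappa k) = pair_coef w eps k) ->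
  om_shape rho (fun=> 1) u ->
  exists v, [/\ cofin_basis E v, h_orthonormal v, conjugate_by w eps v &
    om_shape (kappa \o rho) (fun=> 1) v].
Proof.
move=> kK rK kr kw fk eu ou cu fK su.
have c2 : (2%:R : C) != 0 by rewrite pnatr_eq0.
pose a : C := (1 - 'i) / 2%:R; pose b : C := (1 + 'i) / 2%:R.
have ab1 : a + b = 1 by rewrite /a /b; field.
have aabb : a * a + b * b = 0.
  have -> : a * a + b * b = (1 + 'i * 'i) / 2%:R by rewrite /a /b; field.
  by rewrite imaginary_sq subrr mul0r.
have ab2 : a * b + b * a = 1.
  have -> : a * b + b * a = (1 - 'i * 'i) / 2%:R by rewrite /a /b; field.
  by rewrite imaginary_sq opprK divff.
have ca : a^* = b.
  by rewrite /a /b rmorphM fmorphV rmorphB rmorph1 rmorph_nat /= conjCi opprK.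
have cb : b^* = a by rewrite -ca conjCK.
pose v k := a *: u k + b *: u (kappa k).
have ov : h_orthonormal v.
  move=> k l; rewrite /v (phDl hP) !(phDr hP) !(phZl hP) !(phZr hP) !ou ca cb.
  rewrite (inj_eq (inv_inj kK)) (can2_eq kK kK).
  have [->|lk] := eqVneq l k.
    have [_|_] := eqVneq k (kappa k); last first.
      by rewrite !mulr0 addr0 add0r !mulr1 addrC.
    transitivity ((a * b + b * a) + (a * a + b * b)); first by ring.
    by rewrite ab2 aabb addr0.
  have [_|_] := eqVneq l (kappa k); last by rewrite !mulr0 !addr0.
  by rewrite !mulr0 !mulr1 addr0 add0r addrC.
have fv : finite_set [set l | v l != E l].
  apply: finite_change eu.2 fk _ => k uk /= /negP/negPn/eqP kk.
  by rewrite /v kk -scalerDl ab1 scale1r.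
exists v; split=> //; first exact: orthonormal_cofin.
  move=> k; rewrite /v deltaD !deltaZ !cu fK kw scalerDr !scalerA.
  by rewrite ![_ * pair_coef _ _ _]mulrC.
move=> k l; rewrite /v (omDl oH) !(omDr oH) !(omZl oH) !(omZr oH) !su /=.
rewrite -!kr (inj_eq (inv_inj kK)) (can2_eq kK kK).
have [->|lk] := eqVneq l (rho k).
  have [_|_] := eqVneq (rho k) (kappa (rho k)).
    transitivity ((a * b + b * a) + (a * a + b * b)); first by ring.
    by rewrite ab2 aabb addr0.
  by rewrite !mulr0 addr0 add0r !mulr1.
have [_|_] := eqVneq l (kappa (rho k)); last by rewrite !mulr0 !addr0.
by rewrite !mulr0 !mulr1 addr0 add0r.
Qed.

(** For [w k <> k], the eigenvectors [u_k] and [u_(w k)] of [delta] have opposite eigenvalues;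
    rotating them by 45 degrees in their plane gives two vectors that [delta] exchanges. The
    hypotheses on [rho], [s] and [z] make the cross terms of [om] cancel. *)
Lemma rotate_pairs rho w eps s z u : involutive rho -> (forall k, rho (w k) = w (rho k)) ->
  signed_invol w eps -> finite_set [set k | w k != k] ->
  cofin_basis E u -> h_orthonormal u -> om_shape rho z u ->
  (forall k, delta (u k) = sgn (s k) *: u k) ->
  (forall k, w k = k -> pair_coef w eps k = sgn (s k)) ->
  (forall k, w k != k -> s (w k) = ~~ s k) ->
  (forall k, sgn (s (rho k)) = eta * sgn (s k)) ->
  (forall k, w k != k -> z (w k) = eta * z k) ->
  exists v, [/\ cofin_basis E v, h_orthonormal v, conjugate_by w eps v &
    om_shape rho (fun k => if w k == k then z k else eta * z k) v].
Proof.
move=> rK rw sw fw eu ou su du sfix swk srho zw; have [wK _] := sw.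
have s20 : sqrtC (2%:R : C) != 0 by rewrite sqrtC_eq0 pnatr_eq0.
pose r : C := (sqrtC 2%:R)^-1.
have rr : r * r = 2%:R^-1 by rewrite /r -invfM -expr2 sqrtCK.
have cr : r^* = r.
  by apply/CrealP; apply: ger0_real; rewrite invr_ge0 sqrtC_ge0 ler0n.
have c2 : (2%:R : C) != 0 by rewrite pnatr_eq0.
pose a k : C := if w k == k then 1 else r * sgn (s k).
pose b k : C := if w k == k then 0 else r * 1.
pose v k := a k *: u k + b k *: u (w k).
have ca k : (a k)^* = a k by rewrite /a; case: ifP; rewrite ?rmorph1 // rmorphM /= cr sgn_conj.
have cb k : (b k)^* = b k by rewrite /b; case: ifP; rewrite ?rmorph0 // rmorphM /= cr rmorph1.
have wkE k : (w (w k) == w k) = (w k == k) by rewrite wK eq_sym.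
have sN k : w k != k -> sgn (s (w k)) = - sgn (s k).
  by move=> /swk ->; case: (s k); rewrite ?opprK.
have rfix k : (w (rho k) == rho k) = (w k == k) by rewrite -rw (inj_eq (inv_inj rK)).
have ov : h_orthonormal v.
  move=> k l; rewrite /v (phDl hP) !(phDr hP) !(phZl hP) !(phZr hP) !ou ca cb.
  rewrite (inj_eq (inv_inj wK)) (can2_eq wK wK).
  have [->|lk] := eqVneq l k.
    rewrite /a /b (eq_sym k (w k)); case: eqP => _.
      by ring.
    transitivity ((r * r) * (sgn (s k) * sgn (s k) + 1)); first by ring.
    by rewrite rr sgn_sq; field.
  have [lw|_] := eqVneq l (w k); last by rewrite !mulr0 !addr0.
  have wk : w k != k by rewrite -lw.
  rewrite /a /b lw wkE (negbTE wk) sN //; ring.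
have fv : finite_set [set l | v l != E l].
  apply: finite_change eu.2 fw _ => k uk /= /negP/negPn/eqP kk.
  by rewrite /v /a /b kk eqxx scale1r scale0r addr0.
exists v; split=> //; first exact: orthonormal_cofin.
  move=> k; rewrite /v deltaD !deltaZ !du /a /b wkE !wK.
  have [wk|wk] := eqVneq (w k) k.
    by rewrite !scale0r !addr0 !scale1r sfix // wk.
  rewrite /pair_coef (negbTE wk) scale1r !scalerA sN // addrC mulr1; congr (_ *: _ + _ *: _).
  by rewrite -mulrA sgn_sq mulr1.
move=> k l; rewrite /v (omDl oH) !(omDr oH) !(omZl oH) !(omZr oH) !su.
rewrite rw (inj_eq (inv_inj wK)) (can2_eq wK wK).
have [->|lk] := eqVneq l (rho k).
  rewrite /a /b rfix; have [wk|wk] := eqVneq (w k) k.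
    by ring.
  have -> : (rho k == w (rho k)) = false by rewrite eq_sym rfix (negbTE wk).
  rewrite !mulr0 !addr0 add0r zw // srho !mulrA.
  transitivity ((r * r) * ((sgn (s k) * sgn (s k)) * eta * z k + eta * z k)); first by ring.
  by rewrite rr sgn_sq; field.
have [lw|_] := eqVneq l (w (rho k)); last by rewrite !mulr0 !addr0.
have wk : w k != k.
  by apply: contra lk => /eqP wk; rewrite lw -rw wk.
have wrk : w (rho k) != rho k by rewrite rfix.
rewrite !mulr0 addr0 add0r /a /b (negbTE wk) lw wkE rfix (negbTE wk) zw // sN // srho.
transitivity ((r * r) * sgn (s k) * z k * (1 - eta * eta)); first by ring.
by rewrite (g_eta G) subrr mulr0.
Qed.

(** The permutation [b] brings the eigenvalues to the right places; then the values of [om]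
    are corrected by square roots, of modulus 1 because these values are signs. *)
Lemma arrange_signs rho s s' z z' u (S : seq nat) : involutive rho ->
  cofin_basis E u -> h_orthonormal u -> om_shape rho z u ->
  (forall k, delta (u k) = sgn (s k) *: u k) ->
  (forall k, z k * z k = 1) -> (forall k, z' k * z' k = 1) ->
  (forall k, z' (rho k) = e * z' k) -> (forall k, k \notin S -> z' k = z k) ->
  (exists b : nat -> nat, [/\ injective b, forall k, b (rho k) = rho (b k),
    forall k, k \notin S -> b k = k & forall k, s (b k) = s' k]) ->
  exists v, [/\ cofin_basis E v, h_orthonormal v, om_shape rho z' v &
    forall k, delta (v k) = sgn (s' k) *: v k].
Proof.
move=> rK eu ou su du zz zz' zr' zS [b [bi br bS bs]].
have zr k : z (rho k) = e * z k.
  have h1 := su k (rho k); have h2 := su (rho k) k; rewrite rK eqxx in h2.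
  by rewrite eqxx in h1; rewrite -h1 -h2; apply: (omC oH).
have z0 k : z k != 0 := neq0_sq1 (zz k).
have z0' k : z' k != 0 := neq0_sq1 (zz' k).
pose q k := z' k / z (b k).
have qr k : q (rho k) = q k.
  by rewrite /q br zr zr'; field; rewrite z0 (eps_neq0 oH).
have qq k : q k * q k = 1.
  transitivity ((z' k * z' k) / (z (b k) * z (b k))); first by rewrite /q; field.
  by rewrite zz zz' divr1.
pose c k := sqrtC (q k).
have cc k : c k * c (rho k) = q k by rewrite /c qr -expr2 sqrtCK.
have cn k : (c k)^* * c k = 1.
  have : `|c k| ^+ 2 = 1.
    rewrite -normrX /c sqrtCK; apply/eqP; rewrite -sqrp_eq1 ?normr_ge0 //.
    by rewrite -normrX expr2 qq normr1.
  by rewrite normCKC.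
pose v k := c k *: u (b k).
have ov : h_orthonormal v.
  move=> k l; rewrite /v (phZl hP) (phZr hP) ou (inj_eq bi).
  by case: eqP => [->|_]; rewrite ?mulr0 // mulr1 cn.
have fv : finite_set [set l | v l != E l].
  apply: finite_change eu.2 (finite_seq S) _ => k uk /negP kS.
  by rewrite /v /c /q bS // zS // divff // sqrtC1 scale1r.
exists v; split=> //; first exact: orthonormal_cofin.
  move=> k l; rewrite /v (omZl oH) (omZr oH) su -br (inj_eq bi).
  case: eqP => [->|_]; last by rewrite !mulr0.
  by rewrite mulrA cc /q mulfVK.
by move=> k; rewrite /v deltaZ du bs !scalerA mulrC.
Qed.

(** * Existence of a conjugate and dual basis *)

Lemma sgn_inj (b b' : bool) : sgn b = sgn b' -> b = b'.
Proof. by case: b; case: b' => // /eqP; rewrite ?m1_eq1F // eq_sym m1_eq1F. Qed.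

Lemma sgnN (b : bool) : sgn (~~ b) = - sgn b.
Proof. by case: b; rewrite ?opprK. Qed.

Section Frame.
Variables (rho w : nat -> nat) (eps : nat -> int) (S : seq nat).
Hypotheses (rK : involutive rho) (rw : forall k, rho (w k) = w (rho k)).
Hypotheses (sw : signed_invol w eps) (uS : uniq S).
Hypotheses (wS : {in S, forall k, w k \in S}) (rS : {in S, forall k, rho k \in S}).
Hypothesis offS : forall k, k \notin S -> w k = k /\ pair_coef w eps k = sg k.
Hypothesis cntS : count (plus_index w eps) S = count pos S.
Hypothesis posr : forall k, sg (rho k) = eta * sg k.
Hypothesis fixr : forall k, w k = k -> pair_coef w eps (rho k) = eta * pair_coef w eps k.
Hypothesis norho : eta = 1 -> forall k, w k != k -> w k != rho k.
Hypothesis hfix : eta = 1 -> {in S &, forall k l, (rho k == k) = (rho l == l)}.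

(** On the points moved by [w], the target signs must be reversed by [w] and multiplied by
    [eta] by [rho], so this is the involution that preserves them. *)
Definition mirror k := if eta == 1 then rho k else rho (w k).
(** The eigenvalues of [delta] that a basis must have before [rotate_pairs]. *)
Definition target k := if w k == k then eps k == 1 else sign_choice w mirror k.

Let wK := sw.1.

Lemma mirrorK : involutive mirror.
Proof. by move=> k; rewrite /mirror; case: (eta == 1); rewrite ?[rho (w k)]rw ?wK rK. Qed.

Lemma w_mirror k : w (mirror k) = mirror (w k).
Proof. by rewrite /mirror; case: (eta == 1); rewrite -rw. Qed.

Lemma rho_neq k : eta = -1 -> rho k != k.
Proof.
move=> em; apply/eqP => rk; have := posr k; rewrite rk em mulN1r.
by rewrite /sg; case: (pos k) => /eqP; rewrite ?opprK ?m1_eq1F // eq_sym m1_eq1F.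
Qed.

Lemma w_mirror_neq k : w k != k -> w k != mirror k.
Proof.
move=> wk; rewrite /mirror; have [e1|/eqP e1] := eqVneq eta 1; first exact: norho.
have em : eta = -1 by case: (sq1P (g_eta G)).
by rewrite eq_sym rho_neq.
Qed.

Lemma target_w k : w k != k -> target (w k) = ~~ target k.
Proof.
move=> wk; rewrite /target wK (eq_sym k) (negbTE wk).
by rewrite sign_choice_neg ?w_mirror_neq //; [exact: mirrorK|exact: w_mirror].
Qed.

Lemma target_fix k : w k = k -> pair_coef w eps k = sgn (target k).
Proof. by move=> wk; rewrite /pair_coef /target wk eqxx; case: (sw.2 _ wk) => ->. Qed.

Lemma target_rho k : sgn (target (rho k)) = eta * sgn (target k).
Proof.
have wr : (w (rho k) == rho k) = (w k == k) by rewrite -rw (inj_eq (inv_inj rK)).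
have [wk|wk] := eqVneq (w k) k.
  by rewrite -!target_fix ?fixr //; apply/eqP; rewrite wr wk.
have [e1|e1] := eqVneq eta 1.
  rewrite e1 mul1r /target wr (negbTE wk).
  have -> : rho k = mirror k by rewrite /mirror e1 eqxx.
  by rewrite sign_choice_pres //; [exact: mirrorK|exact: w_mirror].
have em : eta = -1 by case: (sq1P (g_eta G)) => // e1'; rewrite e1' eqxx in e1.
rewrite em mulN1r -sgnN -target_w // /target wr (negbTE wk) wK (eq_sym k) (negbTE wk).
have -> : rho k = mirror (w k) by rewrite /mirror (negbTE e1) wK.
by rewrite sign_choice_pres //; [exact: mirrorK|exact: w_mirror].
Qed.

Lemma target_off k : k \notin S -> pos k = target k.
Proof.
move=> kS; have [wk fk] := offS kS; apply: sgn_inj.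
by rewrite -target_fix // fk.
Qed.

Lemma target_count : count pos S = count target S.
Proof.
rewrite -cntS.
rewrite (@count_add _ (plus_index w eps) (fun k => (w k == k) && (eps k == 1))
  (fun k => (w k != k) && (k < w k)%N)) => [|k _]; last first.
  by rewrite /plus_index; case: (eqVneq (w k) k) => //= _; rewrite addn0.
rewrite (@count_add _ target (fun k => (w k == k) && (eps k == 1))
  (fun k => (w k != k) && sign_choice w mirror k)) => [|k _]; last first.
  by rewrite /target; case: (eqVneq (w k) k) => //= _; rewrite addn0.
congr (_ + _)%N.
have h1 := @half_moved w (fun k => k < w k)%N S wK uS wS.
have h2 := @half_moved w (sign_choice w mirror) S wK uS wS.
apply/eqP; rewrite -(@eqn_pmul2l 2) //; apply/eqP.
rewrite h1 ?h2 // => k wk.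
- by rewrite sign_choice_neg ?w_mirror_neq //; [exact: mirrorK|exact: w_mirror].
- by rewrite wK; case: ltngtP wk.
Qed.

(** For [eta = 1] this is [relabel]. For [eta = -1], both signs are reversed by [rho], and it
    is enough to exchange [k] and [rho k] where they disagree. *)
Lemma target_relabel : exists b : nat -> nat, [/\ injective b,
  forall k, b (rho k) = rho (b k), forall k, k \notin S -> b k = k &
  forall k, pos (b k) = target k].
Proof.
have [e1|e1] := eqVneq eta 1.
  apply: relabel => //; last exact: target_count; last exact: target_off.
  - by move=> k; apply: sgn_inj; have := posr k; rewrite e1 mul1r.
  - by move=> k; apply: sgn_inj; rewrite target_rho e1 mul1r.
  - exact: hfix.
have em : eta = -1 by case: (sq1P (g_eta G)) => // e1'; rewrite e1' eqxx in e1.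
have pr k : pos (rho k) = ~~ pos k.
  by apply: sgn_inj; rewrite sgnN; have := posr k; rewrite em mulN1r.
have tr k : target (rho k) = ~~ target k.
  by apply: sgn_inj; rewrite sgnN target_rho em mulN1r.
pose b k := if pos k == target k then k else rho k.
have br k : b (rho k) = rho (b k).
  by rewrite /b pr tr; case: (pos k); case: (target k).
have bK : involutive b.
  by move=> k; rewrite {2}/b; case: ifP => hk; rewrite /b ?pr ?tr ?hk //;
    move: hk; case: (pos k); case: (target k) => //=; rewrite rK.
exists b; split=> // [|k kS|k]; first exact: inv_inj.
- by rewrite /b target_off // eqxx.
- by rewrite /b; case: ifP => [/eqP//|]; rewrite pr; case: (pos k); case: (target k).
Qed.

Lemma frame_to_basis u z z' : cofin_basis E u -> h_orthonormal u -> om_shape rho z u ->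
  (forall k, delta (u k) = sgn (pos k) *: u k) ->
  (forall k, z k * z k = 1) -> (forall k, z' k * z' k = 1) ->
  (forall k, z' (rho k) = e * z' k) -> (forall k, k \notin S -> z' k = z k) ->
  (forall k, w k != k -> z' (w k) = eta * z' k) ->
  exists v, [/\ cofin_basis E v, h_orthonormal v, conjugate_by w eps v &
    om_shape rho (fun k => if w k == k then z' k else eta * z' k) v].
Proof.
move=> eu ou su du zz zz' zr zS zw.
have [u' [eu' ou' su' du']] := arrange_signs rK eu ou su du zz zz' zr zS target_relabel.
apply: (rotate_pairs rK rw sw _ eu' ou' su' du') => //.
- apply: (@sub_finite_set _ _ [set` S]); last exact: finite_seq.
  by move=> k /=; apply: contra_neqT => /offS[].
- exact: target_fix.
- exact: target_w.
- exact: target_rho.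
Qed.

End Frame.

Lemma orthonormal_dual w eps v : signed_invol w eps -> h_orthonormal v ->
  conjugate_by w eps v -> dual_by w eps v.
Proof.
move=> sw ov cv k l; rewrite phi_hprod cv (phZl hP) ov (pair_coef_conj _ sw).
by case: eqP; rewrite ?mulr1 ?mulr0.
Qed.

(** If [e = eta = 1], then [w k = iota k] may occur, and [iota] may have fixed points besides
    its 2-cycles, so that a permutation commuting with [iota] need not realize the target
    signs. In that case the pairing of [E] is first changed into the identity inside the
    window by [mix_permutation], and the same operation restores it at the end. In the other
    cases the pairing remains [iota] throughout. *)
Theorem both_exists w eps (S : seq nat) :
  (e = 1 -> forall k, om (E k) (E (iota k)) = 1) ->
  signed_invol w eps -> (forall k, iota (w k) = w (iota k)) ->
  (forall k, w k = k -> pair_coef w eps (iota k) = eta * pair_coef w eps k) ->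
  (eta * e = -1 -> forall k, w k <> iota k) ->
  uniq S -> {in S, forall k, w k \in S} -> iclosed iota S ->
  (forall k, k \notin S -> w k = k /\ pair_coef w eps k = sg k) ->
  count (plus_index w eps) S = count pos S ->
  exists v, [/\ cofin_basis E v, starred_by om iota v,
    conjugate_by w eps v & dual_by w eps v].
Proof.
move=> z1 sw comm fixi noi uS wS iS offS cntS; have [wK _] := sw.
have eE : cofin_basis E E.
  by split=> //; rewrite (_ : [set l | _] = set0) // -subset0 => l /=; rewrite eqxx.
have oE : h_orthonormal E by exact: hprod_diag.
have zE : om_shape iota (fun k => om (E k) (E (iota k))) E by exact: (om_EE H).
have dE k : delta (E k) = sgn (pos k) *: E k by exact: g_deltaE G k.
have em1 (a : C) : a * a = 1 -> a <> 1 -> a = -1 by move=> /sq1P[].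
have [/andP[/eqP e1 /eqP h1]|nBD] := boolP ((e == 1) && (eta == 1)).
  (* [iota] inside the window only, so that almost all vectors remain those of [E] *)
  pose kappa k := if k \in S then iota k else k.
  have iSE k : (iota k \in S) = (k \in S) by exact (iota_in H k iS).
  have wSE k : (w k \in S) = (k \in S).
    by apply/idP/idP => [/wS|/wS//]; rewrite wK.
  have kK : involutive kappa.
    by move=> k; rewrite /kappa; case kS: (k \in S); rewrite ?iSE kS ?iK.
  have ki k : kappa (iota k) = iota (kappa k) by rewrite /kappa iSE; case: ifP.
  have kw k : kappa (w k) = w (kappa k) by rewrite /kappa wSE; case: ifP.
  have fk : finite_set [set k | kappa k != k].
    apply: (@sub_finite_set _ _ [set` S]); last exact: finite_seq.
    by move=> k /=; rewrite /kappa; case: ifP; rewrite ?eqxx.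
  pose eps0 k : int := if pos k then 1 else -1.
  have f0 k : pair_coef id eps0 k = sgn (pos k) by rewrite /pair_coef /eps0 eqxx; case: (pos k).
  have posi k : pos (iota k) = pos k.
    by apply: sgn_inj; have := g_sgi G k; rewrite h1 mul1r.
  have cE : conjugate_by id eps0 E by move=> k; rewrite dE f0.
  have fE k : pair_coef id eps0 (kappa k) = pair_coef id eps0 k.
    by rewrite !f0 /kappa; case: (k \in S); rewrite ?posi.
  have sE : om_shape iota (fun=> 1) E by move=> k l; rewrite zE z1.
  have [u [eu ou cu su]] 
    := mix_permutation (w := id) kK iK ki (fun=> erefl) fk eE oE cE fE sE.
  have fK k : pair_coef w eps (kappa k) = pair_coef w eps k.
    rewrite /kappa; case: ifP => // _; rewrite /pair_coef -comm (inj_eq (inv_inj iK)).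
    case: eqP => // wk; have := fixi _ wk.
    by rewrite /pair_coef -comm (inj_eq (inv_inj iK)) wk eqxx h1 mul1r.
  have rK : involutive (kappa \o iota) by move=> k /=; rewrite -ki iK kK.
  have rw k : (kappa \o iota) (w k) = w ((kappa \o iota) k) by rewrite /= comm kw.
  have rSE k : k \in S -> (kappa \o iota) k = k by move=> kS; rewrite /= /kappa iSE kS iK.
  have [v [ev ov cv sv]] : exists v, [/\ cofin_basis E v, h_orthonormal v,
      conjugate_by w eps v &
      om_shape (kappa \o iota) (fun k => if w k == k then 1 else eta * 1) v].
    have rS : {in S, forall k, (kappa \o iota) k \in S} by move=> k kS; rewrite rSE.
    have posr k : sg ((kappa \o iota) k) = eta * sg k.
      by rewrite /sg h1 mul1r /= /kappa; case: (_ \in S); rewrite ?posi.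
    have fixr k : w k = k -> pair_coef w eps ((kappa \o iota) k) = eta * pair_coef w eps k.
      by move=> wk; rewrite /= fK fixi.
    have norho : eta = 1 -> forall k, w k != k -> w k != (kappa \o iota) k.
      move=> _ k wk; rewrite rSE //; apply: contra_neqT wk => kS.
      by case: (offS k kS).
    have hfix : eta = 1 -> {in S &, forall k l,
        ((kappa \o iota) k == k) = ((kappa \o iota) l == l)}.
      by move=> _ k l kS lS; rewrite !rSE ?eqxx.
    apply: (frame_to_basis rK rw sw uS wS rS offS cntS posr fixr norho hfix eu ou su) => //.
    - by move=> k; rewrite cu f0.
    - by move=> k; rewrite mulr1.
    - by move=> k; rewrite mulr1.
    - by move=> _; rewrite e1 mulr1.
    - by move=> _ _; rewrite h1 mulr1.
  have sv1 : om_shape (kappa \o iota) (fun=> 1) v.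
    by move=> k l; rewrite sv h1 mulr1 if_same.
  have kr k : kappa ((kappa \o iota) k) = (kappa \o iota) (kappa k).
    by rewrite /= -ki.
  have [v' [ev' ov' cv' sv']] := mix_permutation kK rK kr kw fk ev ov cv fK sv1.
  exists v'; split=> //; last exact: orthonormal_dual.
  by move=> k l; rewrite sv' /= kK; case: (eqVneq l (iota k)) => _; rewrite ?eqxx ?oner_eq0.
have zz k : om (E k) (E (iota k)) * om (E k) (E (iota k)) = 1 := g_sq G k.
have zr k : om (E (iota k)) (E (iota (iota k))) = e * om (E k) (E (iota k)).
  by rewrite iK; apply: (omC oH).
have nofix : e = -1 -> forall k, iota k != k.
  move=> em k; apply/eqP => ik; have := zr k; rewrite ik em mulN1r => h0.
  have /eqP := neq0_sq1 (zz k); rewrite ik; apply.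
  apply/eqP; move/eqP: h0; rewrite ik -subr_eq0 opprK -mulr2n -mulr_natl mulf_eq0.
  by rewrite pnatr_eq0.
have wi k : (w (iota k) == iota k) = (w k == k) by rewrite -comm (inj_eq (inv_inj iK)).
(* values of [om] to be prescribed on the moved points: compatibility with the symmetry of
   [om] gives the factor [e], and [rotate_pairs] requires the factor [eta] *)
have [zeta [zeta2 zetai zetaw]] : exists zeta : nat -> C, [/\
    forall k, zeta k * zeta k = 1,
    forall k, w k != k -> zeta (iota k) = e * zeta k &
    forall k, w k != k -> zeta (w k) = eta * zeta k].
  have wiC k : iota (w k) = w (iota k) := comm k.
  have [h1|/eqP h1] := eqVneq eta 1.
    have em : e = -1 by apply: em1 (om_ee oH) _ => e1; rewrite e1 h1 !eqxx in nBD.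
    exists (fun k => sgn (sign_choice iota w k)); split=> k; first exact: sgn_sq.
      move=> wk; rewrite em mulN1r -sgnN sign_choice_neg ?nofix //.
      by rewrite eq_sym; apply/eqP; apply: noi; rewrite h1 em mul1r.
    by move=> wk; rewrite h1 mul1r sign_choice_pres.
  have em := em1 _ (g_eta G) h1.
  case: (sq1P (om_ee oH)) => e1.
    exists (fun k => sgn (sign_choice w iota k)); split=> k; first exact: sgn_sq.
      by move=> wk; rewrite e1 mul1r sign_choice_pres.
    move=> wk; rewrite em mulN1r -sgnN sign_choice_neg //.
    by apply/eqP; apply: noi; rewrite em e1 mulr1.
  have iwK : involutive (iota \o w) by move=> k /=; rewrite comm iK wK.
  have wiw k : w ((iota \o w) k) = (iota \o w) (w k) := esym (comm (w k)).
  have sw' k : w k != k -> sign_choice w (iota \o w) (w k) = ~~ sign_choice w (iota \o w) k.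
    by move=> wk; rewrite sign_choice_neg //= eq_sym nofix.
  exists (fun k => sgn (sign_choice w (iota \o w) k)); split=> k; first exact: sgn_sq.
    move=> wk; rewrite e1 mulN1r -sgnN -sw' //.
    have {1}-> : iota k = (iota \o w) (w k) by rewrite /= wK.
    by rewrite sign_choice_pres.
  by move=> wk; rewrite em mulN1r -sgnN sw'.
pose z' k := if w k == k then om (E k) (E (iota k)) else zeta k.
have [v [ev ov cv sv]] : exists v, [/\ cofin_basis E v, h_orthonormal v,
    conjugate_by w eps v &
    om_shape iota (fun k => if w k == k then z' k else eta * z' k) v].
  have norho : eta = 1 -> forall k, w k != k -> w k != iota k.
    move=> h1 k wk; apply/eqP; apply: noi; rewrite h1 mul1r.
    by apply: em1 (om_ee oH) _ => e1; rewrite e1 h1 !eqxx in nBD.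
  have hfix : eta = 1 -> {in S &, forall k l, (iota k == k) = (iota l == l)}.
    move=> h1 k l _ _; have em : e = -1.
      by apply: em1 (om_ee oH) _ => e1; rewrite e1 h1 !eqxx in nBD.
    by rewrite !(negbTE (nofix em _)).
  apply: (frame_to_basis iK comm sw uS wS iS offS cntS (g_sgi G) fixi norho hfix eE oE zE) => //.
  - by move=> k; rewrite /z'; case: ifP.
  - by move=> k; rewrite /z' wi; case: eqVneq => wk; [exact: zr|exact: zetai].
  - by move=> k /offS[wk _]; rewrite /z' wk eqxx.
  - move=> k wk; rewrite /z' wK (eq_sym k) (negbTE wk); exact: zetaw.
exists v; split=> //; last exact: orthonormal_dual.
move=> k l; rewrite sv; case: (eqVneq l (iota k)) => _; rewrite ?eqxx //.
have z0 : z' k != 0 by apply: neq0_sq1; rewrite /z'; case: ifP.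
by case: ifP => _ //; rewrite mulf_neq0 // (neq0_sq1 (g_eta G)).
Qed.

End Geometry.

(** * Forms given by matrices *)

Section Omega.
Variables (K : fieldType) (eps : int) (Omega : nat -> nat -> K).
Hypothesis eps_sq : eps * eps = 1.
Hypothesis hOmega : is_Omega eps Omega.

Lemma block_position (sz : nat -> nat) : (forall j, 0 < sz j)%N ->
  forall n, exists i p, (p < sz i)%N /\ (n = \sum_(a < i) sz a + p)%N.
Proof.
move=> sz0; elim=> [|n [i [p [pi ->]]]].
  by exists 0%N, 0%N; rewrite big_ord0.
have [lt|ge] := ltnP p.+1 (sz i); first by exists i, p.+1; rewrite addnS.
exists i.+1, 0%N; split; first exact: sz0.
rewrite big_ord_recr /= addn0 -addnS; congr (_ + _)%N.
by apply/eqP; rewrite eqn_leq pi ge.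
Qed.

Lemma Omega_cases k l :
  [/\ Omega l k = eps%:~R * Omega k l,
      Omega k l = 0 \/ Omega k l * Omega k l = 1 &
      eps = 1 -> Omega k l = 0 \/ Omega k l = 1].
Proof.
have eK : eps%:~R * eps%:~R = 1 :> K by rewrite -intrM eps_sq.
have [sz [hsz hO]] := hOmega.
have sz0 j : (0 < sz j)%N by case: (hsz j) => [->|[_ ->]].
have [i [p [pi ->]]] := block_position sz0 k.
have [j [q [qj ->]]] := block_position sz0 l.
rewrite (hO i j) // (hO j i) // eq_sym.
case: eqP => [ij|_]; last by rewrite mulr0; split=> //; left.
subst j; move: pi qj; case: (hsz i) => [->|[e1 ->]].
  move: p q => [|[|p]] [|[|q]] //= _ _; rewrite ?mulr0 ?mulr1 ?eK; split=> //;
  by [left|right|move=> _; left|move=> ->; right].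
by move: p q => [|p] [|q] //= _ _; rewrite e1 !mulr1; split=> //; right.
Qed.

End Omega.

Section MatrixForms.
Variables (K : fieldType) (M : nat -> nat -> K).

Lemma mxformE a b n m : (forall k, (n <= k)%N -> a k = 0) ->
  (forall k, (m <= k)%N -> b k = 0) ->
  mxform M a b = \sum_(k < n) \sum_(l < m) a k * M k l * b l.
Proof.
move=> an bm; rewrite /mxform (@fsumTE _ _ n) => [|k /an ak]; last first.
  by apply: fsbig1 => l _; rewrite ak !mul0r.
by apply: eq_bigr => k _; apply: fsumTE => l /bm ->; rewrite mulr0.
Qed.

Lemma mxform_delta k l : mxform M (fun i => (i == k)%:R) (fun j => (j == l)%:R) = M k l.
Proof.
rewrite (@mxformE _ _ k.+1 l.+1); first last.
- by move=> j; case: eqP => // ->; rewrite ltnn.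
- by move=> j; case: eqP => // ->; rewrite ltnn.
rewrite big_ord_recr /= big1 ?add0r => [|i _]; last first.
  by apply: big1 => j _; rewrite (ltn_eqF (ltn_ord i)) !mul0r.
rewrite big_ord_recr /= big1 ?add0r => [|j _]; last first.
  by rewrite (ltn_eqF (ltn_ord j)) mulr0.
by rewrite !eqxx mul1r mulr1.
Qed.

Lemma mxform_ZDl c a a' b n m : (forall k, (n <= k)%N -> a k = 0) ->
  (forall k, (n <= k)%N -> a' k = 0) -> (forall k, (m <= k)%N -> b k = 0) ->
  mxform M (fun k => c * a k + a' k) b = c * mxform M a b + mxform M a' b.
Proof.
move=> ha ha' hb; rewrite !(@mxformE _ _ n m) //; last first.
  by move=> k hk; rewrite ha // ha' // mulr0 addr0.
rewrite mulr_sumr -big_split; apply: eq_bigr => k _ /=.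
by rewrite mulr_sumr -big_split; apply: eq_bigr => l _ /=; ring.
Qed.

Lemma mxform_ZDr c a b b' n m : (forall k, (n <= k)%N -> a k = 0) ->
  (forall k, (m <= k)%N -> b k = 0) -> (forall k, (m <= k)%N -> b' k = 0) ->
  mxform M a (fun k => c * b k + b' k) = c * mxform M a b + mxform M a b'.
Proof.
move=> ha hb hb'; rewrite !(@mxformE _ _ n m) //; last first.
  by move=> k hk; rewrite hb // hb' // mulr0 addr0.
rewrite mulr_sumr -big_split; apply: eq_bigr => k _ /=.
by rewrite mulr_sumr -big_split; apply: eq_bigr => l _ /=; ring.
Qed.

Lemma mxform_sym (c : K) a b n m : (forall k, (n <= k)%N -> a k = 0) ->
  (forall k, (m <= k)%N -> b k = 0) -> (forall k l, M l k = c * M k l) ->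
  mxform M b a = c * mxform M a b.
Proof.
move=> ha hb hM; rewrite (mxformE hb ha) (mxformE ha hb) exchange_big mulr_sumr.
apply: eq_bigr => k _; rewrite mulr_sumr; apply: eq_bigr => l _.
by rewrite hM; ring.
Qed.

End MatrixForms.

Section CoordinateForms.
Variables (K : fieldType) (V : lmodType K) (E : nat -> V).
Hypothesis bE : is_basis E.
Implicit Types (x y z : V) (M : nat -> nat -> K).

Lemma coord_bound2 x y : exists n, (forall k, (n <= k)%N -> basis_coord E x k = 0) /\
  (forall k, (n <= k)%N -> basis_coord E y k = 0).
Proof.
have [n [hn _]] := bcoordP bE x; have [m [hm _]] := bcoordP bE y.
by exists (maxn n m); split=> k; rewrite geq_max => /andP[]; [move=> /hn|move=> _ /hm].
Qed.

Lemma coord_eps_form M (e : K) : e * e = 1 -> (forall k l, M l k = e * M k l) ->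
  eps_form e (fun x y => mxform M (basis_coord E x) (basis_coord E y)).
Proof.
move=> ee hM; split=> // [a x y z|x y].
- have [n [hx hy]] := coord_bound2 x y; have [m [hz _]] := coord_bound2 z z.
  rewrite -(mxform_ZDl M a hx hy hz).
  have -> : basis_coord E (a *: x + y) = (fun k => a * basis_coord E x k + basis_coord E y k).
    by apply/funext => k; exact: (bcoordZD bE).
  by [].
- have [n [hx hy]] := coord_bound2 x y.
  exact (mxform_sym hx hy hM).
Qed.

Lemma coord_form_basis M k l : mxform M (basis_coord E (E k)) (basis_coord E (E l)) = M k l.
Proof.
have h j : basis_coord E (E j) = (fun i => (i == j)%:R).
  by apply/funext => i; exact: (bcoord_basis bE).
by rewrite !h mxform_delta.
Qed.

Variables (Np : set nat).
Local Notation sgn k := (if k \in Np then 1 else -1 : K).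

Definition coord_delta x := \sum_(k \in [set: nat])
  (\sum_(l \in [set: nat]) Phi K Np k l * basis_coord E x l) *: E k.

Lemma delta_coordE x k : basis_coord E (coord_delta x) k = sgn k * basis_coord E x k.
Proof.
have [n [hx _]] := coord_bound2 x x.
have inner j : \sum_(l \in [set: nat]) Phi K Np j l * basis_coord E x l =
    sgn j * basis_coord E x j.
  rewrite -(@fsbig_widen _ _ _ _ [set j] setT) //.
    by rewrite fsbig_set1 /Phi eqxx.
  by move=> l /= [_ /eqP jl]; rewrite /Phi eq_sym (negbTE jl) mul0r.
move: k; apply: (@bcoord_uniq _ _ _ bE _ (fun k => sgn k * basis_coord E x k) n).
  by move=> j /hx ->; rewrite mulr0.
rewrite /coord_delta (@fsumTE _ _ n) => [|j /hx xj].
  by apply: eq_bigr => j _; rewrite inner.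
by rewrite inner xj mulr0 scale0r.
Qed.

Lemma coord_deltaZD a x y : coord_delta (a *: x + y) = a *: coord_delta x + coord_delta y.
Proof.
apply: (bcoord_inj bE) => k; rewrite delta_coordE !(bcoordZD bE) !delta_coordE.
by rewrite mulrDr mulrCA.
Qed.

Lemma coord_deltaE k : coord_delta (E k) = sgn k *: E k.
Proof.
apply: (bcoord_inj bE) => l; rewrite delta_coordE (bcoordZ bE) (bcoord_basis bE).
by case: (eqVneq l k) => [->|_]; rewrite ?mulr0.
Qed.

End CoordinateForms.

Section HermitianCoordinates.
Variables (C : numClosedFieldType) (V : lmodType C) (E : nat -> V).
Hypothesis bE : is_basis E.
Variable Np : set nat.

Definition coord_phi (x y : V) : C :=
  mxform (Phi C Np) (fun k => (basis_coord E x k)^*) (basis_coord E y).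

Lemma coord_phi_sesq : sesq_form coord_phi.
Proof.
have conj0 x n : (forall k, (n <= k)%N -> basis_coord E x k = 0) ->
    forall k, (n <= k)%N -> (basis_coord E x k)^* = 0.
  by move=> hx k /hx ->; rewrite rmorph0.
split=> a x y z; rewrite /coord_phi.
  have [n [hx hy]] := coord_bound2 bE x y; have [m [hz _]] := coord_bound2 bE z z.
  rewrite -(mxform_ZDl (Phi C Np) _ (conj0 _ _ hx) (conj0 _ _ hy) hz).
  have -> : (fun k => (basis_coord E (a *: x + y) k)^*) =
      (fun k => a^* * (basis_coord E x k)^* + (basis_coord E y k)^*).
    by apply/funext => k; rewrite (bcoordZD bE) rmorphD rmorphM.
  by [].
have [n [hx hy]] := coord_bound2 bE x y; have [m [hz _]] := coord_bound2 bE z z.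
rewrite -(mxform_ZDr (Phi C Np) _ (conj0 _ _ hz) hx hy).
have -> : basis_coord E (a *: x + y) = (fun k => a * basis_coord E x k + basis_coord E y k).
  by apply/funext => k; exact: (bcoordZD bE).
by [].
Qed.

Lemma coord_phi_diag : diag_form E (sg C (fun k => k \in Np)) coord_phi.
Proof.
move=> k l; transitivity (Phi C Np k l); last first.
  by rewrite /Phi /sg; case: (eqVneq l k).
have h j : basis_coord E (E j) = (fun i => (i == j)%:R).
  by apply/funext => i; exact: (bcoord_basis bE).
have hc j : (fun i => (basis_coord E (E j) i)^*) = (fun i => (i == j)%:R).
  by apply/funext => i; rewrite h rmorph_nat.
by rewrite /coord_phi hc h mxform_delta.
Qed.

End HermitianCoordinates.

(** * Flags and linear automorphisms *)

Section FlagsOverC.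
Variables (R : realType) (V : lmodType R[i]) (E : nat -> V).
Hypothesis bE : is_basis E.
Variables (d : Order.disp_t) (A : orderType d) (sigma : nat -> A).
Hypothesis bsigma : bijective sigma.
Implicit Types (v : nat -> V) (P : set nat).

Lemma FlP v (F : set V) : Fl sigma v F <->
  exists k, F = lspan v (below sigma k) \/ F = lspan v (upto sigma k).
Proof.
have [g sK gK] := bsigma.
split=> [[a h]|[k h]]; first by exists (g a); rewrite /below /upto gK.
by exists (sigma k).
Qed.

Lemma Fl_lower v (F : set V) : Fl sigma v F -> exists2 P, lower sigma P & F = lspan v P.
Proof.
move=> /FlP[k [->|->]]; [exists (below sigma k)|exists (upto sigma k)] => //.
  exact: lower_below.
exact: lower_upto.
Qed.

Lemma same_flag_Fl v v' : same_flag sigma v v' -> Fl sigma v = Fl sigma v'.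
Proof.
move=> h; apply/seteqP; split=> F /FlP[k hF]; apply/FlP; exists k;
  by rewrite -?h -?(same_flag_below k h) // ?h ?(same_flag_below k h).
Qed.

Lemma Fl_same_flag v v' : cofin_basis E v -> cofin_basis E v' ->
  Fl sigma v = Fl sigma v' -> same_flag sigma v v'.
Proof.
move=> ev ev' h k.
have : Fl sigma v (lspan v (upto sigma k)) by apply/FlP; exists k; right.
rewrite h => /Fl_lower[P lP hP]; rewrite {1}hP; congr lspan.
exact (esym (lspan_lower_inj bE ev ev' (@lower_upto _ _ sigma k) lP hP)).
Qed.

Lemma linear_ZD (g : {linear V -> V}) a x y : g (a *: x + y) = a *: g x + g y.
Proof. by rewrite linearD linearZ. Qed.

Lemma lspan_image (g : {linear V -> V}) v P :
  g @` lspan v P = lspan (g \o v) P.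
Proof.
apply/seteqP; split=> [_ [x hx <-]|].
  move: x hx; apply: lspan_ind => [|a x y hx hy|k Pk]; first by rewrite linear0; exact: lspan0.
    by rewrite linear_ZD; apply: lspanZD.
  exact: (lspan_mem (g \o v)).
apply: lspan_ind => [|a _ _ [x hx <-] [y hy <-]|k Pk].
- by exists 0; [exact: lspan0|rewrite linear0].
- by exists (a *: x + y); [exact: lspanZD|rewrite linear_ZD].
- by exists (v k) => //; exact: lspan_mem.
Qed.

Lemma Fl_image (g : {linear V -> V}) v :
  [set g @` S | S in Fl sigma v] = Fl sigma (g \o v).
Proof.
apply/seteqP; split=> [_ [S /FlP[k hS] <-]|F /FlP[k hF]].
  by apply/FlP; exists k; case: hS => ->; rewrite lspan_image; [left|right].
case: hF => ->; rewrite -lspan_image.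
  by exists (lspan v (below sigma k)) => //; apply/FlP; exists k; left.
by exists (lspan v (upto sigma k)) => //; apply/FlP; exists k; right.
Qed.

Lemma flag_orbit_Fl (Hs : set {linear V -> V}) v :
  flag_orbit Hs (Fl sigma v) = [set Fl sigma (g \o v) | g in Hs].
Proof.
by apply/seteqP; split=> F [g Hg <-]; exists g => //; rewrite Fl_image.
Qed.

Lemma change_of_basis v v' : is_basis v -> is_basis v' ->
  exists g : {linear V -> V}, bijective g /\ forall k, g (v k) = v' k.
Proof.
move=> bv bv'.
have lin u u' (bu : is_basis u) : exists g : {linear V -> V}, forall k, g (u k) = u' k.
  have lf : linear (semi_ext idfun u u') by move=> a x y; rewrite semi_ext_ZD.
  pose g : {linear V -> V} := HB.pack (semi_ext idfun u u')
    (GRing.isLinear.Build _ _ _ _ (semi_ext idfun u u') lf).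
  by exists g => k; apply: semi_ext_basis.
have [g hg] := lin v v' bv; have [g' hg'] := lin v' v bv'.
exists g; split=> //; exists g'.
  apply: (basis_ind bv) => [|a x y hx hy|k]; first by rewrite !linear0.
    by rewrite !linear_ZD hx hy.
  by rewrite hg hg'.
apply: (basis_ind bv') => [|a x y hx hy|k]; first by rewrite !linear0.
  by rewrite !linear_ZD hx hy.
by rewrite hg' hg.
Qed.

Lemma indep_image (g : {linear V -> V}) v : injective g -> indep v -> indep (g \o v).
Proof.
move=> gi iv n c hn h; apply: (iv n c hn); apply: gi.
by rewrite linear0 linear_sum -[RHS]h; apply: eq_bigr => k _; rewrite linearZ.
Qed.

Lemma GE_cofin (g : {linear V -> V}) v : GE E g -> cofin_basis E v ->
  cofin_basis E (g \o v).
Proof.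
move=> [bg fg] [bv fv]; apply: (cofin_basis_indep bE).
  by apply: indep_image; [exact: bij_inj|exact: basis_indep].
by apply: finite_change fv fg _ => k /= -> /negP/negPn/eqP.
Qed.

Lemma cofin_E : cofin_basis E E.
Proof.
split=> //; rewrite (_ : [set l | _] = set0) // -subset0 => l /=.
by rewrite eqxx.
Qed.

Lemma XFE : XF E sigma = [set Fl sigma v | v in Ebasis E].
Proof.
rewrite /XF flag_orbit_Fl; apply/seteqP; split=> F.
  by move=> [g Gg <-]; exists (g \o E) => //; exact: GE_cofin Gg cofin_E.
move=> [v [bv fv] <-]; have [g [bg hg]] := change_of_basis bE bv.
exists g; last by congr Fl; apply/funext => k /=; rewrite hg.
split=> //; apply: sub_finite_set fv => k /=; by rewrite hg.
Qed.

End FlagsOverC.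

(** * The counting condition on pairs *)

Section Balanced.
Variables (pos : pred nat) (Np Nm : set nat).
Hypotheses (hNp : forall k, Np k <-> pos k) (hNm : forall k, Nm k <-> ~~ pos k).
Variables (w : nat -> nat) (eps : nat -> int).
Hypotheses (wK : involutive w) (he : forall k, w k = k -> eps k = 1 \/ eps k = -1).

Lemma card_window (U : set nat) (q : pred nat) (S : seq nat) : uniq S ->
  (forall k, U k <-> k \in S /\ q k) ->
  finite_set U /\ #|` fset_set U| = count q S.
Proof.
move=> uS hU; have -> : U = [set` [fset x in [seq k <- S | q k]]%fset].
  apply/seteqP; split=> k /=; rewrite in_fset mem_filter => h.
    by have [-> ->] := (hU k).1 h.
  by apply/hU; case/andP: h.
split; first exact: finite_fset.
by rewrite set_fsetK card_fseq undup_id ?filter_uniq // size_filter.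
Qed.

Section Window.
Variable S : seq nat.
Hypotheses (uS : uniq S) (wS : {in S, forall k, w k \in S}).
Hypothesis offS : forall k, k \notin S -> w k = k /\ eps k = if pos k then 1 else -1.

Lemma plus_moved : (2 * count (fun k => (w k != k) && (k < w k)%N) S =
  count (fun k => w k != k) S)%N.
Proof. by apply: half_moved => // k; rewrite wK; case: ltngtP. Qed.

Lemma unsigned_window (b : bool) (s : int) (N : set nat) :
  (forall k, N k <-> pos k == b) -> s = (if b then 1 else -1) ->
  (forall k, (N `\` signed_fix (w, eps) N s) k <->
    k \in S /\ (pos k == b) && ~~ ((w k == k) && (eps k == s))).
Proof.
move=> hN hs k; split=> [[Nk nk]|[kS /andP[pk nk]]].
  have pk := (hN k).1 Nk; have nk' : ~~ ((w k == k) && (eps k == s)).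
    by apply/negP => /andP[/eqP h1 /eqP h2]; apply: nk.
  rewrite pk nk'; split=> //; apply/negPn/negP => kS.
  have [wk ek] := offS kS; move: nk'; rewrite wk ek hs eqxx /=.
  by rewrite (eqP pk) eqxx.
split; first exact/hN.
by move=> [_ [/= wk ek]]; rewrite wk ek !eqxx in nk.
Qed.

Lemma signed_window (b : bool) (s : int) (N : set nat) :
  (forall k, N k <-> pos k == ~~ b) -> s = (if b then 1 else -1) ->
  (forall k, signed_fix (w, eps) N s k <->
    k \in S /\ [&& pos k == ~~ b, w k == k & eps k == s]).
Proof.
move=> hN hs k; split=> [[Nk [/= wk ek]]|[kS /and3P[pk /eqP wk /eqP ek]]]; last first.
  by split; [exact/hN|].
have pk := (hN k).1 Nk; rewrite pk wk ek !eqxx; split=> //.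
apply/negPn/negP => kS; have [_] := offS kS; rewrite ek hs (eqP pk).
by case: (b).
Qed.

Lemma moved_window k : [set l | w l != l] k <-> k \in S /\ w k != k.
Proof.
split=> [/= wk|[]//]; split=> //; apply/negPn/negP => /offS[h _].
by rewrite h eqxx in wk.
Qed.

Lemma balanced_window (b : bool) (s : int) (N N' : set nat) :
  (forall k, N k <-> pos k == b) -> (forall k, N' k <-> pos k == ~~ b) ->
  s = (if b then 1 else -1) ->
  balanced (w, eps) N N' s <->
  count (fun k => pos k == b) S =
    (count (fun k => (w k == k) && (eps k == s)) S +
     count (fun k => (w k != k) && (k < w k)%N) S)%N.
Proof.
move=> hN hN' hs.
have [fU cU] := card_window uS (unsigned_window hN hs).
have [fT cT] := card_window uS (signed_window hN' hs).
have [fM cM] := card_window uS moved_window.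
have h2 := plus_moved.
have h3 : count (fun k => pos k == b) S =
    (count (fun k => (pos k == b) && ((w k == k) && (eps k == s))) S +
     count (fun k => (pos k == b) && ~~ ((w k == k) && (eps k == s))) S)%N.
  by apply: count_add => k _; case: (pos k == b); case: (w k == k); case: (eps k == s).
have h4 : count (fun k => (w k == k) && (eps k == s)) S =
    (count (fun k => (pos k == b) && ((w k == k) && (eps k == s))) S +
     count (fun k => [&& pos k == ~~ b, w k == k & eps k == s]) S)%N.
  apply: count_add => k _; clear hs.
  by case: (pos k); case: (b); case: (w k == k); case: (eps k == s).
split=> [[_ _ _ /=]|h]; last first.
  by split=> //=; rewrite cU cT cM; move: h h2 h3 h4; lia.
by rewrite cU cT cM; move: h2 h3 h4; lia.
Qed.

(** Adding to both sides of the first condition the positive fixed points of [w] in [N_+] turns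
    it into this equality in the window. Inside the window the two conditions are equivalent,
    because their sides add up to the size of the window. *)
Lemma balanced_count :
  (balanced (w, eps) Np Nm 1 /\ balanced (w, eps) Nm Np (-1)) <->
  count (plus_index w eps) S = count pos S.
Proof.
have pT k : Np k <-> pos k == true by rewrite eqb_id.
have pF k : Nm k <-> pos k == false by rewrite eqbF_neg.
have b1 := @balanced_window true 1 Np Nm pT pF erefl.
have b2 := @balanced_window false (-1) Nm Np pF pT erefl.
have hh : count (plus_index w eps) S = (count (fun k => (w k == k) && (eps k == 1%R)) S +
    count (fun k => (w k != k) && (k < w k)%N) S)%N.
  by apply: count_add => k _; rewrite /plus_index; case: (w k == k) => //=; rewrite addn0.
have hp : count (fun k => pos k == true) S = count pos S.
  by apply: eq_count => k; case: (pos k).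
have hn : (count (fun k => pos k == true) S + count (fun k => pos k == false) S = size S)%N.
  by rewrite -(count_predC (fun k => pos k == true)); congr (_ + _)%N;
    apply: eq_count => k /=; case: (pos k).
have hw : (count (fun k => (w k == k) && (eps k == 1%R)) S +
    count (fun k => (w k == k) && (eps k == (-1)%R)) S +
    count (fun k => w k != k) S = size S)%N.
  rewrite -(count_predC (fun k => w k == k) S); congr (_ + _)%N.
  apply/esym/count_add => k _; case: (eqVneq (w k) k) => //= wk.
  by case: (he wk) => ->.
have h2 := plus_moved.
split=> [[/b1 h _]|h]; first by move: h; rewrite hp hh => ->.
by split; [apply/b1|apply/b2]; move: h hh hp hn hw h2; lia.
Qed.

End Window.

(** The counting conditions leave only finitely many indices that are not fixed by [w] with the
    sign of their part; close this finite set under [w] and under [f]. *)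
Lemma Iinf_window (f : nat -> nat) : involutive f -> (forall k, f (w k) = w (f k)) ->
  balanced (w, eps) Np Nm 1 -> balanced (w, eps) Nm Np (-1) ->
  exists S : seq nat, [/\ uniq S, {in S, forall k, w k \in S}, {in S, forall k, f k \in S} &
    forall k, k \notin S -> w k = k /\ eps k = if pos k then 1 else -1].
Proof.
move=> fK fw [fU _ fM _] [fU' _ _ _].
have /finite_seqP[S0 hS0] : finite_set ((Np `\` signed_fix (w, eps) Np 1) `|`
    (Nm `\` signed_fix (w, eps) Nm (-1))) by rewrite finite_setU.
have [S1 [_ sub1 wS1 _]] := invol_closure S0 wK.
have [S [uS sub fS gS]] := invol_closure S1 fK.
exists S; split=> // [|k kS]; first exact: gS wS1.
have kS1 := contra (sub k) kS.
have kS0 : k \notin S0 by apply: contra (sub1 k) kS1.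
have nU : ~ (((Np `\` signed_fix (w, eps) Np 1) `|`
  (Nm `\` signed_fix (w, eps) Nm (-1))) k) by rewrite hS0 /=; apply/negP.
have [pk|pk] := boolP (pos k).
  have Nk : Np k by apply/hNp.
  by apply: contrapT => nk; apply: nU; left; split=> // -[_ [/= wk ek]]; apply: nk.
have Nk : Nm k by apply/hNm.
by apply: contrapT => nk; apply: nU; right; split=> // -[_ [/= wk ek]]; apply: nk.
Qed.

End Balanced.

(** * Orbits *)

Section Orbits.
Variables (R : realType) (V : lmodType R[i]) (E : nat -> V).
Hypothesis hE : is_basis E.
Variables (t : flag_type) (Omega : nat -> nat -> R[i]).
Hypothesis hOmega : is_Omega (epsilon_of t) Omega.
Variable (iota : nat -> nat).
Hypothesis hiota : forall l m : nat, omega E Omega (E l) (E m) != 0 <-> m = iota l.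
Variables (Np Nm : set nat).
Hypotheses (hcover : Np `|` Nm = [set: nat]) (hdisj : Np `&` Nm = set0).
Hypothesis heta : eta_compatible (eta_of t) iota Np Nm.
Variables (d : Order.disp_t) (A : orderType d) (sigma : nat -> A).
Hypothesis hsigma : bijective sigma.
Hypothesis hiso : isotropic E Omega (Fl sigma E).

Local Notation C := (R[i] : numClosedFieldType).
Let e : C := (epsilon_of t)%:~R.
Let eta : C := (eta_of t)%:~R.
Let pos k : bool := k \in Np.
Let om : V -> V -> C := omega E Omega.
Let ph : V -> V -> C := phi E Np.
Let dl : V -> V := delta E Np.

Lemma eps2 : epsilon_of t * epsilon_of t = 1.
Proof. by case: t. Qed.

Lemma eta2 : eta_of t * eta_of t = 1.
Proof. by case: t. Qed.

Lemma om_E k l : om (E k) (E l) = Omega k l.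
Proof. exact (coord_form_basis hE Omega k l). Qed.

Lemma om_form : eps_form e om.
Proof.
have ee : e * e = 1 by rewrite /e -intrM eps2.
have sym k l : Omega l k = e * Omega k l by case: (Omega_cases eps2 hOmega k l).
exact (coord_eps_form hE ee sym).
Qed.

Lemma om_star : starred_by om iota E.
Proof.
move=> k l; apply/idP/eqP => h; first exact/(hiota k l).
exact/(hiota k l).
Qed.

Lemma iotaK : involutive iota.
Proof.
move=> k; apply/esym/eqP; rewrite -om_star (om_neq0C om_form) // om_star.
exact: eqxx.
Qed.

Lemma om_val k : om (E k) (E (iota k)) * om (E k) (E (iota k)) = 1.
Proof.
have : om (E k) (E (iota k)) != 0 by rewrite om_star.
rewrite om_E; case: (Omega_cases eps2 hOmega k (iota k)) => _ [->|->] _ //.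
by rewrite eqxx.
Qed.

Lemma om_val1 : e = 1 -> forall k, om (E k) (E (iota k)) = 1.
Proof.
move=> e1 k; have : om (E k) (E (iota k)) != 0 by rewrite om_star.
rewrite om_E; have e1' : epsilon_of t = 1 by apply: (@intr_inj C).
by case: (Omega_cases eps2 hOmega k (iota k)) => _ _ /(_ e1')[->|->//]; rewrite eqxx.
Qed.

(** The orthogonal of the member of the flag of [E] cut at [iota k] is the span of the [E_j]
    with [iota j] above [iota k], and it is again a member of the flag, so the set of these
    [j] is closed downwards. *)
Lemma iota_anti k l : (sigma k <= sigma l)%O -> (sigma (iota l) <= sigma (iota k))%O.
Proof.
move=> kl; rewrite leNgt; apply/negP => lt.
have : Fl sigma E (lspan E (upto sigma (iota k))) by apply/(FlP hsigma); exists (iota k); right.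
move=> /hiso[/(Fl_lower hsigma)[P lP hP] _].
have h := starred_orth om_form iotaK (upto sigma (iota k)) hE om_star.
have hPE : lspan E P = lspan E [set j | ~ upto sigma (iota k) (iota j)] by rewrite -h -hP.
have Pl : P l.
  apply: contrapT => nP; have : lspan E P (E l).
    by rewrite hPE; apply: lspan_mem; rewrite /upto /= => /(lt_le_trans lt); rewrite ltxx.
  move/(lspan_coord hE) => /(_ l nP); rewrite (bcoord_basis hE) eqxx => /eqP.
  by rewrite oner_eq0.
have Pk := lP _ _ Pl kl.
have : lspan E [set j | ~ upto sigma (iota k) (iota j)] (E k).
  by rewrite -hPE; apply: lspan_mem.
move/(lspan_coord hE) => /(_ k); rewrite (bcoord_basis hE) eqxx /upto /= lexx => h1.
by have /eqP := h1 (fun nh => nh isT); rewrite oner_eq0.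
Qed.

Lemma setting : iso_setting e om E iota sigma.
Proof.
split; [exact: om_form|exact: hE|exact: om_star|exact: iotaK|exact: bij_inj hsigma|].
exact: iota_anti.
Qed.

Lemma NpP k : Np k <-> pos k.
Proof. by split=> [|/set_mem//]; exact: mem_set. Qed.

Lemma NmP k : Nm k <-> ~~ pos k.
Proof.
split=> [Nk|/negP nk].
  by apply/negP => /NpP Pk; have : (Np `&` Nm) k by []; rewrite hdisj.
have : (Np `|` Nm) k by rewrite hcover.
by case=> // /NpP.
Qed.

Lemma sg_iota k : sg C pos (iota k) = eta * sg C pos k.
Proof.
suff : pos (iota k) = if eta_of t == 1 then pos k else ~~ pos k.
  rewrite /sg /eta => ->; case: t; case: (pos k) => //=;
  by rewrite ?mul1r ?mulN1r ?opprK.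
move: heta; rewrite /eta_compatible; case: ifP => _ => [[h _]|h].
  apply/idP/idP => /NpP Pk; apply/NpP.
    by rewrite -[k]iotaK -h; exists (iota k).
  by rewrite -h; exists k.
apply/idP/idP => [/NpP Pk|/NmP].
  by apply/NmP; rewrite -h; exists (iota k); rewrite ?iotaK.
by rewrite -h => -[j Pj <-]; apply/NpP; rewrite iotaK.
Qed.

Lemma geom : geometry e eta om ph dl E iota pos sigma.
Proof.
split.
- exact: setting.
- exact: om_val.
- exact (coord_phi_sesq hE Np).
- exact (coord_phi_diag hE Np).
- exact (coord_deltaZD hE Np).
- exact (coord_deltaE hE Np).
- by rewrite /eta -intrM eta2.
- exact: sg_iota.
Qed.

Implicit Types (v : nat -> V) (p : (nat -> nat) * (nat -> int)).

Lemma wconjugateP p v : wconjugate E Np p v <->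
  cofin_basis E v /\ conjugate_by dl p.1 p.2 v.
Proof.
split=> [[ev hv]|[ev hv]]; split=> // k.
  rewrite /pair_coef; case: eqP => wk; first by rewrite wk; exact (proj2 (hv k) wk).
  by rewrite scale1r; exact (proj1 (hv k) wk).
have := hv k; rewrite /pair_coef; case: eqP => wk h; split=> // wk'; rewrite /dl in h.
  by rewrite h wk'.
by rewrite h scale1r.
Qed.

Lemma wdualP p v : wdual E Np p v <-> cofin_basis E v /\ dual_by ph p.1 p.2 v.
Proof.
split=> [[ev hv]|[ev hv]]; split=> // k l.
  have [h1 [h2 h3]] := hv k l.
  have [lw|/eqP lw] := eqVneq l (p.1 k); last exact: h1.
  rewrite /pair_coef -lw; case: eqP => lk; first exact: h3.
  exact: h2.
have := hv k l; rewrite /ph => h; split=> [lw|].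
  by rewrite h ifN //; apply/eqP.
split=> lw lk; rewrite h lw eqxx /pair_coef -lw; case: eqP => //.
Qed.

Lemma starredP v : starred E Omega iota v <-> starred_by om iota v.
Proof.
split=> [h k l|h k l]; first by apply/idP/eqP => h'; apply/(h k l).
by rewrite -/(om (v k) (v l)) (h k l); split=> /eqP.
Qed.

Lemma XFP F : XF E sigma F <-> exists2 v, cofin_basis E v & F = Fl sigma v.
Proof.
by rewrite (XFE hE hsigma); split=> [[v ev <-]|[v ev ->]]; exists v.
Qed.

Lemma isotropic_starred v : is_basis v -> starred_by om iota v ->
  isotropic E Omega (Fl sigma v).
Proof.
move=> bv sv S hS.
have so P := starred_orth om_form iotaK P bv sv.
have oo P : orth om (orth om (lspan v P)) = lspan v P.
  rewrite !so; congr lspan; apply/seteqP; split=> k /=; rewrite iotaK; first exact: contrapT.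
  by move=> Pk nPk; apply: nPk.
have perpE F : perp E Omega F = orth om F by [].
move/(FlP hsigma): hS => [k [->|->]]; rewrite !perpE oo; split=> //; rewrite so;
  apply/(FlP hsigma); exists (iota k).
- right; congr lspan; apply/seteqP; split=> l; rewrite /below /upto /=.
    by move/negP; rewrite -leNgt -(iota_leE setting) iotaK.
  by rewrite -(iota_leE setting) iotaK => h; apply/negP; rewrite -leNgt.
- left; congr lspan; apply/seteqP; split=> l; rewrite /below /upto /=.
    by move/negP; rewrite -ltNge -(iota_ltE setting) iotaK.
  by rewrite -(iota_ltE setting) iotaK => h; apply/negP; rewrite -ltNge.
Qed.

Lemma antitri_isotropic v : cofin_basis E v -> isotropic E Omega (Fl sigma v) ->
  antitri om iota sigma v.
Proof.
move=> ev iv; apply: (isotropic_antitri setting ev) => k.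
  have : Fl sigma v (lspan v (upto sigma k)) by apply/(FlP hsigma); exists k; right.
  by move=> /iv[/(Fl_lower hsigma)[P lP hP] _]; exists P.
have : Fl sigma v (lspan v (below sigma k)) by apply/(FlP hsigma); exists k; left.
by move=> /iv[/(Fl_lower hsigma)[P lP hP] _]; exists P.
Qed.

Lemma XFomega_starred v : cofin_basis E v -> starred_by om iota v ->
  XFomega E Omega sigma (Fl sigma v).
Proof.
by move=> ev sv; split; [apply/XFP; exists v|apply: isotropic_starred => //; case: ev].
Qed.

Lemma Iinf_type_signed p : Iinf_type t iota Np Nm p -> signed_invol p.1 p.2.
Proof. by case=> [[wK [he _]] _]. Qed.

Lemma pair_coef_sg w eps k : signed_invol w eps -> w k = k ->
  (pair_coef C w eps k = sg C pos k <-> eps k = if pos k then 1 else -1).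
Proof.
move=> sw wk; rewrite /pair_coef /sg wk eqxx; split=> [h|->]; last by case: (pos k).
by apply: (@intr_inj C); rewrite h; case: (pos k).
Qed.

(** In a window, the counting condition is the equality of counts that [both_exists] needs. *)
Lemma Iinf_type_exists p : Iinf_type t iota Np Nm p ->
  exists v, [/\ cofin_basis E v, starred_by om iota v,
    conjugate_by dl p.1 p.2 v & dual_by ph p.1 p.2 v].
Proof.
case: p => w eps hI; have sw : signed_invol w eps := Iinf_type_signed hI.
have [wK he] := sw.
case: hI => [[_ [_ [b1 b2]]] [comm [hfix noi]]].
rewrite /= in comm hfix noi.
have [S [uS wS iS offS]] := Iinf_window NpP NmP wK iotaK comm b1 b2.
have cnt := (balanced_count NpP NmP wK he uS wS offS).1 (conj b1 b2).
apply: (both_exists geom om_val1 sw comm _ _ uS wS iS _ cnt).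
- move=> k wk; rewrite /pair_coef -comm (inj_eq (inv_inj iotaK)) wk eqxx.
  by rewrite hfix // intrM.
- move=> h; apply: noi; apply: (@intr_inj C); rewrite intrM -/eta -/e h.
  by rewrite rmorphN rmorph1.
- by move=> k kS; have [wk ek] := offS k kS; split=> //; apply/pair_coef_sg.
Qed.

Lemma Iinf_type_intro w eps v : cofin_basis E v -> signed_invol w eps ->
  conjugate_by dl w eps v \/ dual_by ph w eps v ->
  [/\ forall k, iota (w k) = w (iota k),
      forall k, w k = k -> (eps (iota k))%:~R = eta * (eps k)%:~R :> C &
      eta * e = -1 -> forall k, w k <> iota k] ->
  Iinf_type t iota Np Nm (w, eps).
Proof.
move=> ev sw cdv [comm hfix noi]; have [wK he] := sw.
have fixE k : v k = E k -> w k = k /\ pair_coef C w eps k = sg C pos k.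
  move=> vk; case: cdv => h; first exact (conj_fix geom (proj1 ev) sw h vk).
  exact (dual_fix geom h vk).
have [S0 aS0] := adapted_exists hE (proj2 ev).
have [S [uS sub wS _]] := invol_closure S0 wK.
have aS := adapted_mono aS0 uS sub.
have offS k : k \notin S -> w k = k /\ eps k = if pos k then 1 else -1.
  move=> kS; have [wk fk] : w k = k /\ pair_coef C w eps k = sg C pos k.
    by apply: fixE; case: aS => _ h _; apply: h.
  by split=> //; apply/(pair_coef_sg sw wk).
have cnt := plus_index_count geom sw ev aS wS cdv.
have [b1 b2] := (balanced_count NpP NmP wK he uS wS offS).2 cnt.
split; first by split=> //; split.
split=> //; split=> [k wk|h k].
  by apply: (@intr_inj C); rewrite intrM; exact: hfix.
by apply: noi; rewrite /eta /e -intrM h rmorphN rmorph1.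
Qed.

Lemma conjugate_by_coef w eps w' eps' v :
  w = w' /\ (forall k, pair_coef C w eps k = pair_coef C w' eps' k) ->
  conjugate_by dl w eps v <-> conjugate_by dl w' eps' v.
Proof. by move=> [-> h]; split=> hv k; rewrite hv h. Qed.

Lemma dual_by_coef w eps w' eps' v :
  w = w' /\ (forall k, pair_coef C w eps k = pair_coef C w' eps' k) ->
  dual_by ph w eps v <-> dual_by ph w' eps' v.
Proof. by move=> [-> h]; split=> hv k l; rewrite hv h. Qed.

(** An isotropic flag with a conjugate basis also has a starred conjugate basis for some pair,
    which must be the same pair by uniqueness. *)
Lemma OOomegaE p : Iinf_type t iota Np Nm p ->
  OOomega E Omega Np sigma p = [set Fl sigma v |
    v in [set v | wconjugate E Np p v /\ starred E Omega iota v]].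
Proof.
move=> hI; have sw := Iinf_type_signed hI; apply/seteqP; split=> F.
  move=> [[_ [v /wconjugateP[ev cv] <-]] [_ iv]].
  have av := antitri_isotropic ev iv.
  have [w' [eps' [v' [sw' ev' sv' sf cv']]]] := conjugate_exists geom ev av.
  have hw := conj_pair_uniq geom (proj1 ev') (proj1 ev) (same_flag_sym sf) sw' sw cv' cv.
  exists v'; last by rewrite (same_flag_Fl hsigma sf).
  split; last exact/starredP.
  by apply/wconjugateP; split=> //; apply/(conjugate_by_coef _ hw).
move=> [v [/wconjugateP[ev cv] /starredP sv] <-].
have hX := XFomega_starred ev sv.
split=> //; split; first by case: hX.
by exists v => //; apply/wconjugateP.
Qed.

Lemma OOfrakomegaE p : Iinf_type t iota Np Nm p ->
  OOfrakomega E Omega Np sigma p = [set Fl sigma v |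
    v in [set v | wdual E Np p v /\ starred E Omega iota v]].
Proof.
move=> hI; have sw := Iinf_type_signed hI; apply/seteqP; split=> F.
  move=> [[_ [v /wdualP[ev dv] <-]] [_ iv]].
  have av := antitri_isotropic ev iv.
  have [w' [eps' [v' [sw' ev' sv' sf dv']]]] := dual_exists geom ev av.
  have hw := dual_pair_uniq geom (proj1 ev') (proj1 ev) (same_flag_sym sf) sw' sw dv' dv.
  exists v'; last by rewrite (same_flag_Fl hsigma sf).
  split; last exact/starredP.
  by apply/wdualP; split=> //; apply/(dual_by_coef _ hw).
move=> [v [/wdualP[ev dv] /starredP sv] <-].
have hX := XFomega_starred ev sv.
split=> //; split; first by case: hX.
by exists v => //; apply/wdualP.
Qed.

Lemma OO_bothE p : Iinf_type t iota Np Nm p ->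
  OOomega E Omega Np sigma p `&` OOfrakomega E Omega Np sigma p = [set Fl sigma v |
    v in [set v | wconjugate E Np p v /\ wdual E Np p v /\ starred E Omega iota v]].
Proof.
move=> hI; have sw := Iinf_type_signed hI; apply/seteqP; split=> F.
  move=> [[[_ [v1 /wconjugateP[ev1 cv1] <-]] [_ iv]] [[_ [v2 /wdualP[ev2 dv2] hF]] _]].
  have av := antitri_isotropic ev1 iv.
  have sf := Fl_same_flag hE hsigma ev1 ev2 (esym hF).
  have [u [eu su sfu cu du]] := common_basis geom ev1 ev2 av sf sw cv1 dv2.
  exists u; last by rewrite (same_flag_Fl hsigma sfu).
  by split; [apply/wconjugateP|split; [apply/wdualP|apply/starredP]].
move=> [v [cv [dv sv]] <-].
by split; [rewrite OOomegaE //|rewrite OOfrakomegaE //]; exists v.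
Qed.

(** The booleans [c] and [dd] ask for compatibility with [delta] and with [phi], so this covers
    the two groups and their intersection. Transitivity: once [match_values] has adjusted the
    values of [om], all the structures involved take the same values on the two bases, so the
    linear map carrying one to the other preserves them. *)
Lemma orbitE (c dd : bool) (Hs : set {linear V -> V}) w eps v :
  (forall g, Hs g <-> GEomega E Omega g /\
     (c -> forall x, dl (g x) = g (dl x)) /\
     (dd -> forall x y, ph (g x) (g y) = ph x y)) ->
  signed_invol w eps -> cofin_basis E v -> starred_by om iota v ->
  (c -> conjugate_by dl w eps v) -> (dd -> dual_by ph w eps v) ->
  flag_orbit Hs (Fl sigma v) = [set Fl sigma u | u in
    [set u | [/\ cofin_basis E u, starred_by om iota u,
       c -> conjugate_by dl w eps u & dd -> dual_by ph w eps u]]].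
Proof.
move=> hHs sw ev sv cv dv; rewrite (flag_orbit_Fl hsigma); apply/seteqP; split=> F.
  move=> [g /hHs[[Gg og] [cg dg]] <-]; exists (g \o v) => //; split.
  - exact (GE_cofin hE Gg ev).
  - by move=> k l; rewrite /om /= og; exact: sv.
  - move=> hc k; rewrite /= (cg hc) (cv hc).
    by rewrite linearZ.
  - by move=> hd k l; rewrite /= (dg hd) (dv hd).
move=> [u [eu su cu du] <-].
have [u' [eu' sf om' cu' du']] := match_values geom ev eu sv su sw.
have [g [bg hg]] := change_of_basis (proj1 eu') (proj1 eu).
have bu' := proj1 eu'.
have gD a x y := linear_ZD g a x y.
exists g; last first.
  rewrite -(Fl_image hsigma) (same_flag_Fl hsigma sf) (Fl_image hsigma).
  by congr Fl; apply/funext => k; exact: hg.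
have oH := om_form; have P := g_sesqui geom; have dD := deltaZD geom.
apply/hHs; split; [split; [split=> //|]|split].
- apply: finite_change (proj2 eu') (proj2 eu) _ => k uk /= /negP/negPn/eqP.
  by rewrite -{2}uk hg.
- rewrite -/om; apply: (basis_ind bu') => [y|a x x' hx hx' y|k].
  + by rewrite linear0 -/om !(om0l oH).
  + by rewrite gD -/om !(omDl oH) !(omZl oH) hx hx'.
  apply: (basis_ind bu') => [|a x x' hx hx'|l].
  + by rewrite linear0 -/om !(om0r oH).
  + by rewrite gD -/om !(omDr oH) !(omZr oH) hx hx'.
  by rewrite !hg -/om om'.
- move=> hc; have cu'' := cu' (cv hc) (cu hc).
  apply: (basis_ind bu') => [|a x x' hx hx'|k].
  + by rewrite linear0 (delta0 geom) linear0.
  + by rewrite gD !dD hx hx' gD.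
  by rewrite hg (cu hc) cu'' linearZ /= hg.
- move=> hd; have du'' := du' (dv hd) (du hd).
  apply: (basis_ind bu') => [y|a x x' hx hx' y|k].
  + by rewrite linear0 !(ph0l P).
  + by rewrite gD !(ph_ZDl P) hx hx'.
  apply: (basis_ind bu') => [|a x x' hx hx'|l].
  + by rewrite linear0 !(ph0r P).
  + by rewrite gD !(ph_ZDr P) hx hx'.
  by rewrite !hg (du hd) du''.
Qed.

Lemma K_orbitE p v : Iinf_type t iota Np Nm p -> cofin_basis E v ->
  starred_by om iota v -> conjugate_by dl p.1 p.2 v ->
  flag_orbit (KK E Omega Np) (Fl sigma v) = OOomega E Omega Np sigma p.
Proof.
move=> hI ev sv cv; rewrite OOomegaE //.
rewrite (@orbitE true false _ p.1 p.2) //; first 1 last.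
- by move=> g; split=> [[hg hd]|[hg [hd _]]]; split=> //; exact: hd.
- exact: Iinf_type_signed hI.
apply/seteqP; split=> F [u hu <-]; exists u => //; move: hu.
  by move=> [eu su cu _]; split; [apply/wconjugateP; split=> //; exact: cu|apply/starredP].
by move=> [/wconjugateP[eu cu] /starredP su]; split.
Qed.

Lemma G0_orbitE p v : Iinf_type t iota Np Nm p -> cofin_basis E v ->
  starred_by om iota v -> dual_by ph p.1 p.2 v ->
  flag_orbit (G0 E Omega Np) (Fl sigma v) = OOfrakomega E Omega Np sigma p.
Proof.
move=> hI ev sv dv; rewrite OOfrakomegaE //.
rewrite (@orbitE false true _ p.1 p.2) //; first 1 last.
- by move=> g; split=> [[hg hd]|[hg [_ hd]]]; split=> //; exact: hd.
- exact: Iinf_type_signed hI.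
apply/seteqP; split=> F [u hu <-]; exists u => //; move: hu.
  by move=> [eu su _ du]; split; [apply/wdualP; split=> //; exact: du|apply/starredP].
by move=> [/wdualP[eu cu] /starredP su]; split.
Qed.

Lemma K_G0_orbitE p v : Iinf_type t iota Np Nm p -> cofin_basis E v ->
  starred_by om iota v -> conjugate_by dl p.1 p.2 v -> dual_by ph p.1 p.2 v ->
  flag_orbit (KK E Omega Np `&` G0 E Omega Np) (Fl sigma v) =
  OOomega E Omega Np sigma p `&` OOfrakomega E Omega Np sigma p.
Proof.
move=> hI ev sv cv dv; rewrite OO_bothE //.
rewrite (@orbitE true true _ p.1 p.2) //; first 1 last.
- move=> g; split=> [[[hg hd] [_ hp]]|[hg [hd hp]]]; split=> //; split=> //;
  [exact: hd|exact: hp].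
- exact: Iinf_type_signed hI.
apply/seteqP; split=> F [u hu <-]; exists u => //; move: hu.
  move=> [eu su cu du]; split; first by apply/wconjugateP; split=> //; exact: cu.
  by split; [apply/wdualP; split=> //; exact: du|apply/starredP].
by move=> [/wconjugateP[eu cu] [/wdualP[_ du] /starredP su]]; split.
Qed.

End Orbits.

Theorem proposition9 (R : realType) (V : lmodType R[i]) (E : nat -> V)
    (hE : is_basis E) (t : flag_type)
    (Omega : nat -> nat -> R[i]) (hOmega : is_Omega (epsilon_of t) Omega)
    (iota : nat -> nat)
    (hiota : forall l m : nat, omega E Omega (E l) (E m) != 0 <-> m = iota l)
    (Np Nm : set nat)
    (hcover : Np `|` Nm = [set: nat]) (hdisj : Np `&` Nm = set0)
    (hNp : Np !=set0) (hNm : Nm !=set0)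
    (heta : eta_compatible (eta_of t) iota Np Nm)
    (d : Order.disp_t) (A : orderType d) (sigma : nat -> A)
    (hsigma : bijective sigma)
    (hiso : isotropic E Omega (Fl sigma E)) :
  let I := Iinf_type t iota Np Nm in
  let Xw := XFomega E Omega sigma in
  let O := OOomega E Omega Np sigma in
  let Of := OOfrakomega E Omega Np sigma in
  let K := KK E Omega Np in
  let G := G0 E Omega Np in
  (forall p : (nat -> nat) * (nat -> int), I p ->
     (O p = [set Fl sigma v |
               v in [set v | wconjugate E Np p v /\ starred E Omega iota v]] /\
      O p !=set0) /\
     (Of p = [set Fl sigma v |
                v in [set v | wdual E Np p v /\ starred E Omega iota v]] /\
      Of p !=set0) /\
     (O p `&` Of p =
        [set Fl sigma v |
           v in [set v | wconjugate E Np p v /\ wdual E Np p v /\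
                         starred E Omega iota v]] /\
      O p `&` Of p !=set0)) /\
  [set O p | p in I] = [set flag_orbit K F | F in Xw] /\
  [set Of p | p in I] = [set flag_orbit G F | F in Xw] /\
  (forall p : (nat -> nat) * (nat -> int), I p ->
     exists F, Xw F /\ O p `&` Of p = flag_orbit (K `&` G) F).
Proof.
move=> I Xw O Of K G.
have ex p (hp : I p) := Iinf_type_exists hE hOmega hiota hcover hdisj heta hsigma hiso hp.
have g := geom hE hOmega hiota hcover hdisj heta hsigma hiso.
have starX := XFomega_starred hE hOmega hiota hsigma hiso.
have anti := antitri_isotropic hE hOmega hiota hsigma hiso.
have intro := Iinf_type_intro hE hOmega hiota hcover hdisj heta hsigma hiso.
have eK := K_orbitE hE hOmega hiota hcover hdisj heta hsigma hiso.
have eG := G0_orbitE hE hOmega hiota hcover hdisj heta hsigma hiso.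
have eKG := K_G0_orbitE hE hOmega hiota hcover hdisj heta hsigma hiso.
have bothE := OO_bothE hE hOmega hiota hcover hdisj heta hsigma hiso.
have both p (hp : I p) : exists F, (O p `&` Of p) F.
  have [v [ev sv cv dv]] := ex p hp; exists (Fl sigma v).
  rewrite /O /Of bothE //; exists v => //.
  by split; [apply/wconjugateP|split; [apply/wdualP|apply/starredP]].
split; [|split; [|split]].
- move=> p hp; have [F [hF hF']] := both p hp; split; [|split].
  + split; last by exists F.
    exact: (OOomegaE hE hOmega hiota hcover hdisj heta hsigma hiso).
  + split; last by exists F.
    exact: (OOfrakomegaE hE hOmega hiota hcover hdisj heta hsigma hiso).
  + by split; [exact: bothE|exists F].
- apply/seteqP; split=> Q [].
    move=> p hp <-; have [v [ev sv cv dv]] := ex p hp.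
    by exists (Fl sigma v); [exact: starX|exact: eK].
  move=> F [/(XFP hE hsigma)[v ev ->] iv] <-.
  have [w [eps [u [sw eu su sf cu]]]] := conjugate_exists g ev (anti v ev iv).
  have hp : I (w, eps).
    apply: (intro w eps u eu sw (or_introl cu)).
    exact: (conj_admissible g (proj1 eu) su sw cu).
  by exists (w, eps) => //; rewrite (same_flag_Fl hsigma sf) (eK _ u hp).
- apply/seteqP; split=> Q [].
    move=> p hp <-; have [v [ev sv cv dv]] := ex p hp.
    by exists (Fl sigma v); [exact: starX|exact: eG].
  move=> F [/(XFP hE hsigma)[v ev ->] iv] <-.
  have [w [eps [u [sw eu su sf du]]]] := dual_exists g ev (anti v ev iv).
  have hp : I (w, eps).
    apply: (intro w eps u eu sw (or_intror du)).
    exact: (dual_admissible g (proj1 eu) su sw du).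
  by exists (w, eps) => //; rewrite (same_flag_Fl hsigma sf) (eG _ u hp).
- move=> p hp; have [v [ev sv cv dv]] := ex p hp.
  by exists (Fl sigma v); split; [exact: starX|rewrite (eKG p v)].
Qed.
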